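(* For semi-density matrices $\rho$, $\sigma$ on $n$ qubits and $i,j\in\mathbb{N}$, relativized to an elementary POVM $E$, $\mathbf{I}(i:j/n)+\log E\sigma(i)E\rho(j)-\mathbf{K}(\mathbf{I}(i:j/n)/n)<^{+}\mathbf{I}(\sigma:\rho)$.
   Context: $U$ is a fixed universal prefix Turing machine; $\mathbf{K}(x/y)$ is prefix Kolmogorov complexity and $\mathbf{m}(x/y)=\sum_p 2^{-\|p\|}[U_y(p)=x]$ the universal probability. Classical algorithmic mutual information is $\mathbf{I}(x:y/c)=\mathbf{K}(x/c)+\mathbf{K}(y/c)-\mathbf{K}(x,y/c)$. An object is elementary if its entries have rational real and imaginary parts. A POVM $E$ is a set of positive matrices $\{E_k\}$ with $\sum_kE_k=I$; it is elementary if a program enumerates $\{E_k\}$ with each $E_k$ elementary; $E\sigma(k)=\mathrm{Tr}\,E_k\sigma$. A program $q$ lower computes a positive semidefinite matrix $\nu$ if $U(q)$ outputs an increasing sequence of elementary semi-density matrices converging to $\nu$; $\underline{\mathbf{m}}(\nu/x)=\sum\{\mathbf{m}(q/x): q\text{ lower computes }\nu\}$. The universal semi-density matrix on $n$ qubits is $\boldsymbol{\mu}=\sum_{\text{elementary }|\phi\rangle}\mathbf{m}(|\phi\rangle/n)|\phi\rangle\langle\phi|$. Let $\mathcal{C}_{C\otimes D}$ be the set of lower computable matrices $A\otimes B$ with $\mathrm{Tr}(A\otimes B)(C\otimes D)\le1$, $\mathfrak{C}_{C\otimes D}=\sum_{A\otimes B\in\mathcal{C}_{C\otimes D}}\underline{\mathbf{m}}(A\otimes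 B/n)A\otimes B$, and the quantum mutual information is $\mathbf{I}(\sigma:\rho)=\log\mathrm{Tr}\,\mathfrak{C}_{\boldsymbol{\mu}\otimes\boldsymbol{\mu}}(\sigma\otimes\rho)$. $f<^{+}g$ means $f<g+O(1)$.
   Formalization: ''Lower computes'' here uses increasing elementary positive semidefinite matrices of unrestricted trace, not semi-density matrices: with trace at most 1, I(σ:ρ) ≤ 0 always and the claim fails (i=j random, E the computational basis, σ=ρ=|i><i|). *)

(* Defs.v *)
From mathcomp Require Import all_boot all_order all_algebra.
From mathcomp Require Import sesquilinear spectral.
From mathcomp Require Import all_classical all_reals all_analysis.
From mathcomp Require Import complex mxtens.

Set Implicit Arguments.
Unset Strict Implicit.
Unset Printing Implicit Defensive.

Import Order.TTheory GRing.Theory Num.Theory ComplexField.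
Import numFieldNormedType.Exports.

Local Open Scope classical_set_scope.
Local Open Scope ring_scope.
Local Open Scope complex_scope.
Local Open Scope sesquilinear_scope.

(* Algorithms are Kleene's partial recursive functions.  Argument lists are
   untyped; missing arguments read as 0. *)
Inductive recfun : Type :=
| RZero
| RSucc
| RProj of nat
| RComp of recfun & seq recfun
| RPrec of recfun & recfun
| RMu of recfun.

Inductive eval : recfun -> seq nat -> nat -> Prop :=
| EvalZero xs : eval RZero xs 0
| EvalSucc xs : eval RSucc xs (nth 0%N xs 0).+1
| EvalProj i xs : eval (RProj i) xs (nth 0%N xs i)
| EvalComp f gs xs ys z :
    size ys = size gs ->
    (forall k, (k < size gs)%N -> eval (nth RZero gs k) xs (nth 0%N ys k)) ->
    eval f ys z -> eval (RComp f gs) xs z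
| EvalPrec0 f g xs y : eval f xs y -> eval (RPrec f g) (0%N :: xs) y
| EvalPrecS f g n xs y z :
    eval (RPrec f g) (n :: xs) y -> eval g (n :: y :: xs) z ->
    eval (RPrec f g) (n.+1 :: xs) z
| EvalMu f xs n (h : nat -> nat) :
    (forall k, (k < n)%N -> eval f (k :: xs) (h k).+1) ->
    eval f (n :: xs) 0%N -> eval (RMu f) xs n.

(* [runs T y p x] is T_y(p) = x.  Finite objects are identified with natural
   numbers through [pickle], which is effective on all the types used below. *)
Definition runs (X Y : countType) (T : recfun) (y : Y) (p : seq bool) (x : X) :
  Prop := eval T [:: pickle y; pickle p] (pickle x).

Definition prefix_free (T : recfun) : Prop :=
  forall (y : nat) (p s : seq bool), s != [::] ->
    (exists x : nat, runs T y p x) -> ~ exists x : nat, runs T y (p ++ s) x.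

Definition universal (U : recfun) : Prop :=
  prefix_free U /\
  forall T, prefix_free T -> exists t : seq bool,
    forall (y : nat) (p : seq bool) (x : nat),
      runs U y (t ++ p) x <-> runs T y p x.

(* U relativized to a finite object e has e on an additional auxiliary tape:
   U^e_y is U_(e, y), and the unrelativized machine is the case e = [::].
   As the values of U are finite, a program is said to output an infinite
   sequence when it computes the k-th term from k on the auxiliary tape. *)
Definition outputs (X : countType) (U : recfun) (e q : seq bool)
    (s : nat -> X) : Prop := forall k, runs U (e, k) q (s k).

(* Every x has a program when U is universal, so that the default value 0 of
   [xget] is not used. *)
Definition Kpref (X Y : countType) (U : recfun) (x : X) (y : Y) : nat :=
  xget 0%N [set k | (exists2 p, runs U y p x & size p = k) /\
                    forall p, runs U y p x -> (k <= size p)%N].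

Definition mutual_info (X X' Y : countType) (U : recfun) (x : X) (x' : X')
    (c : Y) : int :=
  (Kpref U x c)%:Z + (Kpref U x' c)%:Z - (Kpref U (x, x') c)%:Z.

(* Unordered sum; meaningful for absolutely summable families. *)
Definition rsum (R : realType) (T : choiceType) (D : set T) (f : T -> R) : R :=
  fine (\esum_(t in D) (Num.max (f t) 0)%:E) -
  fine (\esum_(t in D) (Num.max (- f t) 0)%:E).

Definition mxsum (R : realType) (T : choiceType) (D : set T) m n
    (F : T -> 'M[R[i]]_(m, n)) : 'M[R[i]]_(m, n) :=
  \matrix_(a, b) (rsum D (fun t => complex.Re (F t a b)) +i*
                  rsum D (fun t => complex.Im (F t a b))).

Definition mx_cvg (R : realType) m n (s : nat -> 'M[R[i]]_(m, n))
    (A : 'M[R[i]]_(m, n)) : Prop :=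
  forall a b,
    (complex.Re (s k a b) @[k --> \oo] --> complex.Re (A a b)) /\
    (complex.Im (s k a b) @[k --> \oo] --> complex.Im (A a b)).

Definition univ_prob (R : realType) (X Y : countType) (U : recfun) (x : X)
    (y : Y) : R :=
  rsum [set p | runs U y p x] (fun p => 2^-1 ^+ size p).

(* Over R[i], 0 <= z means that z is real and nonnegative, so psd matrices are
   Hermitian. *)
Definition psd (R : realType) N (A : 'M[R[i]]_N) : Prop :=
  forall v : 'cV[R[i]]_N, 0 <= (v^t* *m A *m v) 0 0.

Definition semi_density (R : realType) N (A : 'M[R[i]]_N) : Prop :=
  psd A /\ \tr A <= 1.

(* Elementary objects are (encoded as) matrices over rat[i]. *)
Definition elem_mx (R : realType) m n (A : 'M[rat[i]]_(m, n)) :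
    'M[R[i]]_(m, n) :=
  map_mx (fun z => ratr (complex.Re z) +i* ratr (complex.Im z)) A.

(* A finite measurement is padded with zero matrices. *)
Definition POVM (R : realType) N (E : nat -> 'M[R[i]]_N) : Prop :=
  (forall k, psd (E k)) /\ mx_cvg (fun m => \sum_(k < m) E k) 1%:M.

Definition enumerates (R : realType) (U : recfun) N (e : seq bool)
    (E : nat -> 'M[R[i]]_N) : Prop :=
  exists s : nat -> 'M[rat[i]]_N,
    outputs U [::] e s /\ forall k, E k = elem_mx R (s k).

(* The trace is real when E_k and sigma are positive. *)
Definition measure_prob (R : realType) N (E : nat -> 'M[R[i]]_N)
    (sigma : 'M[R[i]]_N) (k : nat) : R := complex.Re (\tr (E k *m sigma)).

(* Below, everything is relativized to e.  The approximations are positive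
   semidefinite of unrestricted trace, as are the limits nu. *)
Definition lower_computes (R : realType) (U : recfun) (e : seq bool) N
    (q : seq bool) (nu : 'M[R[i]]_N) : Prop :=
  exists s : nat -> 'M[rat[i]]_N,
    [/\ outputs U e q s,
        forall k, psd (elem_mx R (s k)),
        forall k, psd (elem_mx R (s k.+1) - elem_mx R (s k)) &
        mx_cvg (fun k => elem_mx R (s k)) nu].

Definition lower_prob (R : realType) (U : recfun) (e : seq bool)
    (X : countType) N (nu : 'M[R[i]]_N) (x : X) : R :=
  rsum [set q | lower_computes U e q nu] (fun q => univ_prob R U q (e, x)).

(* The sum ranges over pure states, i.e. unit vectors. *)
Definition universal_mx (R : realType) (U : recfun) (e : seq bool) (n : nat) :
    'M[R[i]]_(2 ^ n) :=
  mxsum [set phi : 'cV[rat[i]]_(2 ^ n) |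
           ((elem_mx R phi)^t* *m elem_mx R phi) 0 0 = 1]
        (fun phi => (univ_prob R U phi (e, n))%:C *:
                    (elem_mx R phi *m (elem_mx R phi)^t*)).

Definition tensor_tests (R : realType) (U : recfun) (e : seq bool) N
    (C D : 'M[R[i]]_N) : set 'M[R[i]]_(N * N) :=
  [set M | [/\ exists A B : 'M[R[i]]_N, M = A *t B,
               exists q, lower_computes U e q M &
               \tr (M *m (C *t D)) <= 1]].

Definition universal_test (R : realType) (U : recfun) (e : seq bool) (n : nat)
    (C D : 'M[R[i]]_(2 ^ n)) : 'M[R[i]]_(2 ^ n * 2 ^ n) :=
  mxsum (tensor_tests U e C D) (fun M => (lower_prob U e M n)%:C *: M).

Definition log2 (R : realType) (x : R) : \bar R :=
  (lne x%:E * ((ln 2)^-1)%:E)%E.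

Definition quantum_mutual_info (R : realType) (U : recfun) (e : seq bool)
    (n : nat) (sigma rho : 'M[R[i]]_(2 ^ n)) : \bar R :=
  let mu := universal_mx R U e n in
  log2 (complex.Re (\tr (universal_test U e mu mu *m (sigma *t rho)))).

(* Main.v *)
Require Import Defs.
From mathcomp Require Import all_boot all_order all_algebra.
From mathcomp Require Import sesquilinear spectral.
From mathcomp Require Import all_classical all_reals all_analysis.
From mathcomp Require Import complex mxtens.
From mathcomp Require Import zify ring lra.

(** Let c be such that Tr (E_k mu) <= 2^c 2^-K(k) for every outcome k.  The
    matrix M = 2^(K(i) + K(j) - 2c) E_i (x) E_j then satisfies
    Tr (M (mu (x) mu)) <= 1, and it is computed from i, j, n and the integer
    K(i) + K(j).  A shortest program of (i, j) is an encoding of (i, j)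
    together with its own length K(i,j), so followed by a shortest program of
    I(i:j) it yields K(i) + K(j) = I(i:j) + K(i,j), hence a program of M.
    Consequently M has weight at least 2^(-K(i,j) - K(I(i:j)) - O(1)) in the
    universal test, whose trace against sigma (x) rho is thus at least
    2^(I(i:j) - K(I(i:j)) - O(1)) E sigma(i) E rho(j).

    The bound on Tr (E_k mu) is a coding theorem.  The number Tr (E_k mu) is
    approximated from below by running all programs and adding up
    2^-|p| <phi|E_k|phi> for each program p of a unit vector phi.  When the
    approximation exceeds 2^-l, a codeword of length l + 2 is reserved for k:
    the successive reservations claim consecutive subintervals of [0, 1) of
    length 2^-(l + 1), and such an interval contains a dyadic interval of
    length 2^-(l + 2).  The space suffices because the E_k add up to the
    identity and 2^-|p| adds up to at most 1.

    Tr (universal test * A) is the sum of the traces only because the sum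
    defining the universal test converges absolutely: mu dominates a positive
    multiple of the identity, which bounds the trace of every test. *)

(* The analysis library has its own [eval]. *)
Import Defs.

Set Implicit Arguments.
Unset Strict Implicit.
Unset Printing Implicit Defensive.

Import Order.TTheory GRing.Theory Num.Theory ComplexField.
Import numFieldNormedType.Exports.

(** * Computable functions between countable types *)

(** The constant has to be uniform in n, E and e, so each machine is built once for all conditions
    and receives [e] and [n] as data. Now [universal] simulates only machines that are prefix-free
    under every condition, including those in which [e] enumerates no POVM. The coding machine
    therefore keeps its codewords disjoint under any condition; that E is a POVM serves to show that
    a requested codeword still fits into [0, 1). Algorithms are concrete partial recursive
    functions, so every machine comes with an explicit proof of computability. As the dimension is
    part of the data, the machines act on codes of matrices, with exact rational arithmetic, and
    they consult [U] through a step-bounded evaluator. A test is weighted by the universal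
    probability of the programs that compute it, so what counts for M is the complexity of such a
    program and not its length. This is why that program may list its data in unary. *)

Lemma eval_comp1 f g xs a z :
  eval g xs a -> eval f [:: a] z -> eval (RComp f [:: g]) xs z.
Proof. by move=> ga fz; apply: (EvalComp (ys := [:: a])) => // -[]. Qed.

Lemma eval_comp2 f g h xs a b z :
  eval g xs a -> eval h xs b -> eval f [:: a; b] z ->
  eval (RComp f [:: g; h]) xs z.
Proof.
by move=> ga hb fz; apply: (EvalComp (ys := [:: a; b])) => // -[|[]].
Qed.

Lemma eval_proj i xs z : nth 0 xs i = z -> eval (RProj i) xs z.
Proof. by move<-; constructor. Qed.

Lemma eval_succ xs z : z = (nth 0 xs 0).+1 -> eval RSucc xs z.
Proof. by move->; constructor. Qed.

Lemma eval_prec (F : nat -> nat) f g n xs :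
  eval f xs (F 0) -> (forall k, k < n -> eval g [:: k, F k & xs] (F k.+1)) ->
  eval (RPrec f g) (n :: xs) (F n).
Proof.
move=> f0; elim: n => [|n IHn] gS; first exact: EvalPrec0.
by apply: EvalPrecS (gS n _) => //; apply: IHn => k ltkn; apply/gS/leqW.
Qed.

Fixpoint rconst n := if n is k.+1 then RComp RSucc [:: rconst k] else RZero.

Lemma eval_const n xs : eval (rconst n) xs n.
Proof.
elim: n => [|n IHn]; first exact: EvalZero.
exact: eval_comp1 IHn (EvalSucc _).
Qed.

Definition radd := RPrec (RProj 0) (RComp RSucc [:: RProj 1]).

Lemma eval_add n x : eval radd [:: n; x] (n + x).
Proof.
apply: (eval_prec (F := fun n => n + x)); first exact: eval_proj.
by move=> k _; apply: eval_comp1 (EvalProj _ _) _; apply: eval_succ.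
Qed.

Definition rdbl := RPrec (RProj 0) (RComp radd [:: RProj 1; RProj 1]).

Lemma eval_dbl n x : eval rdbl [:: n; x] (2 ^ n * x).
Proof.
apply: (eval_prec (F := fun n => 2 ^ n * x)).
  by apply: eval_proj; rewrite mul1n.
move=> k _; apply: eval_comp2 (EvalProj _ _) (EvalProj _ _) _.
by rewrite expnS -mulnA mul2n -addnn; apply: eval_add.
Qed.

(** In [CodeSeq] the number [2 ^ a * c.*2.+1] codes the sequence with head [a] and tail of code [c],
    and 0 codes the empty sequence. Pairs, strings, rationals and matrices are all coded by such
    sequences. *)
Definition rcode :=
  RComp rdbl [:: RProj 0; RComp RSucc [:: RComp rdbl [:: rconst 1; RProj 1]]].

Lemma eval_code a c : eval rcode [:: a; c] (2 ^ a * c.*2.+1).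
Proof.
apply: eval_comp2 (EvalProj _ _) _ (eval_dbl _ _).
apply: eval_comp1; last exact: EvalSucc.
apply: eval_comp2 (eval_const _ _) (EvalProj _ _) _.
by rewrite -mul2n; apply: eval_dbl.
Qed.

Definition rnot := RPrec (rconst 1) RZero.

Lemma eval_not n xs : eval rnot (n :: xs) (n == 0).
Proof.
apply: (eval_prec (F := fun n => n == 0)); first exact: eval_const.
by move=> k _; apply: EvalZero.
Qed.

Definition rodd := RPrec RZero (RComp rnot [:: RProj 1]).

Lemma eval_odd n xs : eval rodd (n :: xs) (odd n).
Proof.
apply: (eval_prec (F := fun n => odd n)); first exact: EvalZero.
move=> k _; apply: eval_comp1 (EvalProj _ _) _ => /=.
by rewrite -(eqb0 (odd k)); apply: eval_not.
Qed.

Definition rhalf :=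
  RPrec RZero (RComp radd [:: RComp rodd [:: RProj 0]; RProj 1]).

Lemma eval_half n xs : eval rhalf (n :: xs) n./2.
Proof.
apply: (eval_prec (F := half)); first exact: EvalZero.
move=> k _; rewrite -uphalfE uphalf_half.
apply: eval_comp2 (EvalProj _ _) (eval_add _ _).
exact: eval_comp1 (EvalProj _ _) (eval_odd _ _).
Qed.

Definition rihalf := RPrec (RProj 0) (RComp rhalf [:: RProj 1]).

Lemma eval_ihalf n c : eval rihalf [:: n; c] (iter n half c).
Proof.
apply: (eval_prec (F := fun n => iter n half c)); first exact: eval_proj.
by move=> k _; apply: eval_comp1 (EvalProj _ _) (eval_half _ _).
Qed.

Lemma iter_half_code k a c : k <= a ->
  iter k half (2 ^ a * c.*2.+1) = 2 ^ (a - k) * c.*2.+1.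
Proof.
elim: k => [|k IHk] ltka; first by rewrite subn0.
rewrite iterS IHk ?(ltnW ltka)// -[a - k]prednK ?subn_gt0// -subnS expnS.
by rewrite -mulnA mul2n doubleK.
Qed.

(** The head is the exponent of 2 in the code, that is, the least number of halvings that yields an
    odd number. On 0, the code of the empty sequence, the search does not end. *)
Definition rhead :=
  RMu (RComp rnot [:: RComp rodd [:: RComp rihalf [:: RProj 0; RProj 1]]]).

Lemma eval_head a c : eval rhead [:: 2 ^ a * c.*2.+1] a.
Proof.
have body k : eval (RComp rnot [:: RComp rodd
    [:: RComp rihalf [:: RProj 0; RProj 1]]]) [:: k; 2 ^ a * c.*2.+1]
    (~~ odd (iter k half (2 ^ a * c.*2.+1))).
  rewrite -eqb0; apply: eval_comp1 (eval_not _ _).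
  apply: eval_comp1 (eval_odd _ _).
  exact: eval_comp2 (EvalProj _ _) (EvalProj _ _) (eval_ihalf _ _).
apply: (EvalMu (h := fun=> 0)) => [k ltka|].
  have := body k; rewrite iter_half_code ?(ltnW ltka)//.
  by rewrite oddM oddX subn_eq0 leqNgt ltka.
by have := body a; rewrite iter_half_code// subnn mul1n /= odd_double.
Qed.

Definition rtail := RComp rhalf [:: RComp rihalf [:: rhead; RProj 0]].

Lemma eval_tail a c : eval rtail [:: 2 ^ a * c.*2.+1] c.
Proof.
apply: eval_comp1.
  exact: eval_comp2 (eval_head _ _) (EvalProj _ _) (eval_ihalf _ _).
rewrite iter_half_code// subnn mul1n.
by have := eval_half c.*2.+1 [::]; rewrite -uphalfE uphalf_double.
Qed.

(** The realizer is constrained on codes only and may diverge elsewhere, as the projections of pairs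
    do. *)
Definition computable (X Y : countType) (f : X -> Y) : Prop :=
  exists r, forall x, eval r [:: pickle x] (pickle (f x)).

Lemma pickle_cons (X : countType) (x : X) s : pickle (x :: s) = 2 ^ pickle x * (pickle s).*2.+1.
Proof. by []. Qed.

Lemma pickle_pair (X Y : countType) (x : X) (y : Y) :
  pickle (x, y) = CodeSeq.code [:: pickle x; pickle y].
Proof. by []. Qed.

Section Computable.
Variables X Y Z : countType.
Implicit Types (f : X -> Y) (g : Y -> Z) (h : X -> Z).

Lemma eq_computable f f' : f =1 f' -> computable f -> computable f'.
Proof. by move=> eqf [r rf]; exists r => x; rewrite -eqf. Qed.

(** Computability sees codes only, so it passes between types whose elements have the same codes,
    for instance from rationals to pairs of integers. *)
Lemma computable_pickle f h :
  (forall x, pickle (f x) = pickle (h x)) -> computable f -> computable h.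
Proof. by move=> eqf [r rf]; exists r => x; rewrite -eqf. Qed.

Lemma computable_id : computable (fun x : X => x).
Proof. by exists (RProj 0) => x; apply: eval_proj. Qed.

Lemma computable_const (y : Y) : computable (fun _ : X => y).
Proof. by exists (rconst (pickle y)) => x; apply: eval_const. Qed.

Lemma computable_comp g f :
  computable g -> computable f -> computable (fun x => g (f x)).
Proof.
move=> [r rg] [s sf]; exists (RComp r [:: s]) => x; exact: eval_comp1 (sf x) _.
Qed.

Lemma computable_code f : computable f -> computable (fun x => pickle (f x)).
Proof. by []. Qed.

Lemma computable_cons (T : countType) (a : X -> T) s :
  computable a -> computable s -> computable (fun x => a x :: s x).
Proof.
move=> [r ra] [t ts]; exists (RComp rcode [:: r; t]) => x.
exact: eval_comp2 (ra x) (ts x) (eval_code _ _).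
Qed.

Lemma computable_pair f h :
  computable f -> computable h -> computable (fun x => (f x, h x)).
Proof.
move=> Cf Ch; have [r rP] : computable (fun x => [:: pickle (f x); pickle (h x)]).
  apply: computable_cons; first exact: Cf.
  by apply: computable_cons; [exact: Ch|exists RZero => x; apply: EvalZero].
by exists r => x; have := rP x; rewrite pickle_pair.
Qed.

Lemma computable_fst (f : X -> Y * Z) :
  computable f -> computable (fun x => (f x).1).
Proof.
move=> [r rf]; exists (RComp rhead [:: r]) => x; apply: eval_comp1 (rf x) _.
by case: (f x) => y z; rewrite pickle_pair; apply: eval_head.
Qed.

Lemma computable_snd (f : X -> Y * Z) :
  computable f -> computable (fun x => (f x).2).
Proof.
move=> [r rf]; exists (RComp rhead [:: RComp rtail [:: r]]) => x.
case: (f x) (rf x) => y z rx.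
have tx : eval (RComp rtail [:: r]) [:: pickle x] (CodeSeq.code [:: pickle z]).
  by apply: eval_comp1 rx _; rewrite pickle_pair; apply: eval_tail.
by refine (eval_comp1 tx _); apply: (eval_head (pickle z) 0).
Qed.

End Computable.

(** The test is the counter of a primitive recursion whose base case is the negative branch and
    whose step ignores the previous value. *)
Lemma computable_if (X Y : countType) (b : X -> bool) (f g : X -> Y) :
  computable b -> computable f -> computable g ->
  computable (fun x => if b x then f x else g x).
Proof.
move=> [rb rbP] [rf rfP] [rg rgP].
exists (RComp (RPrec rg (RComp rf [:: RProj 2])) [:: rb; RProj 0]) => x.
apply: eval_comp2 (rbP x) (EvalProj _ _) _ => /=.
case: (b x); last exact: EvalPrec0.
apply: EvalPrecS; first exact: EvalPrec0 (rgP x).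
by apply: eval_comp1 (rfP x); apply: eval_proj.
Qed.

(* The primitive recursion over a zero test makes the case analysis lazy: the
   head and tail functions are undefined on the code of the empty sequence. *)
Lemma computable_seq_case (X Y T : countType) (s : X -> seq T) (f : X -> Y)
    (g : X -> T -> seq T -> Y) :
  computable s -> computable f ->
  computable (fun z : X * (T * seq T) => g z.1 z.2.1 z.2.2) ->
  computable (fun x => if s x is a :: t then g x a t else f x).
Proof.
move=> [rs rsP] [rf rfP] [rg rgP].
pose q := RComp rnot [:: RComp rnot [:: rs]].
pose br := RComp rg [:: RComp rcode [:: RProj 2; RComp rcode
  [:: RComp rcode [:: RComp rhead [:: RComp rs [:: RProj 2]];
       RComp rcode [:: RComp rtail [:: RComp rs [:: RProj 2]]; RZero]]; RZero]]].
exists (RComp (RPrec rf br) [:: q; RProj 0]) => x.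
have qx : eval q [:: pickle x] (s x != [::]).
  have -> : (s x != [::]) = ((pickle (s x) == 0) == false).
    case: (s x) => //= a t; rewrite -[LHS]/true; apply/esym/eqP.
    by rewrite pickle_cons muln_eq0 expn_eq0.
  have -> : ((pickle (s x) == 0) == false) = ((pickle (s x) == 0 : nat) == 0).
    by case: (_ == 0).
  exact: eval_comp1 (eval_comp1 (rsP x) (eval_not _ _)) (eval_not _ _).
apply: eval_comp2 qx (EvalProj _ _) _ => /=.
case Es: (s x) => [|a t] /=; first exact: EvalPrec0.
apply: EvalPrecS; first exact: EvalPrec0 (rfP x).
apply: eval_comp1 (rgP (x, (a, t))); rewrite pickle_pair pickle_pair /=.
have st : eval (RComp rs [:: RProj 2]) [:: 0; pickle (f x); pickle x]
   (2 ^ pickle a * (pickle t).*2.+1).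
  by apply: eval_comp1 (EvalProj _ _) _; rewrite -pickle_cons -Es; apply: rsP.
apply: eval_comp2 (EvalProj _ _) _ (eval_code _ _).
apply: eval_comp2 (EvalZero _) (eval_code _ _).
apply: eval_comp2 _ _ (eval_code _ _).
  exact: eval_comp1 st (eval_head _ _).
apply: eval_comp2 (EvalZero _) (eval_code _ _).
exact: eval_comp1 st (eval_tail _ _).
Qed.

(** Primitive recursion with the parameter [x] carried along. Most closure properties below are
    obtained by exhibiting a loop of this form. *)
Lemma computable_iteri (X Y : countType) (n : X -> nat) (f : X -> Y)
    (g : X -> nat -> Y -> Y) :
  computable n -> computable f ->
  computable (fun z : X * (nat * Y) => g z.1 z.2.1 z.2.2) ->
  computable (fun x => iteri (n x) (g x) (f x)).
Proof.
move=> [rn rnP] [rf rfP] [rg rgP].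
pose br := RComp rg [:: RComp rcode [:: RProj 2; RComp rcode
  [:: RComp rcode [:: RProj 0; RComp rcode [:: RProj 1; RZero]]; RZero]]].
exists (RComp (RPrec rf br) [:: rn; RProj 0]) => x.
apply: eval_comp2 (rnP x) (EvalProj _ _) _ => /=.
apply: (eval_prec (F := fun k => pickle (iteri k (g x) (f x)))); first exact: rfP.
move=> k _; apply: eval_comp1 (rgP (x, (k, _))).
rewrite pickle_pair pickle_pair.
apply: eval_comp2 (EvalProj _ _) _ (eval_code _ _).
apply: eval_comp2 (EvalZero _) (eval_code _ _).
apply: eval_comp2 (EvalProj _ _) _ (eval_code _ _).
exact: eval_comp2 (EvalProj _ _) (EvalZero _) (eval_code _ _).
Qed.

Lemma computable_succ (X : countType) (f : X -> nat) :
  computable f -> computable (fun x => (f x).+1).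
Proof.
by move=> [r rf]; exists (RComp RSucc [:: r]) => x; apply: eval_comp1 (rf x) (EvalSucc _).
Qed.

Lemma computable_app1 (X Y Z : countType) (F : Y -> Z) (f : X -> Y) :
  computable F -> computable f -> computable (fun x => F (f x)).
Proof. exact: computable_comp. Qed.

Lemma computable_app2 (X Y1 Y2 Z : countType) (F : Y1 -> Y2 -> Z) f1 f2 :
  computable (fun z : Y1 * Y2 => F z.1 z.2) ->
  computable f1 -> computable f2 -> computable (fun x : X => F (f1 x) (f2 x)).
Proof.
move=> CF C1 C2.
exact: (computable_comp CF (computable_pair C1 C2)).
Qed.

Lemma computable_app3 (X Y1 Y2 Y3 Z : countType) (F : Y1 -> Y2 -> Y3 -> Z)
    f1 f2 f3 :
  computable (fun z : Y1 * (Y2 * Y3) => F z.1 z.2.1 z.2.2) ->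
  computable f1 -> computable f2 -> computable f3 ->
  computable (fun x : X => F (f1 x) (f2 x) (f3 x)).
Proof.
move=> CF C1 C2 C3.
exact: (computable_comp CF (computable_pair C1 (computable_pair C2 C3))).
Qed.

(* [comp_ext] and [comp_ext2] are extended as more closure lemmas are proved. *)
Ltac comp_ext := fail.

(** Syntax-directed search. Constant functions are tried before the shape of the body is inspected,
    so that closed subterms are not taken apart. *)
Ltac comp_step :=
  cbv beta; first [simple apply computable_const | lazymatch goal with
  | |- computable (fun x => x) => apply: computable_id
  | |- computable (fun x => (_, _)) => apply: computable_pair
  | |- computable (fun x => _ :: _) => apply: computable_cons
  | |- computable (fun x => if _ then _ else _) => apply: computable_if
  | |- computable (fun x => match _ with nil => _ | cons _ _ => _ end) =>
      apply: computable_seq_case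
  | |- computable (fun x => iteri _ _ _) => apply: computable_iteri
  | |- computable (fun x => pickle _) => apply: computable_code
  | |- computable (fun x => S _) => apply: computable_succ
  | |- computable (fun x => fst _) => apply: computable_fst
  | |- computable (fun x => snd _) => apply: computable_snd
  | _ => comp_ext
  end].

Ltac comp_hyp :=
  match goal with
  | H : computable ?g |- computable (fun x => ?g _) =>
      refine (computable_app1 H _)
  | H : computable (fun z => ?g z.1 z.2) |- computable (fun x => ?g _ _) =>
      refine (computable_app2 H _ _)
  | H : computable (fun z => ?g z.1 z.2.1 z.2.2) |-
      computable (fun x => ?g _ _ _) => refine (computable_app3 H _ _ _)
  end.

Ltac comp_eta :=
  lazymatch goal with
  | |- computable (fun x => _) => fail
  | |- computable ?f => change (computable (fun x => f x))
  end.

Ltac comp := repeat first [assumption | comp_eta | comp_step | comp_hyp].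

Section Computable_nat.
Variable X : countType.
Implicit Types (f g : X -> nat) (b c : X -> bool).

Lemma computable_predn f : computable f -> computable (fun x => (f x).-1).
Proof.
(* The last value taken by the loop counter is the predecessor. *)
move=> Cf; apply: (@eq_computable _ _ (fun x => iteri (f x) (fun k _ => k) 0)).
  by move=> x; case: (f x).
by comp.
Qed.

Lemma computable_addn f g :
  computable f -> computable g -> computable (fun x => f x + g x).
Proof.
move=> Cf Cg.
apply: (@eq_computable _ _ (fun x => iteri (f x) (fun _ y => y.+1) (g x))).
  by move=> x; elim: (f x) => //= n ->.
by comp.
Qed.

End Computable_nat.

Ltac comp_ext ::=
  lazymatch goal with
  | |- computable (fun x => predn _) => apply: computable_predn
  | |- computable (fun x => _ + _) => apply: computable_addn
  end.

Section Computable_nat2.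
Variable X : countType.
Implicit Types (f g : X -> nat) (b c : X -> bool).

Lemma computable_subn f g :
  computable f -> computable g -> computable (fun x => f x - g x).
Proof.
move=> Cf Cg.
apply: (@eq_computable _ _ (fun x => iteri (g x) (fun _ y => y.-1) (f x))).
  by move=> x; elim: (g x) => [|n]; rewrite ?subn0 ?subnS //= => ->.
by comp.
Qed.

Lemma computable_muln f g :
  computable f -> computable g -> computable (fun x => f x * g x).
Proof.
move=> Cf Cg.
apply: (@eq_computable _ _ (fun x => iteri (f x) (fun _ y => g x + y) 0)).
  by move=> x; elim: (f x) => //= n ->.
by comp.
Qed.

Lemma computable_eq0 f : computable f -> computable (fun x => f x == 0).
Proof.
move=> Cf.
apply: (@eq_computable _ _ (fun x => iteri (f x) (fun _ _ => false) true)).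
  by move=> x; case: (f x).
by comp.
Qed.

Lemma computable_leq f g :
  computable f -> computable g -> computable (fun x => f x <= g x).
Proof. by move=> Cf Cg; apply: computable_eq0; apply: computable_subn. Qed.

Lemma computable_andb b c :
  computable b -> computable c -> computable (fun x => b x && c x).
Proof. by move=> Cb Cc; apply: computable_if => //; comp. Qed.

Lemma computable_orb b c :
  computable b -> computable c -> computable (fun x => b x || c x).
Proof. by move=> Cb Cc; apply: computable_if => //; comp. Qed.

Lemma computable_negb b : computable b -> computable (fun x => ~~ b x).
Proof. by move=> Cb; apply: computable_if => //; comp. Qed.

Lemma computable_nat_of_bool b :
  computable b -> computable (fun x => nat_of_bool (b x)).
Proof. by []. Qed.

End Computable_nat2.

Lemma computable_eqop (X Y : countType) (f g : X -> Y) :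
  computable f -> computable g -> computable (fun x => f x == g x).
Proof.
move=> Cf Cg; apply: (@eq_computable _ _
  (fun x => (pickle (f x) <= pickle (g x)) && (pickle (g x) <= pickle (f x)))).
  by move=> x; rewrite -eqn_leq (inj_eq (pcan_inj pickleK)).
by apply: computable_andb; apply: computable_leq; apply: computable_code.
Qed.

Ltac comp_ext ::=
  lazymatch goal with
  | |- computable (fun x => predn _) => apply: computable_predn
  | |- computable (fun x => _ + _) => apply: computable_addn
  | |- computable (fun x => _ - _) => apply: computable_subn
  | |- computable (fun x => _ * _) => apply: computable_muln
  | |- computable (fun x => leq _ _) => apply: computable_leq
  | |- computable (fun x => _ && _) => apply: computable_andb
  | |- computable (fun x => _ || _) => apply: computable_orb
  | |- computable (fun x => ~~ _) => apply: computable_negb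
  | |- computable (fun x => nat_of_bool _) => apply: computable_nat_of_bool
  | |- computable (fun x => _ == _) => apply: computable_eqop
  end.

Section Computable_bounded.
Variable X : countType.
Implicit Types (f g : X -> nat).

Lemma computable_expn f g :
  computable f -> computable g -> computable (fun x => f x ^ g x).
Proof.
move=> Cf Cg.
apply: (@eq_computable _ _ (fun x => iteri (g x) (fun _ y => f x * y) 1)).
  by move=> x; elim: (g x) => //= n ->; rewrite expnS.
by comp.
Qed.

Lemma computable_sum f (F : X -> nat -> nat) :
  computable f -> computable (fun z : X * nat => F z.1 z.2) ->
  computable (fun x => \sum_(0 <= k < f x) F x k).
Proof.
move=> Cf CF.
apply: (@eq_computable _ _ (fun x => iteri (f x) (fun k y => y + F x k) 0)).
  by move=> x; elim: (f x) => [|n] /=; rewrite ?big_nil ?big_nat_recr //= => ->.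
comp.
Qed.

(** The quotient counts the positive multiples of the divisor up to the dividend; division by 0
    gives 0 by convention. *)
Lemma computable_divn f g :
  computable f -> computable g -> computable (fun x => f x %/ g x).
Proof.
move=> Cf Cg; apply: (@eq_computable _ _ (fun x => if g x == 0 then 0 else
    \sum_(0 <= k < f x) (k.+1 * g x <= f x))).
  move=> x; case: eqP => [->|/eqP]; rewrite ?divn0// -lt0n => g_gt0.
  rewrite big_mkord; under eq_bigr do rewrite -leq_divRL//.
  move: (leq_div (f x) (g x)); move: (f x %/ g x) => m.
  elim: (f x) m => [|n IHn] m; first by rewrite leqn0 big_ord0 => /eqP.
  rewrite leq_eqVlt big_ord_recr /= => /predU1P[->|]; last first.
    by move=> lemn; rewrite IHn// ltnNge -ltnS lemn addn0.
  rewrite ltnSn (eq_bigr (fun=> 1)) => [|i _]; last by rewrite leqW.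
  by rewrite sum_nat_const card_ord muln1 addn1.
by comp; apply: computable_sum; comp.
Qed.

(** Unbounded search for a total function. It provides the denominators of rationals in lowest
    terms. *)
Lemma computable_bigmin f (P : X -> nat -> bool) :
  computable (fun z : X * nat => P z.1 z.2) ->
  (forall x, P x (f x)) -> (forall x k, k < f x -> ~~ P x k) -> computable f.
Proof.
move=> [r rP] Pf minf.
exists (RMu (RComp rnot [:: RComp r [:: RComp rcode
  [:: RProj 1; RComp rcode [:: RProj 0; RZero]]]])) => x.
have body k : eval (RComp rnot [:: RComp r [:: RComp rcode
  [:: RProj 1; RComp rcode [:: RProj 0; RZero]]]]) [:: k; pickle x]
  (~~ P x k).
  rewrite -eqb0; apply: eval_comp1 (eval_not _ _).
  apply: eval_comp1 (rP (x, k)); rewrite pickle_pair.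
  apply: eval_comp2 (EvalProj _ _) _ (eval_code _ _).
  exact: eval_comp2 (EvalProj _ _) (EvalZero _) (eval_code _ _).
apply: (EvalMu (h := fun=> 0)) => [k ltk|].
  by have := body k; rewrite minf.
by have := body (f x); rewrite Pf.
Qed.

End Computable_bounded.

Section Computable_seq.
Variable X : countType.

(** The code of a sequence is at least its length and serves as the number of iterations; the
    surplus ones meet the empty sequence and change nothing. *)
Lemma computable_foldl (Y T : countType) (z : X -> Y) (s : X -> seq T)
    (g : X -> Y -> T -> Y) :
  computable z -> computable s ->
  computable (fun u : X * (Y * T) => g u.1 u.2.1 u.2.2) ->
  computable (fun x => foldl (g x) (z x) (s x)).
Proof.
move=> Cz Cs Cg.
pose step x (_ : nat) (u : seq T * Y) :=
  if u.1 is a :: t then (t, g x u.2 a) else u.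
apply: (@eq_computable _ _ (fun x => (iteri (pickle (s x)) (step x)
                                       (s x, z x)).2)); last first.
  by rewrite /step; comp.
move=> x; have : size (s x) <= pickle (s x).
  elim: (s x) => //= a t IHt; rewrite pickle_cons.
  rewrite (leq_ltn_trans IHt)//.
  rewrite -[X in X < _]mul1n; apply: (@leq_trans (1 * (pickle t).*2.+1)).
    by rewrite !mul1n ltnS -addnn leq_addr.
  by rewrite leq_mul2r expn_gt0 orbT.
elim: (s x) (z x) (pickle (s x)) => [|a t IHt] y [|n] //=.
  by move=> _; have -> : iteri n (step x) ([::], y) = ([::], y)
    by elim: n => //= n ->.
move=> lesn; rewrite -(IHt (g x y a) n)//; congr (_.2).
have iterSr m u : iteri m.+1 (step x) u = iteri m (step x) (step x 0 u).
  by elim: m => //= m ->.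
exact: iterSr.
Qed.

Lemma computable_rev (T : countType) (s : X -> seq T) :
  computable s -> computable (fun x => rev (s x)).
Proof.
move=> Cs.
apply: (@eq_computable _ _ (fun x => foldl (fun t a => a :: t) [::] (s x))).
  move=> x; rewrite /rev; elim: (s x) [::] => //=.
by apply: computable_foldl; comp.
Qed.

Lemma computable_foldr (Y T : countType) (z : X -> Y) (s : X -> seq T)
    (g : X -> T -> Y -> Y) :
  computable z -> computable s ->
  computable (fun u : X * (T * Y) => g u.1 u.2.1 u.2.2) ->
  computable (fun x => foldr (g x) (z x) (s x)).
Proof.
move=> Cz Cs Cg; apply: (@eq_computable _ _
    (fun x => foldl (fun y a => g x a y) (z x) (rev (s x)))).
  by move=> x; rewrite foldl_rev.
apply: computable_foldl => //; first exact: computable_rev.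
by comp.
Qed.

Lemma computable_map (T Y : countType) (s : X -> seq T) (g : X -> T -> Y) :
  computable s -> computable (fun u : X * T => g u.1 u.2) ->
  computable (fun x => map (g x) (s x)).
Proof.
move=> Cs Cg; apply: (@eq_computable _ _
    (fun x => foldr (fun a t => g x a :: t) [::] (s x))).
  by move=> x; elim: (s x) => //= a t ->.
apply: computable_foldr; comp.
Qed.

Lemma computable_size (T : countType) (s : X -> seq T) :
  computable s -> computable (fun x => size (s x)).
Proof.
move=> Cs; apply: (@eq_computable _ _ (fun x => foldr (fun _ n => n.+1) 0 (s x))).
  by move=> x; elim: (s x) => //= a t ->.
by apply: computable_foldr; comp.
Qed.

Lemma computable_cat (T : countType) (s t : X -> seq T) :
  computable s -> computable t -> computable (fun x => s x ++ t x).
Proof.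
move=> Cs Ct; apply: (@eq_computable _ _ (fun x => foldr cons (t x) (s x))).
  by move=> x; elim: (s x) => //= a u ->.
by apply: computable_foldr; comp.
Qed.

Lemma computable_drop (T : countType) (n : X -> nat) (s : X -> seq T) :
  computable n -> computable s -> computable (fun x => drop (n x) (s x)).
Proof.
move=> Cn Cs; apply: (@eq_computable _ _ (fun x =>
    iteri (n x) (fun _ (s : seq T) => if s is a :: t then t else [::]) (s x))).
  move=> x; elim: (n x) => [|k] /=; rewrite ?drop0// => ->.
  by rewrite -addn1 addnC -drop_drop; case: (drop _ _) => //= a t; rewrite drop0.
by comp.
Qed.

Lemma computable_nth (T : countType) (a : X -> T) (s : X -> seq T) (n : X -> nat) :
  computable a -> computable s -> computable n ->
  computable (fun x => nth (a x) (s x) (n x)).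
Proof.
move=> Ca Cs Cn; apply: (@eq_computable _ _ (fun x =>
    if drop (n x) (s x) is b :: _ then b else a x)).
  move=> x; case: (ltnP (n x) (size (s x))) => [lt|le].
    by rewrite (drop_nth (a x)).
  by rewrite drop_oversize// nth_default.
by comp; apply: computable_drop.
Qed.

Lemma computable_mkseq (T : countType) (n : X -> nat) (g : X -> nat -> T) :
  computable n -> computable (fun u : X * nat => g u.1 u.2) ->
  computable (fun x => mkseq (g x) (n x)).
Proof.
move=> Cn Cg; apply: (@eq_computable _ _ (fun x =>
    rev (iteri (n x) (fun k s => g x k :: s) [::]))).
  move=> x; elim: (n x) => //= k IHk.
  by rewrite rev_cons IHk -addn1 /mkseq iotaD map_cat cats1.
by apply: computable_rev; comp.
Qed.

Lemma computable_take (T : countType) (n : X -> nat) (s : X -> seq T) :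
  computable n -> computable s -> computable (fun x => take (n x) (s x)).
Proof.
move=> Cn Cs; apply: (@eq_computable _ _ (fun x =>
    rev (drop (size (s x) - n x) (rev (s x))))).
  move=> x; rewrite drop_rev revK.
  case: (leqP (n x) (size (s x))) => [le|/ltnW le]; first by rewrite subKn.
  by rewrite (eqnP le) subn0 take_size take_oversize.
apply: computable_rev; apply: computable_drop; last exact: computable_rev.
by comp; apply: computable_size.
Qed.

(** An option is coded as a sequence of at most one element. *)
Lemma computable_some (T : countType) (f : X -> T) :
  computable f -> computable (fun x => Some (f x)).
Proof.
move=> Cf; apply: (@computable_pickle _ _ _ (fun x => [:: f x])) => //.
by comp.
Qed.

Lemma computable_oapp (T Y : countType) (o : X -> option T) (f : X -> Y)
    (g : X -> T -> Y) :
  computable o -> computable f -> computable (fun u : X * T => g u.1 u.2) ->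
  computable (fun x => if o x is Some a then g x a else f x).
Proof.
move=> Co Cf Cg; apply: (@eq_computable _ _ (fun x =>
    if seq_of_opt (o x) is a :: _ then g x a else f x)).
  by move=> x; case: (o x).
apply: computable_seq_case => //; last by comp.

Qed.

End Computable_seq.

(** Every number codes a sequence of numbers, so decoding does not change the code. *)
Lemma computable_decode (X : countType) (f : X -> nat) :
  computable f -> computable (fun x => CodeSeq.decode (f x)).
Proof.
move=> Cf; apply: (@computable_pickle _ _ _ f) => // x.
by rewrite -[LHS]CodeSeq.decodeK; congr CodeSeq.code; rewrite map_id.
Qed.

Lemma computable_CodeSeq_code (X : countType) (s : X -> seq nat) :
  computable s -> computable (fun x => CodeSeq.code (s x)).
Proof.
move=> Cs; apply: computable_pickle Cs => x.
by rewrite -[LHS]/(CodeSeq.code _) map_id.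
Qed.

Ltac comp_ext2 := fail.

Ltac comp_ext ::=
  lazymatch goal with
  | |- computable (fun x => predn _) => apply: computable_predn
  | |- computable (fun x => _ + _) => apply: computable_addn
  | |- computable (fun x => _ - _) => apply: computable_subn
  | |- computable (fun x => _ * _) => apply: computable_muln
  | |- computable (fun x => _ ^ _) => apply: computable_expn
  | |- computable (fun x => _ %/ _) => apply: computable_divn
  | |- computable (fun x => leq _ _) => apply: computable_leq
  | |- computable (fun x => _ && _) => apply: computable_andb
  | |- computable (fun x => _ || _) => apply: computable_orb
  | |- computable (fun x => ~~ _) => apply: computable_negb
  | |- computable (fun x => nat_of_bool _) => apply: computable_nat_of_bool
  | |- computable (fun x => _ == _) => apply: computable_eqop
  | |- computable (fun x => \sum_(0 <= k < _) _) => apply: computable_sum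
  | |- computable (fun x => foldl _ _ _) => apply: computable_foldl
  | |- computable (fun x => foldr _ _ _) => apply: computable_foldr
  | |- computable (fun x => map _ _) => apply: computable_map
  | |- computable (fun x => rev _) => apply: computable_rev
  | |- computable (fun x => size _) => apply: computable_size
  | |- computable (fun x => cat _ _) => apply: computable_cat
  | |- computable (fun x => drop _ _) => apply: computable_drop
  | |- computable (fun x => take _ _) => apply: computable_take
  | |- computable (fun x => nth _ _ _) => apply: computable_nth
  | |- computable (fun x => mkseq _ _) => apply: computable_mkseq
  | |- computable (fun x => Some _) => apply: computable_some
  | |- computable (fun x => match _ with Some _ => _ | None => _ end) =>
      apply: computable_oapp
  | |- computable (fun x => CodeSeq.decode _) => apply: computable_decode
  | |- computable (fun x => CodeSeq.code _) => apply: computable_CodeSeq_code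
  | _ => comp_ext2
  end.

(** * Kleene normal form *)

Section RecfunInd.
Variable P : recfun -> Prop.
Hypotheses (PZero : P RZero) (PSucc : P RSucc) (PProj : forall i, P (RProj i)).
Hypothesis PComp : forall f gs, P f -> foldr and True (map P gs) -> P (RComp f gs).
Hypothesis PPrec : forall f g, P f -> P g -> P (RPrec f g).
Hypothesis PMu : forall f, P f -> P (RMu f).

(** The functions listed in [RComp] are a nested occurrence; the inner fixpoint collects an
    induction hypothesis for each of them. *)
Fixpoint nested_recfun_ind f : P f :=
  match f with
  | RZero => PZero
  | RSucc => PSucc
  | RProj i => PProj i
  | RComp f gs => PComp (nested_recfun_ind f)
      ((fix loop gs : foldr and True (map P gs) :=
         match gs with
         | [::] => I
         | g :: gs => conj (nested_recfun_ind g) (loop gs)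
         end) gs)
  | RPrec f g => PPrec (nested_recfun_ind f) (nested_recfun_ind g)
  | RMu f => PMu (nested_recfun_ind f)
  end.

End RecfunInd.

Definition fuel_monotone (X Y : Type) (H : nat -> X -> option Y) :=
  forall s t xs v, s <= t -> H s xs = Some v -> H t xs = Some v.

(** Kleene's normal form for a fixed [f]: a total computable simulation with fuel [t], which answers
    [None] as long as the fuel is insufficient. It allows all programs to be run in parallel. *)
Definition evaluator (f : recfun) (H : nat -> seq nat -> option nat) :=
  [/\ computable (fun z : nat * seq nat => H z.1 z.2), fuel_monotone H &
      forall xs v, eval f xs v <-> exists t, H t xs = Some v].

Lemma uniform_fuel (P : nat -> nat -> Prop) n :
  (forall k s t, s <= t -> P k s -> P k t) ->
  (forall k, k < n -> exists t, P k t) -> exists t, forall k, k < n -> P k t.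
Proof.
move=> Pmono; elim: n => [|n IHn] Pn; first by exists 0.
have [k ltkn|t tP] := IHn; first exact: Pn (leqW ltkn).
have [u uP] := Pn n (ltnSn n); exists (maxn t u) => k.
rewrite ltnS leq_eqVlt => /predU1P[->|ltkn].
  by apply: Pmono uP; apply: leq_maxr.
by apply: Pmono (tP k ltkn); apply: leq_maxl.
Qed.

Lemma evaluator_total f (F : seq nat -> nat) :
  computable F -> (forall xs v, eval f xs v <-> v = F xs) ->
  exists H, evaluator f H.
Proof.
move=> CF fP; exists (fun _ xs => Some (F xs)); split=> //.
  by comp.
move=> xs v; rewrite fP; split=> [->|[_ [->//]]]; by exists 0.
Qed.

Lemma evaluator_comp_seq gs :
  foldr and True (map (fun g => exists H, evaluator g H) gs) ->
  exists Hs : nat -> seq nat -> option (seq nat),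
  [/\ computable (fun z : nat * seq nat => Hs z.1 z.2), fuel_monotone Hs &
      forall xs ys, (size ys = size gs /\ forall k, k < size gs ->
          eval (nth RZero gs k) xs (nth 0 ys k)) <->
        exists t, Hs t xs = Some ys].
Proof.
elim: gs => /= [_|g gs IHgs [[H [CH Hmono HP]] /IHgs[Hs [CHs Hsmono HsP]]]].
  exists (fun _ _ => Some [::]); split=> // [|xs ys].
    by comp.
  split=> [[/size0nil->]|[_ [<-]]] //; by exists 0.
exists (fun t xs => if H t xs is Some y then
    if Hs t xs is Some ys then Some (y :: ys) else None else None); split.
(* The branch is named as a function of the context and of the matched value, so that the outer
   match and the branch are treated separately. *)
- pose R (z : nat * seq nat) y : option (seq nat) :=
    if Hs z.1 z.2 is Some ys then Some (y :: ys) else None.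
  have CR : computable (fun u : (nat * seq nat) * nat => R u.1 u.2).
    by rewrite /R; comp.
  apply: (@eq_computable _ _ (fun z => if H z.1 z.2 is Some y then R z y else None)).
    by [].
  by comp.
- move=> s t xs v lest; case Ey: (H s xs) => [y|]//.
  case Eys: (Hs s xs) => [ys|]// [<-].
  by rewrite (Hmono _ _ _ _ lest Ey) (Hsmono _ _ _ _ lest Eys).
move=> xs [|y ys].
  by split=> [[]//|[t]]; case: (H t xs) (Hs t xs) => [?|] [?|].
split.
  move=> [[sz_ys] ysP].
  have [t1 /(Hmono _ (maxn t1 _)) Ht1] := proj1 (HP xs y) (ysP 0 isT).
  have [t2 /(Hsmono _ (maxn _ t2)) Ht2] : exists t, Hs t xs = Some ys.
    by apply/HsP; split=> // k ltk; apply: (ysP k.+1).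
  by exists (maxn t1 t2); rewrite Ht1 ?leq_maxl// Ht2 ?leq_maxr.
move=> [t]; case Ey: (H t xs) => [y'|]//; case Eys: (Hs t xs) => [ys'|]// [<- <-].
have [szys ysP] : size ys' = size gs /\ forall k, k < size gs ->
    eval (nth RZero gs k) xs (nth 0 ys' k) by apply/HsP; exists t.
split=> [|[_|k /ysP//]]; first by rewrite /= szys.
by apply/HP; exists t.
Qed.

Lemma eval_comp_inv f gs xs z : eval (RComp f gs) xs z ->
  exists ys, [/\ size ys = size gs,
    forall k, k < size gs -> eval (nth RZero gs k) xs (nth 0 ys k) &
    eval f ys z].
Proof.
by move=> E; inversion E as [| | |f' gs' xs' ys z' sz gsP fP| | |]; subst; exists ys.
Qed.

Lemma eval_prec0_inv f g xs z : eval (RPrec f g) (0 :: xs) z -> eval f xs z.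
Proof. by move=> E; inversion E. Qed.

Lemma eval_precS_inv f g n xs z : eval (RPrec f g) (n.+1 :: xs) z ->
  exists2 y, eval (RPrec f g) (n :: xs) y & eval g [:: n, y & xs] z.
Proof. by move=> E; inversion E as [| | | | |f' g' n' xs' y z' fP gP|]; subst; exists y. Qed.

Lemma eval_mu_inv f xs n : eval (RMu f) xs n -> eval f (n :: xs) 0 /\
  exists h, forall k, k < n -> eval f (k :: xs) (h k).+1.
Proof.
by move=> E; inversion E as [| | | | | |f' xs' n' h hP fP]; subst; split=> //; exists h.
Qed.

(** The state of the search: [None] while all values so far are positive, [Some (Some k)] once the
    zero [k] is found, [Some None] when the fuel failed for a candidate. The failure is final,
    because a later zero would not be the result of [RMu]. *)
Definition mu_step (H : nat -> seq nat -> option nat) t xs k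
    (o : option (option nat)) :=
  if o is Some _ then o
  else if H t (k :: xs) is Some v then if v == 0 then Some (Some k) else None
  else Some None.

Lemma mu_stepP H t xs m :
  (iteri m (mu_step H t xs) None = None <->
     forall k, k < m -> exists v, H t (k :: xs) = Some v.+1) /\
  forall n, iteri m (mu_step H t xs) None = Some (Some n) <->
    [/\ n < m, H t (n :: xs) = Some 0 &
        forall k, k < n -> exists v, H t (k :: xs) = Some v.+1].
Proof.
elim: m => [|m [IHN IHS]] /=.
  by split=> // n; split=> // -[].
case Em: (iteri m _ None) IHN IHS => [w|] IHN IHS /=.
  split.
    split=> // pos; suff : Some w = None by [].
    by apply/IHN => k ltkm; apply: pos; apply: leqW.
  move=> n; rewrite {}IHS; split=> -[ltnm n0 npos]; split=> //.
    exact: leqW.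
  move: ltnm; rewrite ltnS leq_eqVlt => /predU1P[Enm|//].
  suff : Some w = None by [].
  by apply/IHN => k ltkm; apply: npos; rewrite Enm.
have /IHN pos : None = None :> option (option nat) by [].
rewrite /mu_step; case Hm: (H t (m :: xs)) => [[|v]|] /=.
- split=> [|n].
    by split=> // /(_ m (ltnSn m))[v]; rewrite Hm.
  split=> [[<-]|[lenm n0 npos]]; first by split.
  have [ltnm|ltmn|->//] := ltngtP n m; last by rewrite ltnNge -ltnS lenm in ltmn.
  by have [v] := pos n ltnm; rewrite n0.
- split=> [|n].
    split=> // _ k; rewrite ltnS leq_eqVlt => /predU1P[->|/pos//].
    by exists v.
  split=> // -[lenm n0 npos].
  move: lenm; rewrite ltnS leq_eqVlt => /predU1P[Enm|/pos[u]]; rewrite ?n0//.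
  by rewrite Enm Hm in n0.
- split=> [|n].
    by split=> // /(_ m (ltnSn m))[v]; rewrite Hm.
  split=> // -[lenm n0 npos].
  move: lenm; rewrite ltnS leq_eqVlt => /predU1P[Enm|/pos[u]]; rewrite ?n0//.
  by rewrite Enm Hm in n0.
Qed.

Lemma evaluator_prec f g Hf Hg : evaluator f Hf -> evaluator g Hg ->
  exists H, evaluator (RPrec f g) H.
Proof.
move=> [Cf fmono fP] [Cg gmono gP].
pose it t xs n := iteri n (fun k o =>
  if o is Some y then Hg t [:: k, y & xs] else None) (Hf t xs).
exists (fun t xs => if xs is n :: xs then it t xs n else None).
have itmono s t xs n v : s <= t -> it s xs n = Some v -> it t xs n = Some v.
  move=> lest; elim: n v => [|n IHn] v /=; first exact: fmono.
  rewrite -/(it s xs n) -/(it t xs n); case: (it s xs n) IHn => // y IHn.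
  by rewrite (IHn y erefl); apply: gmono.
split.
- pose R (z : nat * (nat * seq nat)) (k : nat) (o : option nat) :=
    if o is Some y then Hg z.1 [:: k, y & z.2.2] else None.
  have CR : computable (fun u : (nat * (nat * seq nat)) * (nat * option nat) =>
      R u.1 u.2.1 u.2.2) by rewrite /R; comp.
  pose F (z : nat * seq nat) n xs := iteri n (R (z.1, (n, xs))) (Hf z.1 xs).
  have CF : computable (fun u : (nat * seq nat) * (nat * seq nat) =>
      F u.1 u.2.1 u.2.2).
    rewrite /F.
    apply: (@computable_iteri _ _ (fun u : (nat * seq nat) * (nat * seq nat) =>
       u.2.1) (fun u => Hf u.1.1 u.2.2) (fun u => R (u.1.1, (u.2.1, u.2.2)))).
    - by comp.
    - by comp.
    - by comp.
  apply: (@eq_computable _ _ (fun z => if z.2 is n :: xs then F z n xs else None)).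
    by [].
  by comp.
- by move=> s t [|n xs] v // lest; apply: itmono.
move=> [|n xs] v; split=> //.
- by move=> E; inversion E.
- by case.
- elim: n v => [|n IHn] v.
    by move/eval_prec0_inv/fP => -[t tP]; exists t.
  move=> /eval_precS_inv[y /IHn[t1 t1P] /gP[t2 t2P]]; exists (maxn t1 t2).
  rewrite /it /= -/(it _ xs n) (itmono _ (maxn t1 t2) _ _ _ _ t1P) ?leq_maxl//.
  by apply: gmono t2P; apply: leq_maxr.
move=> [t]; elim: n v => [|n IHn] v.
  by move=> tP; apply: EvalPrec0; apply/fP; exists t.
rewrite /it /= -/(it _ xs n); case E: (it t xs n) => [y|//] tP.
by apply: EvalPrecS (IHn y E) _; apply/gP; exists t.
Qed.

(** The fuel bounds both the candidates tried and each evaluation of [f]. *)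
Lemma evaluator_mu f H : evaluator f H -> exists H', evaluator (RMu f) H'.
Proof.
move=> [CH Hmono HP].
pose G t xs := if iteri t (mu_step H t xs) None is Some o then o else None.
have GP t xs n : G t xs = Some n <-> [/\ n < t, H t (n :: xs) = Some 0 &
    forall k, k < n -> exists v, H t (k :: xs) = Some v.+1].
  have [_ <-] := mu_stepP H t xs t; rewrite /G; split=> [|->//].
  by case: (iteri _ _ _) => // o ->.
exists G; split.
- pose R (z : nat * seq nat) k := mu_step H z.1 z.2 k.
  have CR : computable (fun u : (nat * seq nat) * (nat * option (option nat)) =>
      R u.1 u.2.1 u.2.2).
    rewrite /R /mu_step.
    pose S (u : (nat * seq nat) * (nat * option (option nat))) (v : nat) :=
      if v == 0 then Some (Some u.2.1) else None.
    have CS : computable (fun w : _ * nat => S w.1 w.2) by rewrite /S; comp.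
    apply: (@eq_computable _ _ (fun u => if u.2.2 is Some o then Some o
      else if H u.1.1 (u.2.1 :: u.1.2) is Some v then S u v else Some None)).
      by move=> [z [k [w|]]].
    by comp.
  apply: (@eq_computable _ _ (fun z : nat * seq nat => 
    if iteri z.1 (R z) None is Some o then o else None)).
    by [].
  by comp.
- move=> s t xs n lest /GP[ltns n0 npos]; apply/GP; split.
  + exact: leq_trans lest.
  + exact: Hmono n0.
  by move=> k /npos[v kv]; exists v; apply: Hmono kv.
move=> xs n; split.
  move=> /eval_mu_inv[/HP[t1 t1P] [h hP]].
  have [|k ltkn|t2 t2P] := @uniform_fuel
    (fun k t => H t (k :: xs) = Some (h k).+1) n.
  - by move=> k s t lest; apply: Hmono.
  - by apply/HP; apply: hP.
  (* Only candidates below the fuel are tried, hence [n.+1]. *)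
  exists (maxn n.+1 (maxn t1 t2)); apply/GP; split.
  + exact: leq_maxl.
  + by apply: Hmono t1P; rewrite (leq_trans _ (leq_maxr _ _)) ?leq_maxl.
  + move=> k /t2P kP; exists (h k); apply: Hmono kP.
    by rewrite (leq_trans _ (leq_maxr _ _)) ?leq_maxr.
move=> [t /GP[ltnt n0 npos]].
(* [EvalMu] asks for the predecessors of the positive values met before the zero; the default 0 is
   not read below [n]. *)
apply: (@EvalMu _ _ _ (fun k => (odflt 0 (H t (k :: xs))).-1)).
  by move=> k /npos[v kv]; apply/HP; exists t; rewrite kv.
by apply/HP; exists t.
Qed.

(** Applied to [U], this is how all the machines below run programs: they search for a sufficient
    amount of fuel. *)
Theorem evaluator_exists f : exists H, evaluator f H.
Proof.
elim/nested_recfun_ind: f => [||i|f gs|f g|f].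
- apply: (@evaluator_total _ (fun=> 0)); first by comp.
  by move=> xs v; split=> [E|->]; [inversion E|constructor].
- apply: (@evaluator_total _ (fun xs => (nth 0 xs 0).+1)); first by comp.
  by move=> xs v; split=> [E|->]; [inversion E|constructor].
- apply: (@evaluator_total _ (fun xs => nth 0 xs i)); first by comp.
  by move=> xs v; split=> [E|->]; [inversion E|constructor].
- move=> [H [CH Hmono HP]] /evaluator_comp_seq[Hs [CHs Hsmono HsP]].
  exists (fun t xs => if Hs t xs is Some ys then H t ys else None); split.
  + pose R (z : nat * seq nat) ys := H z.1 ys.
    have CR : computable (fun u : (nat * seq nat) * seq nat => R u.1 u.2).
      by rewrite /R; comp.
    apply: (@eq_computable _ _ (fun z : nat * seq nat => 
      if Hs z.1 z.2 is Some ys then R z ys else None)) => //.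
    by comp.
  + move=> s t xs v lest; case E: (Hs s xs) => [ys|//].
    by rewrite (Hsmono _ _ _ _ lest E); apply: Hmono.
  + move=> xs z; split.
      move=> /eval_comp_inv[ys [szy ysP]] /HP[t1 t1P].
      have [t2 t2P] : exists t, Hs t xs = Some ys by apply/HsP.
      exists (maxn t1 t2); rewrite (Hsmono _ _ _ _ (leq_maxr _ _) t2P).
      exact: Hmono (leq_maxl _ _) t1P.
    move=> [t]; case E: (Hs t xs) => [ys|//] tP.
    have [szy ysP] := proj2 (HsP xs ys) (ex_intro _ t E).
    by apply: EvalComp szy ysP _; apply/HP; exists t.
- by move=> [Hf +] [Hg +]; apply: evaluator_prec.
- by move=> [H]; apply: evaluator_mu.
Qed.

(** Both computations are repeated with the larger of their two amounts of fuel. *)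
Lemma eval_functional f xs v w : eval f xs v -> eval f xs w -> v = w.
Proof.
have [H [_ Hmono HP]] := evaluator_exists f.
move=> /HP[s /(Hmono _ (maxn s _)) Hs] /HP[t /(Hmono _ (maxn _ t)) Ht].
by have := Hs t (leq_maxl _ _); rewrite (Ht s (leq_maxr _ _)) => -[].
Qed.

Definition first (P : nat -> bool) s := P s && [forall k : 'I_s, ~~ P k].

Lemma ex_first (P : nat -> bool) : (exists s, P s) -> exists s, first P s.
Proof.
move=> exP; case: (ex_minnP exP) => s Ps mins; exists s; rewrite /first Ps /=.
by apply/forallP => k; apply/negP => /mins; rewrite leqNgt ltn_ord.
Qed.

Lemma first_lt P s k : first P s -> k < s -> ~~ P k.
Proof. by move=> /andP[_ /forallP nP] lt; apply: (nP (Ordinal lt)). Qed.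

Lemma firstP P s : first P s -> P s. Proof. by case/andP. Qed.

(** The common shape of all machines below: search for the least certificate [s], then compute the
    output from it. The machine halts exactly when some certificate is accepted, so prefix-freeness
    becomes a property of [P]. *)
Lemma machine_exists (P : nat -> seq bool -> nat -> bool)
    (F : nat -> seq bool -> nat -> nat) :
  computable (fun z : nat * (seq bool * nat) => P z.1 z.2.1 z.2.2) ->
  computable (fun z : nat * (seq bool * nat) => F z.1 z.2.1 z.2.2) ->
  exists T, forall y p x, eval T [:: y; pickle p] x <->
    exists2 s, first (P y p) s & x = F y p s.
Proof.
move=> [rP rPP] [rF rFP].
pose arg i j k := RComp rcode [:: RProj i; RComp rcode [:: RComp rcode
  [:: RProj j; RComp rcode [:: RProj k; RZero]]; RZero]].
have argP i j k (xs : seq nat) y (p : seq bool) s : nth 0 xs i = y ->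
    nth 0 xs j = pickle p -> nth 0 xs k = s ->
    eval (arg i j k) xs (pickle (y, (p, s))).
  move=> iE jE kE; rewrite !pickle_pair.
  apply: eval_comp2 (eval_proj iE) _ (eval_code _ _).
  apply: eval_comp2 (EvalZero _) (eval_code _ _).
  apply: eval_comp2 (eval_proj jE) _ (eval_code _ _).
  exact: eval_comp2 (eval_proj kE) (EvalZero _) (eval_code _ _).
pose test := RComp rnot [:: RComp rP [:: arg 1 2 0]].
have testP y p s : eval test [:: s; y; pickle p] (~~ P y p s).
  rewrite -eqb0; apply: eval_comp1 (eval_not _ _).
  by apply: eval_comp1 (rPP (y, (p, s))); apply: argP.
exists (RComp (RComp rF [:: arg 1 2 0]) [:: RMu test; RProj 0; RProj 1]) => y p x.
have outP s : first (P y p) s ->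
    eval (RComp (RComp rF [:: arg 1 2 0]) [:: RMu test; RProj 0; RProj 1])
      [:: y; pickle p] (F y p s).
  move=> sP; apply: (EvalComp (ys := [:: s; y; pickle p])) => //.
    move=> [|[|[|k]]]// _; try exact: eval_proj.
    apply: (EvalMu (h := fun=> 0)) => [k lt|].
      by have := testP y p k; rewrite (first_lt sP lt).
    by have := testP y p s; rewrite (firstP sP).
  by apply: eval_comp1 (rFP (y, (p, s))); apply: argP.
split=> [E|[s sP ->]]; last exact: outP.
have [ys [_ /(_ 0 isT) /= /eval_mu_inv[sP [h hP]] _]] := eval_comp_inv E.
have {}sP : first (P y p) (nth 0 ys 0).
  apply/andP; split.
    by have := eval_functional sP (testP y p _); case: (P _ _ _).
  apply/forallP => k.
  by have := eval_functional (hP k (ltn_ord k)) (testP y p _); case: (P _ _ _).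
by exists (nth 0 ys 0) => //; apply: eval_functional E _; apply: outP.
Qed.

(** * The coding theorem *)

(** The string is read as a binary numeral v, most significant bit first, so that it denotes the
    dyadic interval from v / 2^|p| to (v + 1) / 2^|p|. *)
Definition bits_val (p : seq bool) := foldl (fun v (b : bool) => v + v + b) 0 p.

Lemma bits_val_cat p q :
  bits_val (p ++ q) = bits_val p * 2 ^ size q + bits_val q.
Proof.
rewrite /bits_val foldl_cat; set v := foldl _ 0 p.
elim/last_ind: q => [|q b IHq]; first by rewrite muln1 addn0.
rewrite -!cats1 !foldl_cat /= IHq size_cat expnD expn1 mulnA; lia.
Qed.

Lemma bits_val_lt p : bits_val p < 2 ^ size p.
Proof.
elim/last_ind: p => [|p b IHp] //; rewrite -cats1 bits_val_cat size_cat expnD.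
by move: IHp; rewrite /bits_val /=; case: b => /=; lia.
Qed.

Lemma bits_exist k a : a < 2 ^ k -> exists2 p, size p = k & bits_val p = a.
Proof.
elim: k a => [|k IHk] a; first by rewrite ltnS leqn0 => /eqP->; exists [::].
rewrite expnS => lta; have [|p sz_p pE] := IHk a./2.
  by move: (odd_double_half a) lta; case: odd; lia.
exists (rcons p (odd a)); first by rewrite size_rcons sz_p.
rewrite -cats1 bits_val_cat pE /bits_val /= -[RHS]odd_double_half.
by case: odd; lia.
Qed.

Section Coding.
(** Under the condition y, the t-th approximation of the weight of i is [N y i t / 2 ^ t]. By
    [N_mono] these fractions increase with t. *)
Variable N : nat -> nat -> nat -> nat.
Hypothesis N_computable :
  computable (fun z : nat * (nat * nat) => N z.1 z.2.1 z.2.2).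
Hypothesis N_mono : forall y i t, 2 * N y i t <= N y i t.+1.

Local Notation big y i l t := (2 ^ t < N y i t * 2 ^ l).

Lemma big_mono y i l s t : s <= t -> big y i l s -> big y i l t.
Proof.
move=> /subnK <-; elim: (t - s) => //= d IHd /IHd; rewrite addSn expnS.
have := N_mono y i (d + s); move: (N _ _ _) (N _ _ _) => a b.
by move: (2 ^ _) (2 ^ l) => u v; nia.
Qed.

(* Stage [r], read as a triple (i, l, t), requests a codeword of length l + 2
   for i when the t-th approximation of the weight of i is the first one to
   exceed 2^-l. *)
Definition requests y i l r :=
  let t := nth 0 (CodeSeq.decode r) 2 in
  [&& r == CodeSeq.code [:: i; l; t], big y i l t & (t == 0) || ~~ big y i l t.-1].

Definition request y r : option (nat * nat) :=
  let i := nth 0 (CodeSeq.decode r) 0 in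
  let l := nth 0 (CodeSeq.decode r) 1 in
  if requests y i l r then Some (i, l) else None.

Lemma requestP y i l r : (request y r == Some (i, l)) = requests y i l r.
Proof.
rewrite /request; apply/eqP/idP => [|rq].
  by case: ifP => // rq [<- <-].
case/and3P: (rq) => /eqP rE _ _.
have -> : nth 0 (CodeSeq.decode r) 0 = i by rewrite rE CodeSeq.codeK.
have -> : nth 0 (CodeSeq.decode r) 1 = l by rewrite rE CodeSeq.codeK.
by rewrite rq.
Qed.

(** A code exceeds its entries. Hence the subtraction in the exponent [r - l] of [used] is not
    truncated, and the requests before stage s concern only i and l below s. *)
Lemma request_lt y i l r : request y r = Some (i, l) -> i < r /\ l < r.
Proof.
move=> /eqP; rewrite requestP => /and3P[/eqP-> _ _].
by have /= /and4P[-> -> _ _] := CodeSeq.ltn_code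
  [:: i; l; nth 0 (CodeSeq.decode r) 2].
Qed.

(** By monotonicity a threshold is crossed for the first time only once, so each pair (i, l) is
    charged at most once. *)
Lemma requests_inj y i l r s : requests y i l r -> requests y i l s -> r = s.
Proof.
move=> /and3P[/eqP rE br fr] /and3P[/eqP sE bs fs]; rewrite rE sE.
have [lt|lt|->//] := ltngtP (nth 0 (CodeSeq.decode r) 2)
  (nth 0 (CodeSeq.decode s) 2).
- move: fs; rewrite (gtn_eqF (leq_ltn_trans (leq0n _) lt)) /= => /negP[].
  by apply: big_mono br; lia.
- move: fr; rewrite (gtn_eqF (leq_ltn_trans (leq0n _) lt)) /= => /negP[].
  by apply: big_mono bs; lia.
Qed.

(* The weights 2^-(l + 1) of the requests made before stage [s] add up to
   [used y s / 2 ^ s]. *)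
Definition used y s := iteri s (fun r c =>
  2 * c + if request y r is Some u then 2 ^ (r - u.2) else 0) 0.

(** The reserved interval begins at [used y s / 2 ^ s]. This is its beginning in units of 2^-(l +
    2), rounded up. *)
Definition left_end y s l := (used y s * 2 ^ l.+2 + (2 ^ s).-1) %/ 2 ^ s.

Lemma used_mono y r s : r <= s -> used y r * 2 ^ (s - r) <= used y s.
Proof.
move=> /subnK <-; rewrite addnK; move: (s - r) => d.
elim: d => [|d IHd]; first by rewrite muln1.
by rewrite addSn /= -/(used y _) expnS mulnCA (leq_trans _ (leq_addr _ _))// leq_mul2l IHd.
Qed.

Lemma left_end_ge y s l : used y s * 2 ^ l.+2 <= left_end y s l * 2 ^ s.
Proof.
have d_gt0 : 0 < 2 ^ s by rewrite expn_gt0.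
rewrite /left_end; set u := _ * _; have := divn_eq (u + (2 ^ s).-1) (2 ^ s).
have := ltn_pmod (u + (2 ^ s).-1) d_gt0; lia.
Qed.

(** Rounding up loses less than 2^-(l + 2), which is half of the reserved length, so the other half
    holds the dyadic interval. *)
Lemma left_end_le y s i l : request y s = Some (i, l) ->
  (left_end y s l).+1 * 2 ^ s.+1 <= used y s.+1 * 2 ^ l.+2.
Proof.
move=> rq; have [_ lts] := request_lt rq.
have E : used y s.+1 = 2 * used y s + 2 ^ (s - l) by rewrite /used /= rq.
rewrite E mulnDl -expnD addnS addnS subnK ?(ltnW lts)// !expnS.
have lE : left_end y s l * 2 ^ s <= used y s * 2 ^ l.+2 + (2 ^ s).-1.
  by rewrite /left_end leq_divM.
have : 0 < 2 ^ s by rewrite expn_gt0.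
move: lE; rewrite !expnS; move: (left_end y s l) (used _ _) (2 ^ l) (2 ^ s) => a u b c.
by nia.
Qed.

(* The dyadic intervals [a / 2^(k+2), (a+1) / 2^(k+2)) of distinct requests are
   disjoint. *)
Lemma left_end_lt y r s i j k l : r < s ->
  request y r = Some (i, k) -> request y s = Some (j, l) ->
  (left_end y r k).+1 * 2 ^ l.+2 <= left_end y s l * 2 ^ k.+2.
Proof.
move=> ltrs rq_r rq_s.
have A := left_end_le rq_r; have B := used_mono y ltrs; have C := left_end_ge y s l.
(* Multiplying by [2 ^ s] allows the end of the first interval, the space used after stage r and the
   start of the second interval to be compared without fractions. *)
rewrite -(@leq_pmul2r (2 ^ s)) ?expn_gt0//.
have -> : 2 ^ s = 2 ^ r.+1 * 2 ^ (s - r.+1) by rewrite -expnD subnKC.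
have {}C : used y s * 2 ^ l.+2 <= left_end y s l * (2 ^ r.+1 * 2 ^ (s - r.+1)).
  by rewrite -expnD subnKC.
rewrite (_ : _ * _ * (_ * _) = (left_end y r k).+1 * 2 ^ r.+1 *
  (2 ^ l.+2 * 2 ^ (s - r.+1))); last by ring.
rewrite (_ : left_end _ _ _ * _ * _ = left_end y s l *
  (2 ^ r.+1 * 2 ^ (s - r.+1)) * 2 ^ k.+2); last by ring.
have C' := leq_mul C (leqnn (2 ^ k.+2)); apply: leq_trans C'.
apply: leq_trans (leq_mul A (leqnn _)) _.
rewrite (_ : _ * _ * _ = used y r.+1 * 2 ^ (s - r.+1) * 2 ^ l.+2 * 2 ^ k.+2).
  by rewrite !leq_mul.
by ring.
Qed.

Definition codeword y p s : bool :=
  if request y s is Some u then (size p == u.2.+2) && (bits_val p == left_end y s u.2)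
  else false.

Lemma codewordP y p s : codeword y p s -> exists i l,
  [/\ request y s = Some (i, l), size p = l.+2 & bits_val p = left_end y s l].
Proof.
by rewrite /codeword; case: request => // -[i l] /andP[/eqP ? /eqP ?]; exists i, l.
Qed.

(** A string and its extension denote nested dyadic intervals, whereas distinct requests own
    disjoint ones. The argument is valid under every condition y, as prefix-freeness demands. *)
Lemma codeword_prefix y p q r s : codeword y p r -> codeword y (p ++ q) s ->
  r = s /\ q = [::].
Proof.
move=> /codewordP[i [k [rq_r sz_p pE]]] /codewordP[j [l [rq_s sz_q qE]]].
have lkl : 2 ^ l.+2 = 2 ^ k.+2 * 2 ^ size q.
  by rewrite -expnD -sz_p -size_cat sz_q.
have ltq := bits_val_lt q; rewrite bits_val_cat pE in qE.
have gt0 : 0 < 2 ^ k.+2 by rewrite expn_gt0.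
have [lt|lt|eqrs] := ltngtP r s.
- have := left_end_lt lt rq_r rq_s; move: lkl qE gt0 ltq.
  move: (2 ^ l.+2) (2 ^ k.+2) (2 ^ size q) (left_end _ _ _) (left_end _ _ _).
  by move: (bits_val q) => v a b c d e -> <-; nia.
- have := left_end_lt lt rq_s rq_r; move: lkl qE gt0 ltq.
  move: (2 ^ l.+2) (2 ^ k.+2) (2 ^ size q) (left_end _ _ _) (left_end _ _ _).
  by move: (bits_val q) => v a b c d e -> <-; nia.
split=> //; apply: size0nil; move: rq_s; rewrite -eqrs rq_r => -[_ eqkl].
by move: sz_q; rewrite size_cat sz_p eqkl; lia.
Qed.

Lemma codeword_computable :
  computable (fun z : nat * (seq bool * nat) => codeword z.1 z.2.1 z.2.2).
Proof.
have Creqs : computable (fun z : nat * (nat * (nat * nat)) =>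
    requests z.1 z.2.1 z.2.2.1 z.2.2.2).
  by rewrite /requests; comp.
have Creq : computable (fun z : nat * nat => request z.1 z.2).
  rewrite /request; comp.
  apply: (computable_comp Creqs (f := fun z => (z.1, (nth 0 (CodeSeq.decode z.2) 0,
    (nth 0 (CodeSeq.decode z.2) 1, z.2))))).
  by comp.
have Cused : computable (fun z : nat * nat => used z.1 z.2).
  rewrite /used.
  pose G (u : nat * (nat * nat)) (v : nat * nat) := 2 ^ (u.2.1 - v.2).
  have CG : computable (fun w : (nat * (nat * nat)) * (nat * nat) => G w.1 w.2).
    by rewrite /G; comp.
  pose F (y r c : nat) := 2 * c + if request y r is Some u then G (y, (r, c)) u else 0.
  have CF : computable (fun w : nat * (nat * nat) => F w.1 w.2.1 w.2.2).
    apply: (@eq_computable _ _ (fun w : nat * (nat * nat) => 2 * w.2.2 +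
      if request w.1 w.2.1 is Some u then G w u else 0)).
      by move=> [y [r c]].
    by comp.
  apply: (@eq_computable _ _ (fun z : nat * nat => iteri z.2 (F z.1) 0)) => //.
  by comp.
have Cleft : computable (fun z : nat * (nat * nat) => left_end z.1 z.2.1 z.2.2).
  by rewrite /left_end; comp.
have Cval : computable bits_val by rewrite /bits_val; comp.
rewrite /codeword; pose G (w : nat * (seq bool * nat)) (u : nat * nat) :=
  (size w.2.1 == u.2.+2) && (bits_val w.2.1 == left_end w.1 w.2.2 u.2).
have CG : computable (fun v : (nat * (seq bool * nat)) * (nat * nat) => G v.1 v.2).
  by rewrite /G; comp.
apply: (@eq_computable _ _ (fun w => if request w.1 w.2.2 is Some u then G w u else false)).
  by [].
by comp.
Qed.

Definition weight_below y := forall m t, \sum_(i < m) N y i t <= 2 ^ t.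

(** Let l0 be the least l with 2^-l below a / 2^s. The reservations of length 2^-(l + 1) for l0 <= l
    < m form a geometric sum equal to 2^-l0 - 2^-m. If there is no such l below m, the left side is
    0 and truncated subtraction is harmless. *)
Lemma sum_big_le a s m : m <= s ->
  \sum_(l < m) (2 ^ s < a * 2 ^ l) * 2 ^ (s.-1 - l) <= a - 2 ^ (s - m).
Proof.
elim: m => [|m IHm] ltms; first by rewrite big_ord0.
rewrite big_ord_recr /=; have {IHm} := IHm (ltnW ltms).
have -> : s.-1 - m = s - m.+1 by lia.
have -> : 2 ^ (s - m) = 2 * 2 ^ (s - m.+1) by rewrite -expnS; congr (2 ^ _); lia.
have -> : 2 ^ s = 2 * 2 ^ (s - m.+1) * 2 ^ m.
  by rewrite -expnS -expnD; congr (2 ^ _); lia.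
rewrite ltn_pmul2r ?expn_gt0//.
case: ltnP => h; rewrite ?mul1n ?mul0n; move: h; set S := \sum_(l < m) _;
  by move: S (2 ^ (s - m.+1)); lia.
Qed.

Lemma usedE y s : used y s = \sum_(r < s)
  if request y r is Some u then 2 ^ (s.-1 - u.2) else 0.
Proof.
elim: s => [|s IHs]; first by rewrite big_ord0.
rewrite big_ord_recr /= -/(used y s) IHs big_distrr /=; congr (_ + _).
apply: eq_bigr => r _; case rq: request => [[i l]|] //=.
have [_ ltlr] := request_lt rq; have := ltn_ord r.
by rewrite -expnS => ltrs; congr (2 ^ _); lia.
Qed.

Lemma count_requests y i l s :
  \sum_(r < s) (requests y i l r : nat) <= (2 ^ s < N y i s * 2 ^ l).
Proof.
case: (pickP (fun r : 'I_s => requests y i l r)) => [r rq|none]; last first.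
  by rewrite big1 // => r _; rewrite none.
rewrite (bigD1 r) //= rq big1 => [|k neq_kr]; last first.
  apply/eqP; rewrite eqb0; apply: contra neq_kr => rqk.
  by apply/eqP/val_inj/(requests_inj rqk rq).
have /and3P[/eqP rE big_t _] := rq.
rewrite (_ : (_ < _) = true)//; apply: big_mono big_t.
have := CodeSeq.ltn_code [:: i; l; nth 0 (CodeSeq.decode r) 2].
by rewrite -rE => /and4P[_ _ lt _]; apply/ltnW/(ltn_trans lt).
Qed.

(** The requests are grouped by i and l. A pair occurs at most once, and only if 2^-l is below the
    weight of i at time s, so [sum_big_le] bounds the share of i by its weight. *)
Lemma used_le y s : weight_below y -> used y s <= 2 ^ s.
Proof.
move=> /(_ s s); apply: leq_trans; rewrite usedE.
apply: (@leq_trans (\sum_(r < s) \sum_(i < s) \sum_(l < s)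
    (requests y i l r) * 2 ^ (s.-1 - l))).
  apply: leq_sum => r _; case rq: request => [[i l]|] //=.
  have [ltir ltlr] := request_lt rq; have ltrs := ltn_ord r.
  rewrite (bigD1 (Ordinal (ltn_trans ltir ltrs))) //=.
  rewrite (bigD1 (Ordinal (ltn_trans ltlr ltrs))) //=.
  by move/eqP: rq; rewrite requestP => ->; rewrite mul1n -addnA leq_addr.
rewrite exchange_big; apply: leq_sum => i _ /=.
rewrite exchange_big /= (leq_trans _ (leq_subr (2 ^ (s - s)) _))//.
apply: leq_trans (sum_big_le _ (leqnn s)); apply: leq_sum => l _.
by rewrite -big_distrl leq_mul2r count_requests orbT.
Qed.

End Coding.

(** One machine serves all conditions, which makes c independent of y; [weight_below] enters when a
    codeword of the required length is to be found. *)
Theorem coding_theorem U (N : nat -> nat -> nat -> nat) : universal U ->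
  computable (fun z : nat * (nat * nat) => N z.1 z.2.1 z.2.2) ->
  (forall y i t, 2 * N y i t <= N y i t.+1) ->
  exists c, forall y, weight_below N y -> forall i l,
    (exists t, 2 ^ t < N y i t * 2 ^ l) ->
    exists2 p, runs U y p i & size p <= l + c.
Proof.
move=> [_ Uuniv] CN Nmono.
have [T TP] := machine_exists (F := fun _ _ s => nth 0 (CodeSeq.decode s) 0)
  (codeword_computable CN) ltac:(comp).
have [y p s nz_s [x /TP[r /firstP rP _]] [x' /TP[r' /firstP r'P _]]|t tP] := Uuniv T.
  by have [_ s0] := codeword_prefix rP r'P; rewrite s0 in nz_s.
(* The codeword for the threshold l has length l + 2 and follows the prefix [t] by which [U]
   simulates the machine. *)
exists (size t + 2) => y wy i l exb.
case: (ex_minnP exb) => m bm minm.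
pose s := CodeSeq.code [:: i; l; m].
have rq : request N y s = Some (i, l).
  apply/eqP; rewrite requestP /requests /s CodeSeq.codeK /= eqxx bm /=.
  case: m {s} bm minm => //= m _ minm; apply/negP => /minm.
  by rewrite ltnn.
(* The space used after stage s is at most 1, so the left end is below [2 ^ l.+2] and is the value
   of a string of length [l.+2]. *)
have [|p sz_p pE] := @bits_exist l.+2 (left_end N y s l).
  have := leq_trans (left_end_le rq) (leq_mul (used_le Nmono s.+1 wy) (leqnn _)).
  by rewrite mulnC leq_pmul2l ?expn_gt0.
have ps : codeword N y p s by rewrite /codeword rq sz_p pE !eqxx.
exists (t ++ p); last by rewrite size_cat sz_p; lia.
apply/tP/TP; have [s' s'P] : exists s', first (codeword N y p) s'.
  by apply: ex_first; exists s.
exists s' => //; have := codeword_prefix ps (q := [::]) (s := s').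
rewrite cats0 => /(_ (firstP s'P))[<- _].
by rewrite /s CodeSeq.codeK.
Qed.

(** * Exact arithmetic on codes *)

Section Computable_arith.
Variable X : countType.

Lemma computable_dvdn (f g : X -> nat) :
  computable f -> computable g -> computable (fun x => f x %| g x).
Proof.
move=> Cf Cg; apply: (@eq_computable _ _ (fun x => g x %/ f x * f x == g x)).
  by move=> x; rewrite dvdn_eq.
by comp.
Qed.

(** Integers are coded through the sum type [nat + nat], hence as pairs of options. *)
Lemma computable_Posz (f : X -> nat) :
  computable f -> computable (fun x => Posz (f x)).
Proof.
move=> Cf; apply: (@computable_pickle _ _ _
  (fun x => (Some (f x), None : option nat))) => //.
by comp.
Qed.

Lemma computable_Negz (f : X -> nat) :
  computable f -> computable (fun x => Negz (f x)).
Proof.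
move=> Cf; apply: (@computable_pickle _ _ _
  (fun x => (None : option nat, Some (f x)))) => //.
by comp.
Qed.

Definition pos_part (z : int) := if z is Posz n then n else 0.
Definition neg_part (z : int) := if z is Negz n then n.+1 else 0.

Lemma computable_pos_part (f : X -> int) :
  computable f -> computable (fun x => pos_part (f x)).
Proof.
move=> Cf; have Cg : computable (fun x => opair_of_sum (natsum_of_int (f x))).
  exact: (computable_pickle _ Cf).
apply: (@eq_computable _ _ (fun x =>
   if (opair_of_sum (natsum_of_int (f x))).1 is Some n then n else 0)).
  by move=> x; case: (f x).
by comp.
Qed.

Lemma computable_neg_part (f : X -> int) :
  computable f -> computable (fun x => neg_part (f x)).
Proof.
move=> Cf; have Cg : computable (fun x => opair_of_sum (natsum_of_int (f x))).
  exact: (computable_pickle _ Cf).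
apply: (@eq_computable _ _ (fun x =>
   if (opair_of_sum (natsum_of_int (f x))).2 is Some n then n.+1 else 0)).
  by move=> x; case: (f x).
by comp.
Qed.

Lemma computable_subz (f g : X -> nat) :
  computable f -> computable g -> computable (fun x => Posz (f x) - Posz (g x))%R.
Proof.
move=> Cf Cg; apply: (@eq_computable _ _ (fun x =>
    if g x <= f x then Posz (f x - g x) else Negz (g x - f x).-1)).
  by move=> x; case: leqP => h; lia.
by comp; [apply: computable_Posz|apply: computable_Negz]; comp.
Qed.

Lemma pos_neg_partE z : z = (Posz (pos_part z) - Posz (neg_part z))%R.
Proof. by case: z => n /=; lia. Qed.

Lemma computable_addz (f g : X -> int) :
  computable f -> computable g -> computable (fun x => f x + g x)%R.
Proof.
move=> Cf Cg; apply: (@eq_computable _ _ (fun x =>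
    Posz (pos_part (f x) + pos_part (g x)) -
    Posz (neg_part (f x) + neg_part (g x)))%R).
  by move=> x; rewrite [in RHS](pos_neg_partE (f x)) [in RHS](pos_neg_partE (g x)); lia.
by apply: computable_subz; comp; do ?[exact: computable_pos_part|exact: computable_neg_part].
Qed.

Lemma computable_mulz (f g : X -> int) :
  computable f -> computable g -> computable (fun x => f x * g x)%R.
Proof.
move=> Cf Cg; apply: (@eq_computable _ _ (fun x =>
    Posz (pos_part (f x) * pos_part (g x) + neg_part (f x) * neg_part (g x)) -
    Posz (pos_part (f x) * neg_part (g x) + neg_part (f x) * pos_part (g x)))%R).
  move=> x; rewrite [in RHS](pos_neg_partE (f x)) [in RHS](pos_neg_partE (g x)).
  by rewrite !PoszD !PoszM; ring.
by apply: computable_subz; comp; do ?[exact: computable_pos_part|exact: computable_neg_part].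
Qed.

Lemma computable_absz (f : X -> int) :
  computable f -> computable (fun x => absz (f x)).
Proof.
move=> Cf; apply: (@eq_computable _ _ (fun x => pos_part (f x) + neg_part (f x))).
  by move=> x; case: (f x) => n /=; lia.
by comp; [exact: computable_pos_part|exact: computable_neg_part].
Qed.

Lemma computable_valq (f : X -> rat) :
  computable f -> computable (fun x => valq (f x)).
Proof. exact: computable_pickle. Qed.

Lemma computable_numq (f : X -> rat) :
  computable f -> computable (fun x => numq (f x)).
Proof. by move=> Cf; apply: computable_fst; apply: computable_valq. Qed.

Lemma computable_denq (f : X -> rat) :
  computable f -> computable (fun x => denq (f x)).
Proof. by move=> Cf; apply: computable_snd; apply: computable_valq. Qed.

End Computable_arith.

(** It follows that the reduced denominator of n / d is the least positive k such that d divides n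
    k, which a search can find. *)
Lemma denq_dvd (n : int) (d k : nat) : 0 < d ->
  (d %| absz n * k) = (absz (denq (n%:~R / d%:R)) %| k).
Proof.
move=> d_gt0; set q := (_ / _)%R; have [a_gt0 co] := (denq_gt0 q, coprime_num_den q).
have dNZ : (d%:R != 0 :> rat)%R by rewrite pnatr_eq0 -lt0n.
have E : (n * denq q = numq q * d%:Z)%R.
  have qE : (n%:~R = q * d%:~R)%R by rewrite /q -pmulrn divfK.
  by apply/eqP; rewrite -(eqr_int rat) !rmorphM /= numqE qE mulrAC.
have {}E : absz n * absz (denq q) = absz (numq q) * d by rewrite -[d in RHS]/(absz d) -!abszM E.
have den_gt0 : 0 < absz (denq q) by rewrite absz_gt0 denq_neq0.
apply/idP/idP => /dvdnP[c cE].
  have : absz (denq q) %| absz (numq q) * k.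
    apply/dvdnP; exists c; apply/eqP; rewrite -(eqn_pmul2r d_gt0).
    by rewrite mulnAC -E mulnAC cE; apply/eqP; lia.
  by rewrite Gauss_dvdr// coprime_sym.
by apply/dvdnP; exists (c * absz (numq q)); rewrite cE mulnCA E mulnA.
Qed.

Lemma natr_absz_denq q : ((absz (denq q))%:R = (denq q)%:~R :> rat)%R.
Proof. by rewrite -[in RHS]absz_denq pmulrn. Qed.

Section Computable_rat.
Variable X : countType.

(** Rationals are coded in lowest terms. The denominator is found by search, and the numerator is f
    times this denominator divided by g, an exact division. *)
Lemma computable_ratio (f : X -> int) (g : X -> nat) : (forall x, 0 < g x) ->
  computable f -> computable g -> computable (fun x => (f x)%:~R / (g x)%:R : rat)%R.
Proof.
move=> g_gt0 Cf Cg; pose q x : rat := ((f x)%:~R / (g x)%:R)%R.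
have Cdvd : computable (fun z : X * nat =>
    (0 < z.2) && (g z.1 %| absz (f z.1) * z.2)).
  by apply: computable_andb; [comp|apply: computable_dvdn; comp; apply: computable_absz; comp].
have Cden : computable (fun x => absz (denq (q x))).
  apply: (@computable_bigmin _ _
    (fun x k => (0 < k) && (g x %| absz (f x) * k)) Cdvd) => [x|x k ltk] /=;
    rewrite denq_dvd//.
    by rewrite dvdnn absz_gt0 denq_neq0.
  by case: posnP => //= k_gt0; rewrite gtnNdvd.
have Cnum : computable (fun x => numq (q x)).
  apply: (@eq_computable _ _ (fun x =>
    Posz (pos_part (f x) * absz (denq (q x)) %/ g x) -
    Posz (neg_part (f x) * absz (denq (q x)) %/ g x))%R); last first.
    by apply: computable_subz; comp; do ?[exact: computable_pos_part|exact: computable_neg_part].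
  move=> x; have gNZ : ((g x)%:R != 0 :> rat)%R by rewrite pnatr_eq0 -lt0n.
  have E : (f x * denq (q x) = numq (q x) * (g x)%:Z)%R.
    have qE : ((f x)%:~R = q x * (g x)%:~R)%R by rewrite /q -pmulrn divfK.
    by apply/eqP; rewrite -(eqr_int rat) !rmorphM /= numqE qE mulrAC.
  have := denq_gt0 (q x); have := g_gt0 x.
  case: (denq (q x)) E => // d; case: (f x) => a /=.
    rewrite -PoszM /=; case: (numq (q x)) => b E; last by lia.
    move=> gx d_gt0; move: E; rewrite -PoszM => -[->].
    by rewrite mulnK// mul0n div0n subr0.
  case: (numq (q x)) => b E; first by lia.
  move=> gx d_gt0; move: E; rewrite !NegzE !mulNr => /oppr_inj; rewrite -!PoszM => -[->].
  by rewrite mulnK// mul0n div0n sub0r.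
apply: (@computable_pickle _ _ _ (fun x => (numq (q x), Posz (absz (denq (q x)))))).
  by move=> x; rewrite -[RHS]/(pickle (numq (q x), denq (q x))) absz_denq.
by comp; apply: computable_Posz.
Qed.

Lemma computable_addq (f g : X -> rat) :
  computable f -> computable g -> computable (fun x => f x + g x)%R.
Proof.
move=> Cf Cg; apply: (@eq_computable _ _ (fun x =>
  (numq (f x) * denq (g x) + numq (g x) * denq (f x))%:~R /
  (absz (denq (f x)) * absz (denq (g x)))%:R)%R).
  move=> x; rewrite natrM !natr_absz_denq.
  rewrite -[in RHS](divq_num_den (f x)) -[in RHS](divq_num_den (g x)).
  by rewrite rmorphD !rmorphM /=; field; rewrite !intr_eq0 !denq_neq0.
apply: computable_ratio; first by move=> x; rewrite muln_gt0 !absz_gt0 !denq_neq0.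
  apply: computable_addz; apply: computable_mulz;
  by do ?[exact: computable_numq|exact: computable_denq].
by comp; apply: computable_absz; exact: computable_denq.
Qed.

Lemma computable_mulq (f g : X -> rat) :
  computable f -> computable g -> computable (fun x => f x * g x)%R.
Proof.
move=> Cf Cg; apply: (@eq_computable _ _ (fun x =>
  (numq (f x) * numq (g x))%:~R /
  (absz (denq (f x)) * absz (denq (g x)))%:R)%R).
  move=> x; rewrite natrM !natr_absz_denq.
  rewrite -[in RHS](divq_num_den (f x)) -[in RHS](divq_num_den (g x)).
  by rewrite !rmorphM /=; field; rewrite !intr_eq0 !denq_neq0.
apply: computable_ratio; first by move=> x; rewrite muln_gt0 !absz_gt0 !denq_neq0.
  by apply: computable_mulz; exact: computable_numq.
by comp; apply: computable_absz; exact: computable_denq.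
Qed.

Lemma computable_oppq (f : X -> rat) :
  computable f -> computable (fun x => - f x)%R.
Proof.
move=> Cf; apply: (@eq_computable _ _ (fun x => (-1) * f x)%R).
  by move=> x; rewrite mulN1r.
by apply: computable_mulq => //; apply: computable_const.
Qed.

Lemma computable_Re (f : X -> rat[i]%C) :
  computable f -> computable (fun x => complex.Re (f x)).
Proof.
move=> Cf; apply: (@eq_computable _ _ (fun x =>
   nth 0%R (ComplexEqChoice.sqR_of_complex (f x)) 0)).
  by move=> x; case: (f x).
by comp; apply: computable_pickle Cf.
Qed.

Lemma computable_Im (f : X -> rat[i]%C) :
  computable f -> computable (fun x => complex.Im (f x)).
Proof.
move=> Cf; apply: (@eq_computable _ _ (fun x =>
   nth 0%R (ComplexEqChoice.sqR_of_complex (f x)) 1)).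
  by move=> x; case: (f x).
by comp; apply: computable_pickle Cf.
Qed.

Lemma computable_complex (f g : X -> rat) :
  computable f -> computable g -> computable (fun x => f x +i* g x)%C.
Proof.
move=> Cf Cg; apply: (@computable_pickle _ _ _ (fun x => [:: f x; g x])) => //.
by comp.
Qed.

End Computable_rat.

Lemma computable_sumq (X : countType) (n : X -> nat) (F : X -> nat -> rat) :
  computable n -> computable (fun z : X * nat => F z.1 z.2) ->
  computable (fun x => \sum_(0 <= k < n x) F x k)%R.
Proof.
move=> Cn CF.
apply: (@eq_computable _ _ (fun x => iteri (n x) (fun k y => y + F x k)%R 0%R)).
  by move=> x; elim: (n x) => [|m] /=; rewrite ?big_nil ?big_nat_recr //= => ->.
by comp; apply: computable_addq; comp.
Qed.

(* The decoders are total: they return junk on the numbers which are not codes. *)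
Definition field_at (c k : nat) := nth 0 (CodeSeq.decode c) k.

Definition int_of_code c : int :=
  if field_at c 0 == 0 then Negz (field_at (field_at c 1) 0)
  else Posz (field_at (field_at c 0) 0).

Definition rat_of_code c : rat :=
  ((int_of_code (field_at c 0))%:~R /
   (absz (int_of_code (field_at c 1))).-1.+1%:R)%R.

Definition complex_of_code c : rat[i]%C :=
  (rat_of_code (field_at c 0) +i* rat_of_code (field_at c 1))%C.

(** A matrix is coded by the graph of its entry function, a sequence of pairs of an index and a
    value; field 1 is the value. *)
Definition entry (c k : nat) : rat[i]%C :=
  complex_of_code (field_at (field_at c k) 1).

Lemma field_at_code s k : field_at (CodeSeq.code s) k = nth 0 s k.
Proof. by rewrite /field_at CodeSeq.codeK. Qed.

Lemma int_of_codeK z : int_of_code (pickle z) = z.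
Proof.
case: z => n.
- rewrite -[pickle (Posz n)]/(CodeSeq.code [:: CodeSeq.code [:: n]; 0]).
  by rewrite /int_of_code !field_at_code /= muln1 expn_eq0.
- rewrite -[pickle (Negz n)]/(CodeSeq.code [:: 0; CodeSeq.code [:: n]]).
  by rewrite /int_of_code !field_at_code.
Qed.

Lemma rat_of_codeK q : rat_of_code (pickle q) = q.
Proof.
rewrite -[pickle q]/(CodeSeq.code [:: pickle (numq q); pickle (denq q)]).
rewrite /rat_of_code !field_at_code /= !int_of_codeK prednK ?absz_gt0 ?denq_neq0//.
by rewrite natr_absz_denq divq_num_den.
Qed.

Lemma complex_of_codeK z : complex_of_code (pickle z) = z.
Proof.
case: z => a b.
rewrite -[pickle _]/(CodeSeq.code [:: pickle a; pickle b]).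
by rewrite /complex_of_code !field_at_code /= !rat_of_codeK.
Qed.

Lemma nth_allpairs (S T R : Type) (f : S -> T -> R) x0 y0 z0 s t i j :
  i < size s -> j < size t ->
  nth z0 [seq f x y | x <- s, y <- t] (i * size t + j) =
  f (nth x0 s i) (nth y0 t j).
Proof.
move=> + ltj; elim: s i => [|x s IHs] [|i] //= lti; rewrite nth_cat size_map.
  by rewrite ltj (nth_map y0).
by rewrite mulSn -addnA ltnNge leq_addr /= addKn IHs.
Qed.

(** Entries are listed in row-major order together with their indices. The function [F] on numbers
    stands for [A] because a machine receives the dimensions as data and cannot use ordinals. *)
Lemma pickle_mx (R : countType) m n (A : 'M[R]_(m, n)) (F : nat -> nat -> R) :
  (forall i j, A i j = F i j) ->
  pickle A = CodeSeq.code (mkseq (fun k => CodeSeq.code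
    [:: CodeSeq.code [:: k %/ n; k %% n]; pickle (F (k %/ n) (k %% n))]) (m * n)).
Proof.
move=> AF.
rewrite -[pickle A]/(CodeSeq.code (map pickle (tfgraph (mx_val A)))); congr CodeSeq.code.
rewrite /= /codom /image_mem enumT unlock /= /prod_enum -map_comp map_allpairs.
have size_enum : size [seq (x, y) | x <- enum 'I_m, y <- enum 'I_n] = m * n.
  by rewrite size_allpairs !size_enum_ord.
apply: (@eq_from_nth _ 0); first by rewrite size_mkseq size_allpairs !size_enum_ord.
move=> k; rewrite size_allpairs !size_enum_ord => ltk; rewrite nth_mkseq//.
have n_gt0 : 0 < n by case: n ltk {A AF size_enum} => //; rewrite muln0.
have ltkm : k %/ n < m by rewrite ltn_divLR.
have ltkn : k %% n < n by rewrite ltn_mod.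
pose i0 := Ordinal ltkm; pose j0 := Ordinal ltkn.
rewrite {1}(divn_eq k n).
have := @nth_allpairs _ _ _ (fun x y => (pickle \o total_fun (mx_val A)) (x, y))
  i0 j0 0 (enum 'I_m) (enum 'I_n) (k %/ n) (k %% n).
rewrite !size_enum_ord => -> //.
rewrite (_ : nth i0 _ _ = i0); last by apply/val_inj; rewrite /= nth_enum_ord.
rewrite (_ : nth j0 _ _ = j0); last by apply/val_inj; rewrite /= nth_enum_ord.
rewrite -[LHS]/(CodeSeq.code [:: CodeSeq.code [:: k %/ n; k %% n]; pickle (A i0 j0)]).
by rewrite AF.
Qed.

Lemma entry_mx m n (A : 'M[rat[i]%C]_(m, n)) (i : 'I_m) (j : 'I_n) :
  entry (pickle A) (i * n + j) = A i j.
Proof.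
pose F a b := if (insub a, insub b) is (Some i, Some j) then A i j else 0%R.
have AF i' j' : A i' j' = F i' j' by rewrite /F !valK.
have ltij : i * n + j < m * n.
  by have := ltn_ord i; have := ltn_ord j; nia.
have n_gt0 : 0 < n by apply: leq_ltn_trans (ltn_ord j).
rewrite (pickle_mx AF) /entry !field_at_code nth_mkseq// field_at_code /=.
by rewrite complex_of_codeK divnMDl// divn_small// addn0 modnMDl modn_small// -AF.
Qed.

Lemma computable_field_at (X : countType) (c k : X -> nat) :
  computable c -> computable k -> computable (fun x => field_at (c x) (k x)).
Proof. by move=> Cc Ck; rewrite /field_at; comp. Qed.

Ltac comp_ext2 ::=
  lazymatch goal with
  | |- computable (fun x => field_at _ _) => apply: computable_field_at
  | |- computable (fun x => Posz _) => apply: computable_Posz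
  | |- computable (fun x => Negz _) => apply: computable_Negz
  end.

Section Computable_codes.
Variable X : countType.

Lemma computable_int_of_code (c : X -> nat) :
  computable c -> computable (fun x => int_of_code (c x)).
Proof. by move=> Cc; rewrite /int_of_code; comp. Qed.

Lemma computable_rat_of_code (c : X -> nat) :
  computable c -> computable (fun x => rat_of_code (c x)).
Proof.
move=> Cc; rewrite /rat_of_code; apply: computable_ratio => //.
  by apply: computable_int_of_code; comp.
by comp; apply: computable_absz; apply: computable_int_of_code; comp.
Qed.

Lemma computable_complex_of_code (c : X -> nat) :
  computable c -> computable (fun x => complex_of_code (c x)).
Proof.
move=> Cc; apply: computable_complex; apply: computable_rat_of_code;
  by comp.
Qed.

Lemma computable_entry (c k : X -> nat) :
  computable c -> computable k -> computable (fun x => entry (c x) (k x)).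
Proof.
move=> Cc Ck; apply: computable_complex_of_code.
by comp.
Qed.

Lemma computable_modn (f g : X -> nat) :
  computable f -> computable g -> computable (fun x => f x %% g x).
Proof.
move=> Cf Cg; apply: (@eq_computable _ _ (fun x => f x - f x %/ g x * g x)).
  by move=> x; rewrite {1}(divn_eq (f x) (g x)) addKn.
by comp.
Qed.

End Computable_codes.

Ltac comp_ext2 ::=
  lazymatch goal with
  | |- computable (fun x => field_at _ _) => apply: computable_field_at
  | |- computable (fun x => int_of_code _) => apply: computable_int_of_code
  | |- computable (fun x => complex_of_code _) => apply: computable_complex_of_code
  | |- computable (fun x => entry _ _) => apply: computable_entry
  | |- computable (fun x => modn _ _) => apply: computable_modn
  | |- computable (fun x => absz _) => apply: computable_absz
  | |- computable (fun x => pos_part _) => apply: computable_pos_part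
  | |- computable (fun x => numq _) => apply: computable_numq
  | |- computable (fun x => denq _) => apply: computable_denq
  | |- computable (fun x => Posz _) => apply: computable_Posz
  | |- computable (fun x => complex.Re _) => apply: computable_Re
  | |- computable (fun x => complex.Im _) => apply: computable_Im
  | |- computable (fun x => complex.Complex _ _) => apply: computable_complex
  | |- computable (fun x => _ * _)%R =>
      first [apply: computable_mulq | apply: computable_mulz]
  | |- computable (fun x => \sum_(0 <= k < _) _)%R => apply: computable_sumq
  | |- computable (fun x => - _)%R => apply: computable_oppq
  | |- computable (fun x => _ + _)%R =>
      first [apply: computable_addq | apply: computable_addz]
  end.

Lemma computable_odd (X : countType) (f : X -> nat) :
  computable f -> computable (fun x => odd (f x)).
Proof.
move=> Cf; apply: (@eq_computable _ _ (fun x => f x %% 2 == 1)).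
  by move=> x; rewrite modn2 eqb1.
by comp.
Qed.

(** * Three machines *)

Section Expectation.
Local Open Scope ring_scope.

(** The real part of the product of m, v and the conjugate of u. *)
Definition expectation_term (u m v : rat[i]%C) : rat :=
  complex.Re m * (complex.Re u * complex.Re v + complex.Im u * complex.Im v) +
  complex.Im m * (complex.Im u * complex.Re v + - (complex.Re u * complex.Im v)).

(* [<phi|M|phi>] and [<phi|phi>] for the matrix [M] coded by [c] and the vector
   [phi] coded by [x], of dimension [d]. *)
Definition code_expectation d c x : rat := \sum_(0 <= a < d) \sum_(0 <= b < d)
  expectation_term (entry x a) (entry c (a * d + b)%N) (entry x b).

Definition norm_sqr d x : rat := \sum_(0 <= a < d)
  (complex.Re (entry x a) * complex.Re (entry x a) +
   complex.Im (entry x a) * complex.Im (entry x a)).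

End Expectation.

(** For a unit vector phi and a positive matrix M this is the floor of 2^t 2^-l <phi|M|phi>, where l
    will be the length of a program of phi. *)
Definition scaled_expectation d c x t l : nat :=
  if norm_sqr d x == 1%R then
    pos_part (numq (code_expectation d c x)) * 2 ^ t %/
    (absz (denq (code_expectation d c x)) * 2 ^ l)
  else 0.

Lemma computable_scaled_expectation (X : countType) (d c x t l : X -> nat) :
  computable d -> computable c -> computable x -> computable t -> computable l ->
  computable (fun u => scaled_expectation (d u) (c u) (x u) (t u) (l u)).
Proof.
move=> Cd Cc Cx Ct Cl.
have Cexp : computable (fun u => code_expectation (d u) (c u) (x u)).
  by rewrite /code_expectation /expectation_term; comp.
have Cnorm : computable (fun u => norm_sqr (d u) (x u)).
  by rewrite /norm_sqr; comp.
by rewrite /scaled_expectation; comp.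
Qed.

Lemma scaled_expectation_double d c x t l :
  2 * scaled_expectation d c x t l <= scaled_expectation d c x t.+1 l.
Proof.
rewrite /scaled_expectation; case: ifP => // _.
rewrite expnS mulnCA; set a := _ * 2 ^ t; set b := _ * 2 ^ l.
case: (posnP b) => [->|b_gt0]; first by rewrite !divn0.
by rewrite leq_divRL// -mulnA leq_mul2l leq_divM.
Qed.

Section Machines.
Variables (U : recfun) (H : nat -> seq nat -> option nat).
Hypotheses (U_universal : universal U) (H_evaluator : evaluator U H).

Let CH : computable (fun z : nat * seq nat => H z.1 z.2).
Proof. by case: H_evaluator. Qed.

(** Taking parities makes the decoding total. *)
Definition bits_of_code c : seq bool := map odd (CodeSeq.decode c).

(** Here y codes (e, n) and c runs over the codes of programs; the first test discards all other
    numbers, so that each program is counted once. The first simulation runs the program c, and the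
    second one runs e under the condition [([::], i)] to obtain the code of E_i. *)
Definition contribution y i t c : nat :=
  if pickle (bits_of_code c) == c then
    if H t [:: y; c] is Some x then
      if H t [:: CodeSeq.code [:: 0; i]; field_at y 0] is Some m then
        scaled_expectation (2 ^ field_at y 1) m x t (size (bits_of_code c))
      else 0
    else 0
  else 0.

Definition outcome_weight y i t := \sum_(0 <= c < t) contribution y i t c.

Lemma outcome_weight_computable :
  computable (fun z : nat * (nat * nat) => outcome_weight z.1 z.2.1 z.2.2).
Proof.
have Cbits : computable bits_of_code.
  by rewrite /bits_of_code; comp; apply: computable_odd; comp.
rewrite /outcome_weight /contribution.
by comp; apply: computable_scaled_expectation; comp.
Qed.

Lemma outcome_weight_double y i t :
  2 * outcome_weight y i t <= outcome_weight y i t.+1.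
Proof.
have [_ Hmono _] := H_evaluator.
rewrite /outcome_weight big_distrr big_nat_recr //=.
apply: leq_trans (leq_addr _ _); apply: leq_sum => c _.
rewrite /contribution; case: ifP => // _.
case Ex: (H t [:: y; c]) => [x|] //; rewrite (Hmono _ _ _ _ (leqnSn t) Ex).
case Em: (H t [:: _; field_at y 0]) => [m|] //.
by rewrite (Hmono _ _ _ _ (leqnSn t) Em) scaled_expectation_double.
Qed.

Lemma outcome_coding : exists c, forall y, weight_below outcome_weight y ->
  forall i l, (exists t, 2 ^ t < outcome_weight y i t * 2 ^ l) ->
  exists2 p, runs U y p i & size p <= l + c.
Proof.
exact: (coding_theorem U_universal outcome_weight_computable outcome_weight_double).
Qed.

(** A self-delimiting encoding of a number. *)
Definition unary n := nseq n true ++ [:: false].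

Lemma size_unary n : size (unary n) = n.+1.
Proof. by rewrite size_cat size_nseq addn1. Qed.

Lemma unary_prefix m n s : unary m ++ s = unary n -> s = [::].
Proof.
move=> E; apply/size0nil; move: (congr1 size E); rewrite size_cat !size_unary.
have := congr1 (fun p => nth true p m) E; rewrite /unary -catA nth_cat size_nseq ltnn subnn /=.
rewrite nth_cat size_nseq; case: ltnP => [lt|]; first by rewrite nth_nseq lt.
by case E' : (m - n) => [|k] /=; [lia|case: k {E'}].
Qed.

Lemma computable_unary (X : countType) (n : X -> nat) :
  computable n -> computable (fun x => unary (n x)).
Proof.
move=> Cn; apply: (@eq_computable _ _
    (fun x => mkseq (fun=> true) (n x) ++ [:: false])).
  move=> x; congr cat; apply: (@eq_from_nth _ true); rewrite size_mkseq ?size_nseq//.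
  by move=> k ltk; rewrite nth_mkseq// nth_nseq ltk.
by comp.
Qed.

Section Tensor.
Variable c0 : nat.
Local Open Scope ring_scope.

Definition tensor_scale w : rat := (Posz (2 ^ w))%:~R / (2 ^ c0)%N%:R.

Definition tensor_entry w (u v : rat[i]%C) : rat[i]%C :=
  ((tensor_scale w *
      (complex.Re u * complex.Re v + - (complex.Im u * complex.Im v))) +i*
   (tensor_scale w *
      (complex.Re u * complex.Im v + complex.Im u * complex.Re v)))%C.

Definition tensor_mx d w (A B : 'M[rat[i]%C]_d) : 'M[rat[i]%C]_(d * d) :=
  \matrix_(a, b) tensor_entry w
    (A (mxtens_unindex a).1 (mxtens_unindex b).1)
    (B (mxtens_unindex a).2 (mxtens_unindex b).2).

Local Close Scope ring_scope.

Definition tensor_code d w ca cb := CodeSeq.code (mkseq (fun k => CodeSeq.code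
  [:: CodeSeq.code [:: k %/ (d * d); k %% (d * d)]; pickle (tensor_entry w
     (entry ca (k %/ (d * d) %/ d * d + k %% (d * d) %/ d))
     (entry cb (k %/ (d * d) %% d * d + k %% (d * d) %% d)))]) (d * d * (d * d))).

Lemma pickle_tensor_mx d w A B :
  pickle (@tensor_mx d w A B) = tensor_code d w (pickle A) (pickle B).
Proof.
apply: (pickle_mx (F := fun a b => tensor_entry w
     (entry (pickle A) (a %/ d * d + b %/ d)) (entry (pickle B) (a %% d * d + b %% d)))).
move=> a b; rewrite mxE; congr tensor_entry.
  by rewrite -(entry_mx A).
by rewrite -(entry_mx B).
Qed.

Lemma computable_tensor_code (X : countType) (d w ca cb : X -> nat) :
  computable d -> computable w -> computable ca -> computable cb ->
  computable (fun x => tensor_code (d x) (w x) (ca x) (cb x)).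
Proof.
move=> Cd Cw Ca Cb.
have Cscale : computable tensor_scale.
  rewrite /tensor_scale; apply: computable_ratio; comp => _.
  by rewrite expn_gt0.
by rewrite /tensor_code /tensor_entry; comp.
Qed.

(** The matrix is elementary and hence approximates itself, so the output sequence is constant. The
    auxiliary tape holds only e and the position in the sequence; n has to be written into the
    program. *)
Lemma tensor_machine : exists t, forall e n i j w (s : nat -> 'M[rat[i]%C]_(2 ^ n)),
  outputs U [::] e s ->
  outputs U e (t ++ unary (CodeSeq.code [:: n; i; j; w]))
    (fun _ => tensor_mx w (s i) (s j)).
Proof.
have [_ Hmono HP] := H_evaluator.
pose arg (p : seq bool) k := field_at (size p).-1 k.
pose mat s y (p : seq bool) k := H s [:: CodeSeq.code [:: 0; arg p k]; field_at y 0].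
have Cmat k : computable (fun z : nat * (seq bool * nat) => mat z.2.2 z.1 z.2.1 k).
  by rewrite /mat /arg; comp.
have [T TP] := @machine_exists
  (fun y p s => [&& p == unary (size p).-1, isSome (mat s y p 1) & isSome (mat s y p 2)])
  (fun y p s => if mat s y p 1 is Some ca then
     if mat s y p 2 is Some cb then tensor_code (2 ^ arg p 0) (arg p 3) ca cb else 0
   else 0) ltac:(by rewrite /isSome /mat /arg; comp; apply: computable_unary; comp)
   ltac:(by rewrite /mat /arg; comp; apply: computable_tensor_code; comp).
(* Only programs in unary format are accepted, which makes the machine prefix-free whatever e
   outputs. *)
have [y p s nz_s [x /TP[r + _]] [x' /TP[r' + _]]|t tP] := U_universal.2 T.
  move=> /firstP/and3P[/eqP pE _ _] /firstP/and3P[/eqP psE _ _].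
  by case/eqP: nz_s; move: psE; rewrite {1}pE => /unary_prefix.
exists t => e n i j w s sP k; apply/tP/TP.
set p := unary _.
have argE l : arg p l = nth 0 [:: n; i; j; w] l.
  by rewrite /arg size_unary field_at_code.
have matP l : exists s', mat s' (pickle (e, k)) p l = Some (pickle (s (arg p l))).
  by apply/HP; rewrite field_at_code; apply: sP.
have matE s' l m : mat s' (pickle (e, k)) p l = Some m -> m = pickle (s (arg p l)).
  have [s'' /(Hmono _ (maxn s' s'')) E''] := matP l.
  move=> /(Hmono _ (maxn s' s'')) E'.
  by have := E' (leq_maxl _ _); rewrite E'' ?leq_maxr// => -[].
have [s1 s1P] := matP 1; have [s2 s2P] := matP 2.
case: (@ex_first (fun s' => [&& p == unary (size p).-1,
   isSome (mat s' (pickle (e, k)) p 1) & isSome (mat s' (pickle (e, k)) p 2)])) => [|s' s'P].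
  exists (maxn s1 s2); rewrite {1}/p size_unary eqxx /=.
  by rewrite /mat (Hmono _ _ _ _ (leq_maxl _ _) s1P) (Hmono _ _ _ _ (leq_maxr _ _) s2P).
exists s' => //; case/firstP/and3P: s'P => _.
case E1: (mat _ _ _ 1) => [m1|]// _; case E2: (mat _ _ _ 2) => [m2|]// _.
by rewrite (matE _ _ _ E1) (matE _ _ _ E2) !argE [LHS]pickle_tensor_mx.
Qed.

End Tensor.

(* The program of the pair (i, j) also reveals its own length; together with the
   mutual information this determines the exponent K(i) + K(j). *)
Lemma pair_machine (t2 : seq bool) : exists c, forall (e : seq bool) (n i j : nat)
    (I : int) p1 p2,
  runs U (e, n) p1 (i, j) -> runs U (e, n) p2 I ->
  exists2 p, runs U (e, n) p
      (t2 ++ unary (CodeSeq.code [:: n; i; j; absz (I + Posz (size p1))%R])) &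
    size p <= size p1 + size p2 + c.
Proof.
have [_ Hmono HP] := H_evaluator.
pose val s y (p : seq bool) := H s [:: y; pickle p].
have Cval (s y : nat * (seq bool * nat) -> nat) p :
    computable s -> computable y -> computable p ->
    computable (fun z => val (s z) (y z) (p z)).
  by move=> Cs Cy Cp; rewrite /val; comp.
(* A certificate codes an amount of fuel and the point at which the program is cut into two programs
   of [U]. The absolute value turns I(i:j) + K(i,j), which equals K(i) + K(j) in the intended use,
   into a natural number. *)
have [T TP] := @machine_exists
  (fun y p s => isSome (val (field_at s 0) y (take (field_at s 1) p)) &&
                isSome (val (field_at s 0) y (drop (field_at s 1) p)))
  (fun y p s => if val (field_at s 0) y (take (field_at s 1) p) is Some a then
     if val (field_at s 0) y (drop (field_at s 1) p) is Some b then
       pickle (t2 ++ unary (CodeSeq.code [:: field_at y 1; field_at a 0; field_at a 1;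
         absz (int_of_code b + Posz (size (take (field_at s 1) p)))%R]))
     else 0 else 0) ltac:(by rewrite /isSome /val; comp)
   ltac:(by rewrite /val; comp; apply: computable_unary; comp).
have valP y p a : eval U [:: y; pickle p] a <-> exists s, val s y p = Some a.
  exact: HP.
have valE y (p : seq bool) s : isSome (val s y p) -> exists a, eval U [:: y; pickle p] a.
  by case E: (val s y p) => [a|]// _; exists a; apply/valP; exists s.
(* Halting programs of [U] that are prefixes of the same string coincide. Hence the cut is unique,
   and the new machine inherits prefix-freeness. *)
have prefix_eq y (p q r : seq bool) : (exists a, eval U [:: y; pickle p] a) ->
    (exists a, eval U [:: y; pickle q] a) -> prefix p r -> prefix q r -> p = q.
  wlog lepq : p q / size p <= size q.
    by move=> W; case/orP: (leq_total (size p) (size q)) => le Hp Hq pr qr;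
      [|apply/esym]; apply: W.
  move=> Hp Hq; rewrite !prefixE => /eqP pr /eqP qr.
  have pq : q = p ++ drop (size p) q.
    by rewrite -{1}(cat_take_drop (size p) q) -{1}qr take_takel// pr.
  apply/eqP; rewrite pq -{1}[p]cats0 eqseq_cat// eqxx /= eq_sym.
  apply/negPn/negP => /(@U_universal.1 y p) /(_ Hp); rewrite -pq; exact.
have [y p s nz_s [x /TP[r + _]] [x' /TP[r' + _]]|t tP] := U_universal.2 T.
  move=> /firstP/andP[/valE p1 /valE p2] /firstP/andP[/valE q1 /valE q2].
  case/eqP: nz_s.
  have E1 : take (field_at r 1) p = take (field_at r' 1) (p ++ s).
    apply: (prefix_eq _ _ _ (p ++ s) p1 q1); last exact: prefix_take.
    by rewrite -{2}(cat_take_drop (field_at r 1) p) -catA prefix_prefix.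
  have E : drop (field_at r 1) p ++ s = drop (field_at r' 1) (p ++ s).
    apply/eqP; have := cat_take_drop (field_at r' 1) (p ++ s).
    rewrite -{3}(cat_take_drop (field_at r 1) p) -catA E1 => /eqP.
    by rewrite eqseq_cat// eqxx eq_sym.
  have : drop (field_at r 1) p = drop (field_at r' 1) (p ++ s).
    by apply: (prefix_eq _ _ _ (drop (field_at r' 1) (p ++ s)) p2 q2);
      rewrite -?E ?prefix_prefix ?prefix_refl.
  by rewrite -E => /esym/eqP; rewrite -{2}[drop _ p]cats0 eqseq_cat// eqxx => /eqP.
exists (size t) => e n i j I p1 p2 Up1 Up2.
exists (t ++ (p1 ++ p2)); last by rewrite !size_cat; lia.
apply/tP/TP; set y := pickle (e, n).
have [s1 s1P] := (valP _ _ _).1 Up1; have [s2 s2P] := (valP _ _ _).1 Up2.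
case: (@ex_first (fun s => isSome (val (field_at s 0) y (take (field_at s 1) (p1 ++ p2))) &&
                isSome (val (field_at s 0) y (drop (field_at s 1) (p1 ++ p2))))) => [|s sP].
  exists (CodeSeq.code [:: maxn s1 s2; size p1]).
  rewrite !field_at_code /= take_size_cat// drop_size_cat// /val.
  by rewrite (Hmono _ _ _ _ (leq_maxl _ _) s1P) (Hmono _ _ _ _ (leq_maxr _ _) s2P).
exists s => //; case/firstP/andP: sP => S1 S2.
have E1 : take (field_at s 1) (p1 ++ p2) = p1.
  apply: (prefix_eq y _ _ (p1 ++ p2)); rewrite ?prefix_take ?prefix_prefix//.
    exact: valE S1.
  by exists (pickle (i, j)).
have E2 : drop (field_at s 1) (p1 ++ p2) = p2.
  have := cat_take_drop (field_at s 1) (p1 ++ p2); rewrite {1}E1 => /eqP.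
  by rewrite eqseq_cat// eqxx => /eqP.
rewrite E1 E2 in S1 S2 *.
case V1: (val _ _ p1) S1 => [a|]// _; case V2: (val _ _ p2) S2 => [b|]// _.
have -> : a = pickle (i, j) by apply: (eval_functional _ Up1); apply/valP; exists (field_at s 0).
have -> : b = pickle I by apply: (eval_functional _ Up2); apply/valP; exists (field_at s 0).
have -> : field_at y 1 = n by rewrite /y pickle_pair field_at_code.
by rewrite int_of_codeK [pickle (i, j)]pickle_pair !field_at_code.
Qed.

End Machines.

Local Open Scope classical_set_scope.
Local Open Scope complex_scope.
Local Open Scope ring_scope.
Local Open Scope sesquilinear_scope.

(** * Unordered sums *)

Section Sums.
Variables (R : realType) (T : choiceType).
Implicit Types (D : set T) (f g : T -> R).

Lemma esum_le_seq D f (B : R) :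
  (forall s : seq T, uniq s -> (forall t, t \in s -> D t) ->
     \sum_(t <- s) f t <= B) ->
  (\esum_(t in D) (f t)%:E <= B%:E)%E.
Proof.
move=> leB; apply: ge_ereal_sup => _ [X [finX XD] <-].
rewrite fsbig_finite//= sumEFin lee_fin leB ?finmap.fset_uniq//.
by move=> t; rewrite in_fset_set// inE; apply: XD.
Qed.

Lemma seq_le_esum D f (s : seq T) : uniq s -> (forall t, t \in s -> D t) ->
  ((\sum_(t <- s) f t)%:E <= \esum_(t in D) (f t)%:E)%E.
Proof.
move=> Us sD; rewrite esum_ge//; exists [set` s].
  by split=> //; apply: finite_seq.
by rewrite -fsbig_seq// sumEFin.
Qed.

Definition rsummable D f := (\esum_(t in D) `|f t|%:E < +oo)%E.

Lemma rsummable_bound D f (B : R) :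
  (forall s : seq T, uniq s -> (forall t, t \in s -> D t) ->
     \sum_(t <- s) `|f t| <= B) -> rsummable D f.
Proof. by move=> /esum_le_seq leB; apply: le_lt_trans leB (ltry _). Qed.

Lemma rsummable_ex_bound D f : rsummable D f -> exists2 B : R, 0 <= B &
  forall s : seq T, uniq s -> (forall t, t \in s -> D t) ->
     \sum_(t <- s) `|f t| <= B.
Proof.
move=> sum_f; have ge0 : (0 <= \esum_(t in D) `|f t|%:E)%E.
  by apply: esum_ge0 => t _; rewrite lee_fin.
exists (fine (\esum_(t in D) `|f t|%:E)) => [|s Us sD]; first exact: fine_ge0.
rewrite -lee_fin fineK ?ge0_fin_numE//.
exact: (@seq_le_esum _ (fun t => `|f t|)).
Qed.

Lemma rsummable_le D f g : (forall t, D t -> `|f t| <= `|g t|) ->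
  rsummable D g -> rsummable D f.
Proof.
by move=> fg; apply: le_lt_trans; apply: le_esum => t Dt; rewrite lee_fin fg.
Qed.

Lemma rsummableD D f g :
  rsummable D f -> rsummable D g -> rsummable D (fun t => f t + g t).
Proof.
move=> /rsummable_ex_bound[B _ fB] /rsummable_ex_bound[C _ gC].
apply: (@rsummable_bound _ _ (B + C)) => s Us sD.
apply: le_trans (lerD (fB s Us sD) (gC s Us sD)).
by rewrite -big_split; apply: ler_sum => t _; apply: ler_normD.
Qed.

Lemma rsummableZ D (c : R) f : rsummable D f -> rsummable D (fun t => c * f t).
Proof.
move=> /rsummable_ex_bound[B _ fB]; apply: (@rsummable_bound _ _ (`|c| * B)) => s Us sD.
apply: le_trans (ler_wpM2l (normr_ge0 c) (fB s Us sD)).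
by rewrite mulr_sumr; apply: ler_sum => t _; rewrite normrM.
Qed.

Lemma rsummable_sum D (I : Type) (r : seq I) (f : I -> T -> R) :
  (forall i, rsummable D (f i)) -> rsummable D (fun t => \sum_(i <- r) f i t).
Proof.
move=> sum_f; elim: r => [|i r IHr].
  apply: (@rsummable_bound _ _ 0) => s _ _; rewrite big1// => t _.
  by rewrite big_nil normr0.
by under eq_fun do rewrite big_cons; apply: rsummableD.
Qed.

Lemma rsum_ge0E D f : (forall t, D t -> 0 <= f t) ->
  rsum D f = fine (\esum_(t in D) (f t)%:E).
Proof.
move=> f_ge0; rewrite /rsum [X in _ - fine X](_ : _ = 0%E) ?subr0.
  by congr fine; apply: eq_esum => t Dt; rewrite max_l// f_ge0.
by apply: esum1 => t Dt; rewrite max_r// oppr_le0 f_ge0.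
Qed.

Lemma eq_rsum D f g : (forall t, D t -> f t = g t) -> rsum D f = rsum D g.
Proof.
by move=> fg; rewrite /rsum; congr (fine _ - fine _); apply: eq_esum => t Dt; rewrite fg.
Qed.

(** The value does not depend on how a function is split into nonnegative summable parts: the
    positive part of f - g plus g equals f plus the negative part of f - g, and sums of nonnegative
    functions are additive. *)
Lemma rsum_sub D f g : (forall t, D t -> 0 <= f t) -> (forall t, D t -> 0 <= g t) ->
  rsummable D f -> rsummable D g ->
  rsum D (fun t => f t - g t) = rsum D f - rsum D g.
Proof.
move=> f0 g0 sf sg; rewrite (rsum_ge0E f0) (rsum_ge0E g0) /rsum.
have fin (h : T -> R) : (forall t, D t -> 0 <= h t) -> rsummable D h ->
    \esum_(t in D) (h t)%:E \is a fin_num.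
  move=> h0 sh; rewrite ge0_fin_numE.
    2: by apply: esum_ge0 => t Dt; rewrite lee_fin h0.
  by apply: le_lt_trans sh; apply: le_esum => t Dt; rewrite lee_fin ler_norm.
have posM (h : T -> R) : rsummable D h -> \esum_(t in D) (Num.max (h t) 0)%:E \is a fin_num.
  move=> sh; apply: (fin (fun t => Num.max (h t) 0)) => [t _|]; first by rewrite le_max lexx orbT.
  apply: rsummable_le sh => t _; rewrite ger0_norm ?le_max ?lexx ?orbT//.
  by rewrite ge_max ler_norm normr_ge0.
have sfg : rsummable D (fun t => f t - g t).
  apply: (rsummableD sf); apply: rsummable_le sg => t _; by rewrite normrN.
have Ff := fin _ f0 sf; have Fg := fin _ g0 sg; have F1 := posM _ sfg.
have F2 : \esum_(t in D) (Num.max (- (f t - g t)) 0)%:E \is a fin_num.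
  by apply: posM; apply: rsummable_le sfg => t _; rewrite normrN.
apply/eqP; rewrite subr_eq addrAC eq_sym subr_eq -!fineD//; apply/eqP; congr fine.
rewrite -!esumD//; do ?by move=> t Dt; rewrite lee_fin ?f0 ?g0 ?le_max ?lexx ?orbT.
apply: eq_esum => t Dt; rewrite -!EFinD; congr EFin.
by rewrite !maxEle; case: (leP (f t - g t) 0); case: (leP (- (f t - g t)) 0); lra.
Qed.

Lemma rsum_decomp D f : rsummable D f -> exists g h,
  [/\ forall t, 0 <= g t, forall t, 0 <= h t, rsummable D g, rsummable D h &
      f = fun t => g t - h t].
Proof.
move=> sf; exists (fun t => Num.max (f t) 0), (fun t => Num.max (- f t) 0); split.
- by move=> t; rewrite le_max lexx orbT.
- by move=> t; rewrite le_max lexx orbT.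
- apply: rsummable_le sf => t Dt; rewrite ger0_norm ?le_max ?lexx ?orbT//.
  by rewrite ge_max ler_norm normr_ge0.
- apply: rsummable_le sf => t Dt; rewrite ger0_norm ?le_max ?lexx ?orbT//.
  by rewrite ge_max -normrN ler_norm normr_ge0.
by apply/funext => t; rewrite !maxEle; case: (leP (f t) 0); case: (leP (- f t) 0); lra.
Qed.

(** For nonnegative functions this is [rsum_sub] for the difference of h + k and k; the general case
    splits both functions. *)
Lemma rsumD D f g : rsummable D f -> rsummable D g ->
  rsum D (fun t => f t + g t) = rsum D f + rsum D g.
Proof.
have add (h k : T -> R) : (forall t, 0 <= h t) -> (forall t, 0 <= k t) ->
    rsummable D h -> rsummable D k ->
    rsum D (fun t => h t + k t) = rsum D h + rsum D k.
  move=> h0 k0 sh sk; apply/eqP; rewrite -subr_eq eq_sym; apply/eqP.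
  rewrite -rsum_sub//; first by apply: eq_rsum => t _; rewrite addrK.
    by move=> t Dt; rewrite addr_ge0.
  exact: rsummableD.
move=> /rsum_decomp[f1 [f2 [f10 f20 sf1 sf2 ->]]].
move=> /rsum_decomp[g1 [g2 [g10 g20 sg1 sg2 ->]]].
rewrite (eq_rsum (g := fun t => (f1 t + g1 t) - (f2 t + g2 t))); last first.
  by move=> t _; lra.
rewrite !rsum_sub//; try by [move=> t _; rewrite addr_ge0|apply: rsummableD].
by rewrite !add//; lra.
Qed.

Lemma rsum_le D f (B : R) : (forall t, D t -> 0 <= f t) ->
  (forall s : seq T, uniq s -> (forall t, t \in s -> D t) ->
     \sum_(t <- s) f t <= B) -> rsum D f <= B.
Proof.
move=> f0 /esum_le_seq leB; rewrite rsum_ge0E// -lee_fin fineK// ge0_fin_numE.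
  exact: le_lt_trans leB (ltry _).
by apply: esum_ge0 => t Dt; rewrite lee_fin f0.
Qed.

Lemma le_rsum_seq D f (s : seq T) : (forall t, D t -> 0 <= f t) -> rsummable D f ->
  uniq s -> (forall t, t \in s -> D t) -> \sum_(t <- s) f t <= rsum D f.
Proof.
move=> f0 sf Us sD; rewrite rsum_ge0E// -lee_fin fineK ?seq_le_esum//.
rewrite ge0_fin_numE; last by apply: esum_ge0 => t Dt; rewrite lee_fin f0.
by apply: le_lt_trans sf; apply: le_esum => t Dt; rewrite lee_fin ler_norm.
Qed.

Lemma rsum_ge0 D f : (forall t, D t -> 0 <= f t) -> 0 <= rsum D f.
Proof.
by move=> f0; rewrite rsum_ge0E// fine_ge0// esum_ge0// => t Dt; rewrite lee_fin f0.
Qed.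

Lemma rsum_sup D f (v : R) : (forall t, D t -> 0 <= f t) -> v < rsum D f ->
  exists2 s : seq T, uniq s /\ (forall t, t \in s -> D t) & v < \sum_(t <- s) f t.
Proof.
move=> f0 ltv; apply: contrapT => nex; move: ltv; apply/negP; rewrite -leNgt.
apply: rsum_le => // s Us sD; rewrite leNgt; apply/negP => ltv; apply: nex.
by exists s.
Qed.

Lemma rsumZ D (c : R) f : rsummable D f -> rsum D (fun t => c * f t) = c * rsum D f.
Proof.
have pos (k : R) (h : T -> R) : 0 <= k -> (forall t, D t -> 0 <= h t) -> rsummable D h ->
    rsum D (fun t => k * h t) = k * rsum D h.
  move=> k0 h0 sh; have kh0 t : D t -> 0 <= k * h t by move=> Dt; rewrite mulr_ge0 ?h0.
  have [->|kNZ] := eqVneq k 0.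
    by rewrite (eq_rsum (g := fun=> 0)) => [|t _]; rewrite mul0r// rsum_ge0E// esum1.
  have k_gt0 : 0 < k by rewrite lt_def kNZ.
  apply/le_anti/andP; split.
    apply: rsum_le => // s Us sD; rewrite -mulr_sumr ler_pM2l//.
    exact: le_rsum_seq.
  rewrite mulrC -ler_pdivlMr//; apply: rsum_le => // s Us sD.
  rewrite ler_pdivlMr// mulrC mulr_sumr; apply: (le_rsum_seq kh0) => //.
  exact: rsummableZ.
move=> /rsum_decomp[g [h [g0 h0 sg sh ->]]].
have subZ k : 0 <= k -> rsum D (fun t => k * (g t - h t)) = k * (rsum D g - rsum D h).
  move=> k0; rewrite (eq_rsum (g := fun t => k * g t - k * h t)); last first.
    by move=> t _; rewrite mulrBr.
  by rewrite rsum_sub ?pos ?mulrBr//; try by [move=> t _; rewrite mulr_ge0|apply: rsummableZ].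
rewrite rsum_sub//; have [/subZ//|lt0] := leP 0 c.
have sgh : rsummable D (fun t => g t - h t).
  by apply: rsummableD => //; apply: rsummable_le sh => t _; rewrite normrN.
(* A negative factor is reduced to its opposite: the two sums cancel. *)
apply: (@addrI _ (rsum D (fun t => - c * (g t - h t)))).
rewrite -rsumD; try exact: rsummableZ.
rewrite subZ ?oppr_ge0 ?ltW// mulNr addNr (eq_rsum (g := fun=> 0)).
  by rewrite rsum_ge0E// esum1.
by move=> t _; rewrite mulNr addNr.
Qed.

Lemma rsum_sum D (I : Type) (r : seq I) (f : I -> T -> R) :
  (forall i, rsummable D (f i)) ->
  rsum D (fun t => \sum_(i <- r) f i t) = \sum_(i <- r) rsum D (f i).
Proof.
move=> sum_f; elim: r => [|i r IHr].
  by rewrite big_nil (eq_rsum (g := fun=> 0)) ?rsum_ge0E ?esum1// => t _; rewrite big_nil.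
rewrite big_cons -IHr -rsumD//; last exact: rsummable_sum.
by apply: eq_rsum => t _; rewrite big_cons.
Qed.

End Sums.

(** * Algorithmic probability *)

(** Induction on the maximal length. If the empty string is absent, the set splits by the first bit
    into two prefix-free sets of shorter strings, and each of them contributes at most 1/2. *)
Lemma kraft (R : realType) (s : seq (seq bool)) : uniq s ->
  (forall p q, p \in s -> q \in s -> prefix p q -> p = q) ->
  \sum_(p <- s) 2^-1 ^+ size p <= 1 :> R.
Proof.
have [m] : exists m, all (fun p => size p <= m)%N s.
  exists (\max_(p <- s) size p)%N; apply/allP => p ps.
  by rewrite (big_rem p)//= leq_maxl.
elim: m s => [|m IHm] s les Us pf.
all: have [s0|s0] := boolP ([::] \in s).
- have -> : s = [:: [::]].
    apply/perm_small_eq => //; apply: uniq_perm => // q; rewrite inE.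
    by apply/idP/eqP => [/(pf [::] q s0)/(_ (prefix0s q))|->].
  by rewrite big_seq1 expr0.
- case: s les {Us pf} s0 => [|p s] /=; first by rewrite big_nil.
  by rewrite leqn0 => /andP[/nilP-> _]; rewrite inE eqxx.
- have -> : s = [:: [::]].
    apply/perm_small_eq => //; apply: uniq_perm => // q; rewrite inE.
    by apply/idP/eqP => [/(pf [::] q s0)/(_ (prefix0s q))|->].
  by rewrite big_seq1 expr0.
pose t b := [seq behead p | p <- s & ohead p == Some b].
have tP b p : (p \in t b) = (b :: p \in s).
  apply/mapP/idP => [[q]|ps]; last by exists (b :: p); rewrite // mem_filter eqxx.
  by rewrite mem_filter => /andP[+ qs ->]; case: q qs => //= c q qs /eqP[<-].
have half b : \sum_(p <- s | ohead p == Some b) 2^-1 ^+ size p <= 2^-1 :> R.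
  have -> : \sum_(p <- s | ohead p == Some b) 2^-1 ^+ size p =
      2^-1 * \sum_(p <- t b) 2^-1 ^+ size p :> R.
    rewrite mulr_sumr big_map big_filter; apply: eq_bigr => -[|c p] //= _.
    by rewrite exprS.
  rewrite -[leRHS]mulr1 ler_pM2l ?invr_gt0//; apply: IHm.
  - apply/allP => p; rewrite tP => /(allP les); exact.
  - rewrite map_inj_in_uniq ?filter_uniq// => p q; rewrite !mem_filter.
    by case: p q => [|a p] [|c q] //= /andP[/eqP[->] _] /andP[/eqP[->] _] ->.
  - move=> p q; rewrite !tP => ps qs pq.
    by have := pf _ _ ps qs; rewrite /= eqxx /= => /(_ pq) [].
rewrite (bigID (fun p => ohead p == Some true))/=.
rewrite [X in _ + X](_ : _ = \sum_(p <- s | ohead p == Some false) 2^-1 ^+ size p).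
  2: rewrite big_seq_cond [RHS]big_seq_cond; apply: eq_bigl => -[|[] p] //=.
  2: by rewrite (negbTE s0).
by have := lerD (half true) (half false); lra.
Qed.

(** Finite lists chosen from disjoint fibers concatenate to a list without repetitions. This turns
    bounds on sums over programs into bounds on sums over the objects that they compute. *)
Lemma rsum_fibers (R : realType) (T1 T2 : choiceType) (D : T1 -> set T2)
    (f : T2 -> R) (s : seq T1) (B : R) : uniq s ->
  (forall x x' t, D x t -> D x' t -> x = x') -> (forall t, 0 <= f t) ->
  (forall u : seq T2, uniq u -> (forall t, t \in u -> exists2 x, x \in s & D x t) ->
     \sum_(t <- u) f t <= B) ->
  \sum_(x <- s) rsum (D x) f <= B.
Proof.
move=> + Dinj f0; elim: s B => [|x s IHs] B /= => [_ leB|/andP[xs Us] leB].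
  by have := leB [::]; rewrite !big_nil; apply.
rewrite big_cons -lerBrDr; apply: rsum_le => // u Uu uD.
rewrite lerBrDl -lerBrDr; apply: IHs => // v Uv vD.
rewrite lerBrDl -big_cat; apply: leB => [|t].
  rewrite cat_uniq Uu Uv andbT /=; apply/hasPn => t tv; apply/negP => tu.
  have [x' x's /Dinj/(_ (uD _ tu)) E] := vD t tv.
  by rewrite -E x's in xs.
rewrite mem_cat => /orP[/uD Dxt|/vD[x' x's Dx't]]; first by exists x; rewrite ?mem_head.
by exists x'; rewrite // inE x's orbT.
Qed.

Section Probability.
Variables (R : realType) (U : recfun).
Hypothesis hU : universal U.

Lemma runs_functional (X Y : countType) (y : Y) p (x x' : X) :
  runs U y p x -> runs U y p x' -> x = x'.
Proof. by move=> E E'; apply: (pcan_inj pickleK); apply: eval_functional E E'. Qed.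

Lemma program_sum (Y : countType) (y : Y) (s : seq (seq bool)) : uniq s ->
  (forall p, p \in s -> exists x : nat, runs U y p x) ->
  \sum_(p <- s) 2^-1 ^+ size p <= 1 :> R.
Proof.
move=> Us halt; apply: kraft => // p q /halt ph /halt qh /prefixP[r qE].
have [r0|r0] := eqVneq r [::]; first by rewrite qE r0 cats0.
by have := hU.1 (pickle y) p r r0 ph; rewrite -qE.
Qed.

Lemma expr_half_ge0 k : 0 <= 2^-1 ^+ k :> R.
Proof. by rewrite exprn_ge0// invr_ge0. Qed.
Hint Resolve expr_half_ge0 : core.

Lemma rsummable_programs (X Y : countType) (x : X) (y : Y) :
  rsummable [set p | runs U y p x] (fun p => 2^-1 ^+ size p : R).
Proof.
apply: (@rsummable_bound _ _ _ _ 1) => s Us sD.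
under eq_bigr do rewrite ger0_norm//.
by apply: (program_sum (y := y)) => // p /sD; exists (pickle x).
Qed.

Lemma univ_prob_ge0 (X Y : countType) (x : X) (y : Y) : 0 <= univ_prob R U x y.
Proof. exact: rsum_ge0. Qed.

Lemma univ_prob_ge (X Y : countType) (x : X) (y : Y) p :
  runs U y p x -> 2^-1 ^+ size p <= univ_prob R U x y.
Proof.
move=> px; have := @le_rsum_seq R _ [set p | runs U y p x] (fun p => 2^-1 ^+ size p) [:: p].
rewrite big_seq1; apply => //; first exact: rsummable_programs.
by move=> t; rewrite inE => /eqP->.
Qed.

Lemma univ_prob_sum (X Y : countType) (y : Y) (s : seq X) : uniq s ->
  \sum_(x <- s) univ_prob R U x y <= 1.
Proof.
move=> Us; apply: rsum_fibers => // [x x' p|u Uu uD]; first exact: runs_functional.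
by apply: (program_sum (y := y)) => // p /uD[x _ px]; exists (pickle x).
Qed.

(** [U] simulates the machine that halts on the empty program only and outputs x. *)
Lemma program_exists (X Y : countType) (x : X) (y : Y) : exists p, runs U y p x.
Proof.
have [T TP] := @machine_exists (fun _ p _ => p == [::]) (fun _ _ _ => pickle x)
  ltac:(comp) ltac:(comp).
have [z p s s0 [a /TP[r /firstP/eqP-> _]] [b /TP[r' /firstP]]|t tP] := hU.2 T.
  by rewrite cat0s (negbTE s0).
exists (t ++ [::]); apply/(tP (pickle y) [::] (pickle x))/TP.
by exists 0%N => //; apply/andP; split=> //; apply/forallP => -[].
Qed.

Lemma univ_prob_gt0 (X Y : countType) (x : X) (y : Y) : 0 < univ_prob R U x y.
Proof.
have [p px] := program_exists x y; apply: lt_le_trans (univ_prob_ge px).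
by rewrite exprn_gt0// invr_gt0.
Qed.

Lemma KprefP (X Y : countType) (x : X) (y : Y) :
  (exists2 p, runs U y p x & size p = Kpref U x y) /\
  forall p, runs U y p x -> (Kpref U x y <= size p)%N.
Proof.
rewrite /Kpref; case: xgetP => [k _ [//]|nex]; exfalso.
pose P k := `[< exists2 p, runs U y p x & size p = k >].
have exP : exists k, P k.
  have [p px] := program_exists x y.
  by exists (size p); apply/asboolP; exists p.
case: (ex_minnP exP) => k /asboolP Pk mink; apply: (nex k); split=> // p px.
by apply: mink; apply/asboolP; exists p.
Qed.

End Probability.

(** * Positive matrices *)

Section Psd.
Variable R : realType.
Local Notation C := R[i].

Definition quad N (A : 'M[C]_N) (v : 'cV[C]_N) : C := (v^t* *m A *m v) 0 0.

Lemma quadE N (A : 'M[C]_N) v :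
  quad A v = \sum_a \sum_b (v a 0)^* * A a b * v b 0.
Proof.
rewrite /quad !mxE exchange_big; apply: eq_bigr => b _ /=.
by rewrite mxE mulr_suml; apply: eq_bigr => a _; rewrite !mxE.
Qed.

Lemma trace_rank1 N (A : 'M[C]_N) v : \tr (A *m (v *m v^t*)) = quad A v.
Proof. by rewrite mulmxA mxtrace_mulC mulmxA /mxtrace big_ord1. Qed.

Lemma quadD N (A B : 'M[C]_N) v : quad (A + B) v = quad A v + quad B v.
Proof. by rewrite /quad mulmxDr mulmxDl mxE. Qed.

Lemma quadZ N c (A : 'M[C]_N) v : quad (c *: A) v = c * quad A v.
Proof. by rewrite /quad -scalemxAr -scalemxAl mxE. Qed.

Lemma adjD m n (A B : 'M[C]_(m, n)) : (A + B)^t* = A^t* + B^t*.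
Proof. by apply/matrixP => i j; rewrite !mxE rmorphD. Qed.

Lemma adjZ m n z (A : 'M[C]_(m, n)) : (z *: A)^t* = z^* *: A^t*.
Proof. by apply/matrixP => i j; rewrite !mxE rmorphM. Qed.

Lemma adj_delta m n (i : 'I_m) (j : 'I_n) : (delta_mx i j : 'M[C]_(m, n))^t* = delta_mx j i.
Proof. by apply/matrixP => k l; rewrite !mxE andbC rmorph_nat. Qed.

Lemma adjK m n (A : 'M[C]_(m, n)) : A^t*^t* = A.
Proof. by apply/matrixP => i j; rewrite !mxE; apply: conjCK. Qed.

Lemma adjM m n p (A : 'M[C]_(m, n)) (B : 'M[C]_(n, p)) :
  (A *m B)^t* = B^t* *m A^t*.
Proof. by rewrite trmx_mul map_mxM. Qed.

Lemma quad_delta2 N (A : 'M[C]_N) a b z :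
  quad A (delta_mx a 0 + z *: delta_mx b 0) =
  A a a + z * A a b + z^* * A b a + z^* * z * A b b.
Proof.
have E c d : delta_mx 0 c *m A *m delta_mx d 0 = (A c d)%:M :> 'M[C]_1.
  by rewrite -rowE -colE; apply/matrixP => i j; rewrite !mxE !ord1 eqxx mulr1n.
rewrite /quad adjD adjZ !adj_delta.
rewrite !(mulmxDl, mulmxDr) -?scalemxAl -?scalemxAr -?scalemxAl !E !mxE eqxx !mulr1n.
by ring.
Qed.

Lemma psdZ N c (A : 'M[C]_N) : 0 <= c -> psd A -> psd (c *: A).
Proof. by move=> c0 pA v; rewrite -[X in 0 <= X]/(quad _ v) quadZ mulr_ge0 ?pA. Qed.

Lemma psd_rank1 N (v : 'cV[C]_N) : psd (v *m v^t*).
Proof.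
move=> w; rewrite !mulmxA -mulmxA mxE big_ord1.
have -> : (v^t* *m w) 0 0 = ((w^t* *m v) 0 0)^*.
  rewrite !mxE rmorph_sum; apply: eq_bigr => k _.
  by rewrite !mxE rmorphM mulrC; congr (_ * _); apply/esym/conjCK.
exact: mul_conjC_ge0.
Qed.

Lemma psd_diag_ge0 N (A : 'M[C]_N) a : psd A -> 0 <= A a a.
Proof.
move=> pA; have := pA (delta_mx a 0 + 0 *: delta_mx a 0).
rewrite -[X in _ <= X]/(quad _ _) quad_delta2 conjC0 !mul0r !addr0; exact.
Qed.

(** The quadratic form is evaluated at e_a + z e_b for z = 1, -1, i and -i. *)
Lemma psd_pair N (A : 'M[C]_N) a b : psd A ->
  [/\ complex.Re (A b a) = complex.Re (A a b),
      complex.Im (A b a) = - complex.Im (A a b) &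
      `|complex.Re (A a b)| <= (complex.Re (A a a) + complex.Re (A b b)) / 2 /\
      `|complex.Im (A a b)| <= (complex.Re (A a a) + complex.Re (A b b)) / 2].
Proof.
move=> pA; have H z : 0 <= A a a + z * A a b + z^* * A b a + z^* * z * A b b.
  by rewrite -quad_delta2; apply: pA.
have := H 1; have := H (-1); have := H (0 +i* 1); have := H (0 +i* -1).
have := psd_diag_ge0 a pA; have := psd_diag_ge0 b pA.
move: (A a a) (A a b) (A b a) (A b b) => [x1 y1] [x2 y2] [x3 y3] [x4 y4].
rewrite !lecE /=.
do 6![move=> /andP[/eqP ? ?]].
split; [lra|lra|rewrite !ler_norml; split; apply/andP; split; lra].
Qed.

Lemma psd_hermitian N (A : 'M[C]_N) : psd A -> A^t* = A.
Proof.
move=> pA; apply/matrixP => a b; rewrite !mxE; have [re im _] := psd_pair b a pA.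
apply/eqP; rewrite eq_complex /=; apply/andP; split; apply/eqP;
  by move: re im; case: (A a b) (A b a) => [? ?] [? ?] /=; lra.
Qed.

(** The vectors are the columns of the adjoint of the unitary diagonalizing matrix. The
    decomposition reduces traces against [A] to values of quadratic forms. *)
Lemma psd_spectral N (A : 'M[C]_N) : psd A -> exists (l : 'I_N -> C) (v : 'I_N -> 'cV[C]_N),
  (forall k, 0 <= l k) /\ A = \sum_k l k *: (v k *m (v k)^t*).
Proof.
move=> pA; have nA : A \is normalmx by apply/normalmxP; rewrite psd_hermitian.
have /orthomx_spectralP := nA; have uP := spectral_unitarymx A.
move: (spectralmx A) (spectral_diag A) uP => P d uP; rewrite (invmx_unitary uP) => AE.
pose v k := P^t* *m delta_mx k 0 : 'cV[C]_N.
have adjv k : (v k)^t* = delta_mx 0 k *m P.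
  by rewrite /v adjM adj_delta adjK.
exists (fun k => d 0 k), v; split=> [k|].
  have := pA (v k); rewrite adjv AE /v; suff -> : delta_mx 0 k *m P *m (P^t* *m diag_mx d *m P) *m
    (P^t* *m delta_mx k 0) = (d 0 k)%:M :> 'M[C]_1 by rewrite mxE eqxx mulr1n.
  have PP : P *m P^t* = 1%:M by apply/unitarymxP.
  rewrite -!mulmxA (mulmxA P (P^t*)) PP mul1mx (mulmxA P (P^t*)) PP mul1mx.
  by apply/matrixP => i j; rewrite mulmxA -rowE -colE !mxE !ord1 eqxx.
rewrite AE; transitivity (\sum_k P^t* *m (d 0 k *: delta_mx k k) *m P).
  rewrite -mulmx_suml -mulmx_sumr; congr (_ *m _ *m _).
  by rewrite diag_mx_sum_delta.
apply: eq_bigr => k _; rewrite adjv /v -scalemxAr -scalemxAl; congr (_ *: _).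
by rewrite !mulmxA -(mulmxA _ _ (delta_mx 0 k)) mul_delta_mx.
Qed.

End Psd.

(** * Traces against tensor products and sums of matrices *)

Section PsdTensor.
Variable R : realType.
Local Notation C := R[i].

Lemma trace_sum N (I : finType) (A : I -> 'M[C]_N) :
  \tr (\sum_k A k) = \sum_k \tr (A k).
Proof. exact: raddf_sum. Qed.

Lemma trace_psd_mul N (M A : 'M[C]_N) : psd M -> psd A -> 0 <= \tr (M *m A).
Proof.
move=> pM /psd_spectral[l [v [l0 ->]]].
rewrite mulmx_sumr trace_sum sumr_ge0// => k _.
by rewrite -scalemxAr mxtraceZ trace_rank1 mulr_ge0 ?pM.
Qed.

Lemma tensmx_suml m n p q (I : finType) (A : I -> 'M[C]_(m, n)) (B : 'M[C]_(p, q)) :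
  (\sum_k A k) *t B = \sum_k A k *t B.
Proof.
apply/matrixP => i j; rewrite summxE !mxE summxE mulr_suml.
by apply: eq_bigr => k _; rewrite !mxE.
Qed.

Lemma tensmx_sumr m n p q (I : finType) (A : 'M[C]_(m, n)) (B : I -> 'M[C]_(p, q)) :
  A *t (\sum_k B k) = \sum_k A *t B k.
Proof.
apply/matrixP => i j; rewrite summxE !mxE summxE mulr_sumr.
by apply: eq_bigr => k _; rewrite !mxE.
Qed.

Lemma tensmxDl m n p q (A A' : 'M[C]_(m, n)) (B : 'M[C]_(p, q)) :
  (A + A') *t B = A *t B + A' *t B.
Proof. by apply/matrixP => i j; rewrite !mxE mulrDl. Qed.

Lemma tensmxDr m n p q (A : 'M[C]_(m, n)) (B B' : 'M[C]_(p, q)) :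
  A *t (B + B') = A *t B + A *t B'.
Proof. by apply/matrixP => i j; rewrite !mxE mulrDr. Qed.

Lemma tensmxZ m n p q c d (A : 'M[C]_(m, n)) (B : 'M[C]_(p, q)) :
  (c *: A) *t (d *: B) = (c * d) *: (A *t B).
Proof. by apply/matrixP => i j; rewrite !mxE mulrACA. Qed.

Lemma adj_tensmx m n p q (A : 'M[C]_(m, n)) (B : 'M[C]_(p, q)) :
  (A *t B)^t* = A^t* *t B^t*.
Proof. by rewrite trmx_tens map_mxT. Qed.

(** With A and B decomposed into pure states, the trace is a nonnegative combination of values of
    the form of M at product vectors. *)
Lemma trace_psd_tens N (M : 'M[C]_(N * N)) (A B : 'M[C]_N) :
  psd M -> psd A -> psd B -> 0 <= \tr (M *m (A *t B)).
Proof.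
move=> pM /psd_spectral[l [v [l0 ->]]] /psd_spectral[k [w [k0 ->]]].
rewrite tensmx_suml mulmx_sumr trace_sum sumr_ge0// => a _.
rewrite tensmx_sumr mulmx_sumr trace_sum sumr_ge0// => b _.
rewrite tensmxZ -scalemxAr mxtraceZ mulr_ge0 ?mulr_ge0//.
by rewrite -tensmx_mul -adj_tensmx [X in 0 <= X]trace_rank1 pM.
Qed.

Lemma psd_tens N (A B : 'M[C]_N) : psd A -> psd B -> psd (A *t B).
Proof.
move=> pA pB v; rewrite -[X in 0 <= X]/(quad _ v) -trace_rank1 mxtrace_mulC.
exact: trace_psd_tens (psd_rank1 v) pA pB.
Qed.

Lemma trace_tens N (A B : 'M[C]_N) : \tr (A *t B) = \tr A * \tr B.
Proof. by rewrite /mxtrace mulr_sum; apply: eq_bigr => k _; rewrite !mxE. Qed.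

Lemma trace_tens_mul N (A B D E : 'M[C]_N) :
  \tr ((A *t B) *m (D *t E)) = \tr (A *m D) * \tr (B *m E).
Proof. by rewrite tensmx_mul trace_tens. Qed.

Lemma Re_ge0 (z : C) : 0 <= z -> 0 <= complex.Re z.
Proof. by rewrite lecE => /andP[]. Qed.

Lemma ge0_ReE (z : C) : 0 <= z -> z = (complex.Re z)%:C%C.
Proof. by case: z => x y; rewrite lecE /= => /andP[/eqP->]. Qed.

Lemma Re_sum (I : Type) (r : seq I) (P : pred I) (F : I -> C) :
  complex.Re (\sum_(k <- r | P k) F k) = \sum_(k <- r | P k) complex.Re (F k).
Proof. by elim/big_rec2: _ => //= k x y _ <-; case: (F k) y => [? ?] [? ?]. Qed.

Lemma Im_sum (I : Type) (r : seq I) (P : pred I) (F : I -> C) :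
  complex.Im (\sum_(k <- r | P k) F k) = \sum_(k <- r | P k) complex.Im (F k).
Proof. by elim/big_rec2: _ => //= k x y _ <-; case: (F k) y => [? ?] [? ?]. Qed.

(** Through this, a bound on traces yields absolute convergence of matrix sums in each entry. *)
Lemma psd_entry_bound N (A : 'M[C]_N) a b : psd A ->
  `|complex.Re (A a b)| <= complex.Re (\tr A) /\
  `|complex.Im (A a b)| <= complex.Re (\tr A).
Proof.
move=> pA; have [_ _ [re im]] := psd_pair a b pA.
have diag c : complex.Re (A c c) <= complex.Re (\tr A).
  rewrite /mxtrace Re_sum (bigD1 c)//= lerDl; apply: sumr_ge0 => d _.
  exact/Re_ge0/psd_diag_ge0.
have := diag a; have := diag b.
by split; [apply: le_trans re _|apply: le_trans im _]; lra.
Qed.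

Definition mx_summable (T : choiceType) (D : set T) m n (F : T -> 'M[C]_(m, n)) :=
  forall a b, rsummable D (fun t => complex.Re (F t a b)) /\
              rsummable D (fun t => complex.Im (F t a b)).

(** The trace is a finite real-linear combination of real and imaginary parts of entries, and it
    passes inside the sum because each of these families is summable. *)
Lemma mxsum_trace (T : choiceType) (D : set T) N (F : T -> 'M[C]_N) (A : 'M[C]_N) :
  mx_summable D F ->
  \tr (mxsum D F *m A) = ((rsum D (fun t => complex.Re (\tr (F t *m A)))) +i*
                          (rsum D (fun t => complex.Im (\tr (F t *m A)))))%C.
Proof.
move=> sF; have traceE (M : 'M[C]_N) : \tr (M *m A) = \sum_(u : 'I_N * 'I_N) M u.1 u.2 * A u.2 u.1.
  rewrite -(pair_bigA _ (fun a b => M a b * A b a)) /=.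
  by apply: eq_bigr => a _; rewrite mxE.
have sRe a b : rsummable D (fun t => complex.Re (F t a b)) by case: (sF a b).
have sIm a b : rsummable D (fun t => complex.Im (F t a b)) by case: (sF a b).
have ReM (x y : C) : complex.Re (x * y) =
    complex.Re y * complex.Re x + - complex.Im y * complex.Im x.
  by case: x y => [? ?] [? ?] /=; ring.
have ImM (x y : C) : complex.Im (x * y) =
    complex.Im y * complex.Re x + complex.Re y * complex.Im x.
  by case: x y => [? ?] [? ?] /=; ring.
rewrite traceE; apply/eqP; rewrite eq_complex Re_sum Im_sum /=; apply/andP; split; apply/eqP.
  rewrite (eq_rsum (g := fun t => \sum_(u : 'I_N * 'I_N)
     (complex.Re (A u.2 u.1) * complex.Re (F t u.1 u.2) +
      - complex.Im (A u.2 u.1) * complex.Im (F t u.1 u.2)))); last first.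
    by move=> t _; rewrite traceE Re_sum; apply: eq_bigr => u _; rewrite ReM.
  rewrite rsum_sum => [|u]; last by apply: rsummableD; apply: rsummableZ.
  apply: eq_bigr => u _; rewrite rsumD ?rsumZ//; try exact: rsummableZ.
  by rewrite ReM mxE.
rewrite (eq_rsum (g := fun t => \sum_(u : 'I_N * 'I_N)
   (complex.Im (A u.2 u.1) * complex.Re (F t u.1 u.2) +
    complex.Re (A u.2 u.1) * complex.Im (F t u.1 u.2)))); last first.
  by move=> t _; rewrite traceE Im_sum; apply: eq_bigr => u _; rewrite ImM.
rewrite rsum_sum => [|u]; last by apply: rsummableD; apply: rsummableZ.
apply: eq_bigr => u _; rewrite rsumD ?rsumZ//; try exact: rsummableZ.
by rewrite ImM mxE.
Qed.

Lemma mx_summable_trace (T : choiceType) (D : set T) N (F : T -> 'M[C]_N) (A : 'M[C]_N) :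
  mx_summable D F -> rsummable D (fun t => complex.Re (\tr (F t *m A))).
Proof.
move=> sF; have sRe a b : rsummable D (fun t => complex.Re (F t a b)) by case: (sF a b).
have sIm a b : rsummable D (fun t => complex.Im (F t a b)) by case: (sF a b).
rewrite (_ : (fun t => _) = fun t => \sum_(u : 'I_N * 'I_N)
     (complex.Re (A u.2 u.1) * complex.Re (F t u.1 u.2) +
      - complex.Im (A u.2 u.1) * complex.Im (F t u.1 u.2))).
  by apply: rsummable_sum => u; apply: rsummableD; apply: rsummableZ.
apply/funext => t; rewrite -(pair_bigA _ (fun a b => complex.Re (A b a) * complex.Re (F t a b) +
      - complex.Im (A b a) * complex.Im (F t a b))) /= /mxtrace Re_sum.
apply: eq_bigr => a _; rewrite mxE Re_sum; apply: eq_bigr => b _.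
by case: (F t a b) (A b a) => [? ?] [? ?] /=; ring.
Qed.

Lemma mxsum_trace_ge0E (T : choiceType) (D : set T) N (F : T -> 'M[C]_N) (A : 'M[C]_N) :
  mx_summable D F -> (forall t, D t -> 0 <= \tr (F t *m A)) ->
  \tr (mxsum D F *m A) = (rsum D (fun t => complex.Re (\tr (F t *m A))))%:C%C.
Proof.
move=> sF tr0; rewrite mxsum_trace// (eq_rsum (f := fun t => complex.Im _) (g := fun=> 0)).
  by rewrite (rsum_ge0E (f := fun=> 0))// esum1.
by move=> t /tr0/ge0_ReE->.
Qed.

End PsdTensor.

(** * The universal semi-density matrix *)

Section Codes.
Variable R : realType.
Local Notation C := R[i].

Definition elem (z : rat[i]) : C := ((ratr (complex.Re z)) +i* (ratr (complex.Im z)))%C.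

Definition code_vec N (x : nat) : 'cV[C]_N := \col_a elem (entry x a).

Lemma code_vec_pickle N (phi : 'cV[rat[i]]_N) : code_vec N (pickle phi) = elem_mx R phi.
Proof.
apply/matrixP => a j; rewrite !mxE ord1 -(entry_mx phi a ord0) muln1 addn0.
by [].
Qed.

Lemma ratr_expectation N (A : 'M[rat[i]]_N) x :
  ratr (code_expectation N (pickle A) x) = complex.Re (quad (elem_mx R A) (code_vec N x)).
Proof.
rewrite quadE Re_sum /code_expectation rmorph_sum big_mkord; apply: eq_bigr => a _.
rewrite rmorph_sum Re_sum big_mkord; apply: eq_bigr => b _.
rewrite !mxE entry_mx; move: (entry x a) (A a b) (entry x b) => u m v.
rewrite /expectation_term !(rmorphD, rmorphM, rmorphN) /=; ring.
Qed.

Lemma ratr_norm_sqr N x :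
  (ratr (norm_sqr N x))%:C%C = ((code_vec N x)^t* *m code_vec N x) 0 0.
Proof.
rewrite mxE /norm_sqr rmorph_sum big_mkord.
rewrite [LHS](rmorph_sum (real_complex R)); apply: eq_bigr => a _; rewrite !mxE.
apply/eqP; rewrite eq_complex /= !(rmorphD, rmorphM) /=.
by apply/andP; split; apply/eqP; ring.
Qed.

Lemma norm_sqr_unit N x : norm_sqr N x = 1 ->
  ((code_vec N x)^t* *m code_vec N x) 0 0 = 1.
Proof. by rewrite -ratr_norm_sqr => ->; rewrite rmorph1. Qed.

Lemma unit_norm_sqr N x : ((code_vec N x)^t* *m code_vec N x) 0 0 = 1 ->
  norm_sqr N x = 1.
Proof.
rewrite -ratr_norm_sqr => /(congr1 (@complex.Re _)) /= /eqP.
by rewrite -(rmorph1 (ratr : rat -> R)) (inj_eq (fmorph_inj _)) => /eqP.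
Qed.

Lemma divn_floor (u w : nat) : (0 < w)%N ->
  (u %/ w)%:R <= u%:R / w%:R :> R /\ u%:R / w%:R <= (u %/ w)%:R + 1 :> R.
Proof.
move=> w_gt0; have wR : 0 < w%:R :> R by rewrite ltr0n.
rewrite ler_pdivlMr// ler_pdivrMr// -natrM natr1 -natrM !ler_nat.
by rewrite leq_divM ltnW// ltn_ceil.
Qed.

(** Rounding down costs at most 1, a loss of 2^-t in the approximated weight. *)
Lemma scaled_expectationP N (A : 'M[rat[i]]_N) x t l : psd (elem_mx R A) ->
  let v := 2 ^+ t * (2^-1 ^+ l * complex.Re (quad (elem_mx R A) (code_vec N x))) in
  (scaled_expectation N (pickle A) x t l)%:R <= v /\
  (norm_sqr N x = 1 -> v <= (scaled_expectation N (pickle A) x t l)%:R + 1).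
Proof.
move=> pA v; have q0 : 0 <= complex.Re (quad (elem_mx R A) (code_vec N x)) by apply/Re_ge0/pA.
have v0 : 0 <= v by rewrite !mulr_ge0 ?exprn_ge0 ?invr_ge0.
rewrite /scaled_expectation; case: eqP => [_|//].
set q := code_expectation _ _ _; have vE : v = 2 ^+ t * (2^-1 ^+ l * ratr q).
  by rewrite /v -ratr_expectation.
move: q0; rewrite -ratr_expectation -/q ler0q -numq_ge0 => q0.
have w_gt0 : (0 < absz (denq q) * 2 ^ l)%N by rewrite muln_gt0 absz_gt0 denq_neq0 expn_gt0.
have [lo hi] := divn_floor (pos_part (numq q) * 2 ^ t) w_gt0.
suff -> : v = (pos_part (numq q) * 2 ^ t)%:R / (absz (denq q) * 2 ^ l)%:R by [].
rewrite vE !natrM !natrX /ratr.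
have -> : (pos_part (numq q))%:R = (numq q)%:~R :> R by case: (numq q) q0.
have -> : (absz (denq q))%:R = (denq q)%:~R :> R by rewrite -[in RHS]absz_denq pmulrn.
have d0 : (denq q)%:~R != 0 :> R by rewrite intr_eq0 denq_neq0.
by rewrite exprVn; field; rewrite d0 expf_neq0.
Qed.

End Codes.

Section Measurement.
Variable R : realType.
Local Notation C := R[i].

Lemma quad_sum N (I : Type) (r : seq I) (A : I -> 'M[C]_N) v :
  quad (\sum_(k <- r) A k) v = \sum_(k <- r) quad (A k) v.
Proof.
elim: r => [|k r IHr]; last by rewrite !big_cons quadD IHr.
by rewrite !big_nil /quad mulmx0 mul0mx mxE.
Qed.

Lemma cvg_bigsum (I : Type) (r : seq I) (f : I -> nat -> R) (l : I -> R) :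
  (forall i, f i k @[k --> \oo] --> l i) ->
  \sum_(i <- r) f i k @[k --> \oo] --> \sum_(i <- r) l i.
Proof.
move=> fl; elim: r => [|i r IHr].
  by rewrite big_nil; under eq_fun do rewrite big_nil; apply: cvg_cst.
by rewrite big_cons; under eq_fun do rewrite big_cons; apply: cvgD.
Qed.

Lemma cvg_quad N (s : nat -> 'M[C]_N) A v : mx_cvg s A ->
  complex.Re (quad (s k) v) @[k --> \oo] --> complex.Re (quad A v).
Proof.
move=> sA; have E (M : 'M[C]_N) : complex.Re (quad M v) = \sum_a \sum_b
    (complex.Re ((v a 0)^* * v b 0) * complex.Re (M a b) -
     complex.Im ((v a 0)^* * v b 0) * complex.Im (M a b)).
  rewrite quadE Re_sum; apply: eq_bigr => a _; rewrite Re_sum; apply: eq_bigr => b _.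
  rewrite mulrAC; move: ((v a 0)^* * v b 0) => z.
  by case: z (M a b) => [? ?] [? ?] /=; ring.
rewrite E; under eq_fun do rewrite E.
apply: cvg_bigsum => a; apply: cvg_bigsum => b.
by have [re im] := sA a b; apply: cvgB; apply: cvgMl_tmp.
Qed.

(** The partial sums increase, and they converge to the form of the identity. *)
Lemma POVM_sum_le N (E : nat -> 'M[C]_N) v m : POVM E ->
  \sum_(k < m) complex.Re (quad (E k) v) <= complex.Re ((v^t* *m v) 0 0).
Proof.
move=> [pE /(@cvg_quad _ _ _ v)].
have -> : quad 1%:M v = (v^t* *m v) 0 0 by rewrite /quad mulmx1.
under eq_fun do rewrite quad_sum Re_sum.
move=> cv; rewrite -(cvg_lim (@Rhausdorff R) cv).
apply: (nondecreasing_cvgn_le (u_ := fun m => \sum_(k < m) complex.Re (quad (E k) v))).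
  apply/nondecreasing_seqP => k; rewrite big_ord_recr /= lerDl.
  exact/Re_ge0/pE.
by apply/cvg_ex; eexists; exact: cv.
Qed.

End Measurement.

(** * Approximation of the weights of the outcomes *)

Section OutcomeWeight.
Variables (R : realType) (U : recfun) (H : nat -> seq nat -> option nat).
Hypotheses (hU : universal U) (HU : evaluator U H).
Variables (n : nat) (e : seq bool) (E : nat -> 'M[R[i]]_(2 ^ n)).
Hypothesis E_POVM : POVM E.
Variable s : nat -> 'M[rat[i]]_(2 ^ n).
Hypotheses (s_outputs : outputs U [::] e s) (sE : forall k, E k = elem_mx R (s k)).
Local Notation C := R[i].
Local Notation y := (pickle (e, n)).

Definition outcome_quad k x : R := complex.Re (quad (E k) (code_vec R (2 ^ n) x)).

Lemma outcome_quad_ge0 k x : 0 <= outcome_quad k x.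
Proof. by apply/Re_ge0/E_POVM.1. Qed.

Lemma outcome_quad_sum_le m x : norm_sqr (2 ^ n) x = 1 ->
  \sum_(k < m) outcome_quad k x <= 1.
Proof.
move=> x1; have := POVM_sum_le (code_vec R (2 ^ n) x) m E_POVM.
by rewrite norm_sqr_unit.
Qed.

Lemma outcome_fuel k : exists t, H t [:: CodeSeq.code [:: 0; k]%N; pickle e] = Some (pickle (s k)).
Proof. by have [_ _ HP] := HU; apply/HP; apply: (s_outputs k). Qed.

Lemma outcome_fuelE t k c :
  H t [:: CodeSeq.code [:: 0; k]%N; pickle e] = Some c -> c = pickle (s k).
Proof.
have [_ _ HP] := HU => Ht; apply: eval_functional (s_outputs k).
by apply/HP; exists t.
Qed.

Lemma field_y0 : field_at y 0 = pickle e.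
Proof. by rewrite pickle_pair field_at_code. Qed.

Lemma field_y1 : field_at y 1 = n.
Proof. by rewrite pickle_pair field_at_code. Qed.

(** The condition does not mention the outcome, so for each active program the sum over the outcomes
    can be taken first. *)
Definition active t c := (pickle (bits_of_code c) == c) &&
  (if H t [:: y; c] is Some x then norm_sqr (2 ^ n) x == 1 else false).

Lemma contribution_le k t c : (contribution H y k t c)%:R <=
  (if active t c then 2 ^+ t * (2^-1 ^+ size (bits_of_code c) *
     outcome_quad k (odflt 0 (H t [:: y; c]))%N) else 0) :> R.
Proof.
have fuelE := @outcome_fuelE t k; rewrite /contribution /active field_y0 field_y1.
move: (CodeSeq.code _) fuelE => ck fuelE; case: ifP => //= _.
case Ex: (H t [:: y; c]) => [x|]//=.
case Ec: (H t [:: ck; _]) => [c'|]; last first.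
  by case: ifP => // _; rewrite !mulr_ge0 ?exprn_ge0 ?invr_ge0 ?outcome_quad_ge0.
rewrite (fuelE _ Ec) /outcome_quad sE.
have pE : psd (elem_mx R (s k)) by rewrite -sE; apply: E_POVM.1.
have [le _] := scaled_expectationP x t (size (bits_of_code c)) pE.
by case: ifP le => //; rewrite /scaled_expectation => ->.
Qed.

Lemma bits_of_code_inj c d : pickle (bits_of_code c) = c ->
  pickle (bits_of_code d) = d -> bits_of_code c = bits_of_code d -> c = d.
Proof. by move=> cE dE bE; rewrite -cE bE dE. Qed.

Lemma outcome_weight_below : weight_below (outcome_weight H) y.
Proof.
move=> m t; rewrite -(ler_nat R) natr_sum natrX.
apply: (@le_trans _ _ (\sum_(0 <= c < t | active t c)
   2 ^+ t * 2^-1 ^+ size (bits_of_code c))).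
  rewrite /outcome_weight; under eq_bigr do rewrite natr_sum.
  rewrite exchange_big [leRHS]big_mkcond /=; apply: ler_sum => c _.
  apply: le_trans; first by apply: ler_sum => k _; apply: contribution_le.
  case: ifP => [/andP[_]|_]; last by rewrite big1.
  case Ex: (H t [:: y; c]) => [x|]// /eqP x1 /=.
  rewrite -mulr_sumr ler_pM2l ?exprn_gt0// -mulr_sumr.
  by rewrite ler_piMr ?exprn_ge0 ?invr_ge0 ?outcome_quad_sum_le.
rewrite -mulr_sumr ler_piMr ?exprn_ge0//.
rewrite -big_filter -(big_map bits_of_code xpredT (fun p => 2^-1 ^+ size p)).
apply: (program_sum R hU (y := (e, n))) => [|p /mapP[c]].
  rewrite map_inj_in_uniq ?filter_uniq ?iota_uniq// => c d.
  rewrite !mem_filter => /andP[/andP[/eqP cE _] _] /andP[/andP[/eqP dE _] _].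
  exact: bits_of_code_inj.
rewrite mem_filter => /andP[/andP[/eqP cE] + _] ->.
case Ex: (H t _) => [x|]// _; exists x; rewrite /runs cE.
by have [_ _ HP] := HU; apply/HP; exists t.
Qed.

(** At late stages all programs in [P] have halted and E_k is known. What is missing is the rounding
    error, at most 1 for each program in [P]. *)
Lemma outcome_weight_ge k (P : seq (seq bool)) : uniq P ->
  (forall p, p \in P -> exists2 x, runs U y p x & norm_sqr (2 ^ n) x = 1) ->
  exists t0, forall t, (t0 <= t)%N ->
    2 ^+ t * (\sum_(p <- P) 2^-1 ^+ size p *
      outcome_quad k (xget 0%N [set x : nat | runs U y p x])) - (size P)%:R
    <= (outcome_weight H y k t)%:R.
Proof.
have [_ Hmono HP] := HU; move=> UP Punit.
have [t1 t1P] := outcome_fuel k.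
have [t2 t2P] : exists t0, forall p, p \in P -> (pickle p < t0)%N /\
    H t0 [:: y; pickle p] = Some (xget 0%N [set x : nat | runs U y p x]).
  elim: P {UP} Punit => [|p P IHP] Punit; first by exists 0%N.
  have [|t0 t0P] := IHP; first by move=> q qP; apply: Punit; rewrite inE qP orbT.
  have [x px _] := Punit p (mem_head _ _); have /HP[t tP] := px.
  exists (maxn (pickle p).+1 (maxn t t0)) => q; rewrite inE => /predU1P[->|/t0P[lt Ht]].
    split; first by rewrite leq_max ltnSn.
    rewrite (_ : xget _ _ = x); last first.
      by case: xgetP => [z _ /= pz|/(_ x)//]; apply: runs_functional pz px.
    by apply: Hmono tP; rewrite !leq_max leqnn !orbT.
  split; first by rewrite !leq_max lt !orbT.
  by apply: Hmono Ht; rewrite !leq_max leqnn !orbT.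
exists (maxn t1 t2) => t; rewrite geq_max => /andP[le1 le2].
have pickle_lt p : p \in P -> (pickle p < t)%N.
  by move=> /t2P[lt _]; apply: leq_trans lt le2.
rewrite lerBlDr mulr_sumr; apply: (@le_trans _ _
  (\sum_(p <- P) ((contribution H y k t (pickle p))%:R + 1))).
  rewrite big_seq [leRHS]big_seq; apply: ler_sum => p pP.
  have [_ /(Hmono _ _ _ _ le2) Ht] := t2P p pP; have [x px x1] := Punit p pP.
  have xE : xget 0%N [set x : nat | runs U y p x] = x.
    by case: xgetP => [z _ /= pz|/(_ x)//]; apply: runs_functional pz px.
  have bitsK : bits_of_code (pickle p) = p.
    rewrite /bits_of_code -[pickle p]/(CodeSeq.code (map pickle p)) CodeSeq.codeK.
    by rewrite -map_comp map_id_in// => -[].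
  rewrite /contribution bitsK eqxx Ht field_y0 field_y1 (Hmono _ _ _ _ le1 t1P).
  have pE : psd (elem_mx R (s k)) by rewrite -sE; apply: E_POVM.1.
  have [_] := scaled_expectationP x t (size p) pE.
  by rewrite xE /outcome_quad sE; apply.
rewrite big_split /= big_const_seq count_predT iter_addr addr0 lerD2r.
rewrite -natr_sum ler_nat /outcome_weight.
rewrite -(big_map pickle xpredT (fun c => contribution H y k t c)).
have perm : perm_eq (map pickle P) [seq c <- index_iota 0 t | c \in map pickle P].
  apply: uniq_perm => [||c]; rewrite ?filter_uniq ?iota_uniq//.
    by rewrite map_inj_uniq//; apply: pcan_inj pickleK.
  rewrite mem_filter mem_index_iota; case: mapP => // -[p pP ->].
  by rewrite pickle_lt.
by rewrite (perm_big _ perm) big_filter [leqRHS](bigID (mem (map pickle P))) leq_addr.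
Qed.

End OutcomeWeight.

Section UniversalMatrix.
Variables (R : realType) (U : recfun).
Hypothesis hU : universal U.
Variables (e : seq bool) (n : nat).
Local Notation C := R[i].

Definition unit_vectors : set 'cV[rat[i]]_(2 ^ n) :=
  [set phi | ((elem_mx R phi)^t* *m elem_mx R phi) 0 0 = 1].

Local Notation m phi := (univ_prob R U phi (e, n)).
Local Notation F phi := ((m phi)%:C%C *: (elem_mx R phi *m (elem_mx R phi)^t*)).

Lemma universal_mx_term_psd (phi : 'cV[rat[i]]_(2 ^ n)) : psd (F phi).
Proof. by apply: psdZ (psd_rank1 _); rewrite lecR univ_prob_ge0. Qed.

(** A term is positive with trace [m phi], which bounds its entries, and these traces add up to at
    most 1. *)
Lemma universal_mx_summable : mx_summable unit_vectors (fun phi => F phi).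
Proof.
have bound phi : unit_vectors phi -> complex.Re (\tr (F phi)) = m phi.
  move=> phi1; rewrite mxtraceZ mxtrace_mulC /mxtrace big_ord1 phi1 mulr1.
  by [].
move=> a b; split; apply: (@rsummable_bound _ _ _ _ 1) => s Us sD.
all: apply: le_trans (univ_prob_sum R hU (e, n) Us); rewrite big_seq [leRHS]big_seq.
all: apply: ler_sum => phi /sD/bound E; rewrite -[leRHS]E.
all: by have [] := psd_entry_bound a b (universal_mx_term_psd phi).
Qed.

Lemma universal_mx_trace (A : 'M[C]_(2 ^ n)) : psd A ->
  \tr (universal_mx R U e n *m A) =
  (rsum unit_vectors (fun phi => m phi * complex.Re (quad A (elem_mx R phi))))%:C%C.
Proof.
move=> pA; have trE phi : \tr (F phi *m A) = (m phi)%:C%C * quad A (elem_mx R phi).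
  by rewrite -scalemxAl mxtraceZ mxtrace_mulC trace_rank1.
rewrite /universal_mx mxsum_trace_ge0E; first last.
- by move=> phi _; rewrite trE mulr_ge0 ?pA// lecR univ_prob_ge0.
- exact: universal_mx_summable.
congr (_%:C)%C; apply: eq_rsum => phi _; rewrite trE.
by case: (quad _ _) => x y /=; rewrite mul0r subr0.
Qed.

Lemma universal_mx_rsummable (A : 'M[C]_(2 ^ n)) : psd A ->
  rsummable unit_vectors (fun phi => m phi * complex.Re (quad A (elem_mx R phi))).
Proof.
move=> pA; have := mx_summable_trace A universal_mx_summable.
rewrite (_ : (fun phi => _) = fun phi => m phi * complex.Re (quad A (elem_mx R phi)))//.
apply/funext => phi; rewrite -scalemxAl mxtraceZ mxtrace_mulC trace_rank1.
by case: (quad _ _) => x y /=; rewrite mul0r subr0.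
Qed.

Lemma universal_mx_psd : psd (universal_mx R U e n).
Proof.
move=> v; rewrite -[X in 0 <= X]/(quad _ v) -trace_rank1 universal_mx_trace; last exact: psd_rank1.
rewrite lecR rsum_ge0// => phi _; rewrite mulr_ge0 ?univ_prob_ge0//.
exact/Re_ge0/psd_rank1.
Qed.

End UniversalMatrix.

(** Each universal probability is a sum over all programs of a vector. A strict lower bound on the
    weighted sum over vectors is already attained by finitely many of these programs, which the
    approximation then overtakes. *)
Lemma fiber_programs (R : realType) U (hU : universal U) (e : seq bool) n
    (q : nat -> R) (v : R) (S : seq 'cV[rat[i]]_(2 ^ n)) : (forall x, 0 <= q x) ->
  uniq S -> v < \sum_(phi <- S) univ_prob R U phi (e, n) * q (pickle phi) ->
  exists P : seq (seq bool), [/\ uniq P,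
    forall p, p \in P -> exists2 phi, phi \in S & runs U (e, n) p phi &
    v < \sum_(p <- P) 2^-1 ^+ size p *
      q (xget 0%N [set x : nat | runs U (pickle (e, n)) p x])].
Proof.
move=> q0 US ltv; apply: contrapT => nP; move: ltv; apply/negP; rewrite -leNgt.
pose f p := 2^-1 ^+ size p * q (xget 0%N [set x : nat | runs U (pickle (e, n)) p x]).
rewrite (eq_bigr (fun phi => rsum [set p | runs U (e, n) p phi] f)); last first.
  move=> phi _; rewrite mulrC /univ_prob -rsumZ; last exact: rsummable_programs.
  apply: eq_rsum => p pphi; rewrite /f mulrC (_ : xget _ _ = pickle phi)//.
  by case: xgetP => [z _ /= pz|/(_ (pickle phi))//]; apply: runs_functional pz pphi.
apply: rsum_fibers => // [phi psi p|p|P UP Pphi].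
- exact: runs_functional.
- by rewrite /f mulr_ge0 ?exprn_ge0 ?invr_ge0.
rewrite leNgt; apply/negP => ltv; apply: nP; by exists P.
Qed.

Theorem measurement_coding (R : realType) U : universal U ->
  exists c, forall n e (E : nat -> 'M[R[i]]_(2 ^ n)) k, POVM E -> enumerates U e E ->
  complex.Re (\tr (E k *m universal_mx R U e n)) <= 2 ^+ c * 2^-1 ^+ Kpref U k (e, n).
Proof.
move=> hU; have [H HU] := evaluator_exists U; have [c cP] := outcome_coding hU HU.
(* The additional factor 2 pays for replacing the weight by a power of 2. *)
exists c.+1 => n e E k EP [s [s_outputs sE]].
rewrite mxtrace_mulC (universal_mx_trace hU); last exact: EP.1.
rewrite [complex.Re _]/=; set tau := rsum _ _.
have nonneg phi : 0 <= univ_prob R U phi (e, n) * complex.Re (quad (E k) (elem_mx R phi)).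
  by rewrite mulr_ge0 ?univ_prob_ge0//; apply/Re_ge0/EP.1.
have Kle l : 2^-1 ^+ l < tau -> (Kpref U k (e, n) <= l + c)%N.
  move=> ltl; have [_ Kmin] := KprefP hU k (e, n).
  have [S [US SD] ltS] := rsum_sup (fun t _ => nonneg t) ltl.
  have [||P [UP Punit]] := @fiber_programs R U hU e n (outcome_quad E k) (2^-1 ^+ l) S _ US.
  - by move=> x; apply: outcome_quad_ge0.
  - rewrite (eq_bigr (fun phi => univ_prob R U phi (e, n) *
      complex.Re (quad (E k) (elem_mx R phi))))// => phi _.
    by rewrite /outcome_quad code_vec_pickle.
  set Sig := \sum_(p <- P) _ => ltSig.
  have [|t0 t0P] := @outcome_weight_ge R U H HU n e E EP s s_outputs sE k P UP.
    move=> p /Punit[phi /SD phi1 pphi]; exists (pickle phi); first exact: pphi.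
    by apply: (@unit_norm_sqr R); rewrite code_vec_pickle.
  (* The strict inequality leaves a gap; scaled by 2^t it eventually exceeds the total rounding
     error [size P]. *)
  have gap : 0 < Sig - 2^-1 ^+ l by rewrite subr_gt0.
  pose t := maxn t0 (Num.bound ((size P)%:R / (Sig - 2^-1 ^+ l))).
  have big : (size P)%:R < 2 ^+ t * (Sig - 2^-1 ^+ l).
    by rewrite -ltr_pdivrMr// upper_nthrootP// leq_maxr.
  have exb : exists t, (2 ^ t < outcome_weight H (pickle (e, n)) k t * 2 ^ l)%N.
    exists t; rewrite -(ltr_nat R) natrM !natrX -ltr_pdivrMr ?exprn_gt0//.
    apply: lt_le_trans (t0P t (leq_maxl _ _)); rewrite -/Sig.
    by rewrite ltrBrDr -ltrBrDl -exprVn -mulrBr.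
  have [p pk lep] := cP _ (outcome_weight_below hU HU EP s_outputs sE) k l exb.
  exact: leq_trans (Kmin p pk) lep.
(* This excludes the exponent 0 below, so the least exponent has a predecessor l, for which tau is
   at most 2^-l. *)
have tau1 : tau <= 1.
  apply: rsum_le => // S US SD; apply: le_trans (univ_prob_sum R hU (e, n) US).
  rewrite big_seq [leRHS]big_seq; apply: ler_sum => phi /SD phi1.
  rewrite ler_piMr ?univ_prob_ge0//.
  have := POVM_sum_le (elem_mx R phi) k.+1 EP; rewrite big_ord_recr /= phi1 /=.
  apply: le_trans; rewrite lerDr; apply: sumr_ge0 => j _; exact/Re_ge0/EP.1.
have [tau_le0|tau_gt0] := leP tau 0.
  by apply: le_trans tau_le0 _; rewrite mulr_ge0 ?exprn_ge0 ?invr_ge0.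
have exl : exists l, 2^-1 ^+ l < tau.
  exists (Num.bound tau^-1); rewrite exprVn -[ltRHS]invrK ltf_pV2 ?posrE ?invr_gt0 ?exprn_gt0//.
  by rewrite upper_nthrootP.
case: (ex_minnP exl) => -[|l] ltl minl; first by rewrite expr0 ltNge tau1 in ltl.
have lel : tau <= 2^-1 ^+ l.
  by rewrite leNgt; apply/negP => /minl; rewrite ltnn.
apply: le_trans lel _.
rewrite -ler_pdivrMl ?exprn_gt0// -exprVn -exprD addnC.
apply: ler_wiXn2l; rewrite ?invr_ge0 ?invf_le1 ?ler1n//.
by have := Kle _ ltl; rewrite addSn addnS.
Qed.

(** * A lower bound on the universal matrix and limits of positive matrices *)

Section LowerBound.
Variables (R : realType) (U : recfun).
Hypothesis hU : universal U.
Variables (e : seq bool) (n : nat).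
Local Notation C := R[i].
Local Notation mu := (universal_mx R U e n).

Definition basis_vector (a : 'I_(2 ^ n)) : 'cV[rat[i]]_(2 ^ n) :=
  \col_b ((a == b)%:R +i* 0)%C.

Lemma basis_vectorE a : elem_mx R (basis_vector a) = delta_mx a 0.
Proof.
apply/matrixP => b j; rewrite !mxE ord1 eqxx andbT eq_sym /= rmorph_nat rmorph0.
by case: (b == a); apply/eqP; rewrite eq_complex /= !eqxx.
Qed.

Lemma basis_vector_unit a : unit_vectors R (basis_vector a).
Proof. by rewrite /unit_vectors /= basis_vectorE adj_delta mul_delta_mx mxE !eqxx. Qed.

Lemma basis_vector_inj : injective basis_vector.
Proof.
move=> a b /(congr1 (fun x => elem_mx R x)); rewrite !basis_vectorE => /matrixP/(_ a 0).
by rewrite !mxE !eqxx andbT /=; case: eqVneq => // _ /eqP; rewrite oner_eq0.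
Qed.

(** The vectors of the standard basis are elementary, so each has a positive weight in mu, and their
    projectors add up to the identity. *)
Lemma universal_mx_ge : exists2 c : R, 0 < c & psd (mu - c%:C%C *: 1%:M).
Proof.
pose w a := univ_prob R U (basis_vector a) (e, n).
have w1 a : w a <= 1.
  have := univ_prob_sum R hU (e, n) (s := [:: basis_vector a]) isT.
  by rewrite big_seq1.
have w0 a : 0 < w a by apply: univ_prob_gt0.
(* As no weight exceeds 1, the product is a positive lower bound of all of them. *)
exists (\prod_a w a) => [|v]; first by apply: prodr_gt0.
have cle a : \prod_b w b <= w a.
  rewrite (bigD1 a)//= ler_piMr ?(ltW (w0 a))// prodr_ile1// => b _.
  by rewrite w1 ltW ?w0.
move: (\prod_b w b) cle => c cle.
rewrite -[X in 0 <= X]/(quad _ v) quadD -scaleNr quadZ.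
have -> : quad 1%:M v = (\sum_a complex.Re (quad (v *m v^t*) (delta_mx a 0)))%:C%C.
  rewrite /quad mulmx1 mxE [RHS](rmorph_sum (real_complex R)); apply: eq_bigr => a _.
  rewrite /= adj_delta -rowE -colE !mxE big_ord1 !mxE.
  by case: (v a 0) => x y; apply/eqP; rewrite eq_complex /=; apply/andP; split; apply/eqP; ring.
rewrite -trace_rank1 (universal_mx_trace hU); last exact: psd_rank1.
have -> : - c%:C%C = (- c)%:C%C :> C by rewrite rmorphN.
rewrite -rmorphM -rmorphD lecR mulNr subr_ge0 mulr_sumr.
apply: le_trans (le_rsum_seq (s := [seq basis_vector a | a : 'I_(2 ^ n)]) _ _ _ _).
- rewrite big_map big_enum; apply: ler_sum => a _; rewrite basis_vectorE.
  by rewrite ler_wpM2r ?cle//; apply/Re_ge0/psd_rank1.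
- by move=> phi _; rewrite mulr_ge0 ?univ_prob_ge0//; apply/Re_ge0/psd_rank1.
- exact/universal_mx_rsummable/psd_rank1.
- by rewrite map_inj_uniq ?enum_uniq//; apply: basis_vector_inj.
- by move=> phi /mapP[a _ ->]; apply: basis_vector_unit.
Qed.

Lemma tens_1mx N : 1%:M *t 1%:M = 1%:M :> 'M[C]_(N * N).
Proof.
apply/matrixP => a b; rewrite !mxE -natrM mulnb -(inj_eq (can_inj (@mxtens_unindexK N N))).
by rewrite -pair_eqE.
Qed.

Lemma psd_1mx N : psd (1%:M : 'M[C]_N).
Proof. by move=> v; rewrite mulmx1 mxE sumr_ge0// => a _; rewrite !mxE mulrC mul_conjC_ge0. Qed.

(** With mu = c + nu and nu positive, the tensor square of mu is c^2 plus three positive tensor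
    products, hence B = c^-2. This B depends on n and e; it serves for convergence only and does not
    enter the final constant. *)
Lemma tests_trace_bound : exists2 B : R, 0 < B &
  forall M : 'M[C]_(2 ^ n * 2 ^ n), psd M ->
  complex.Re (\tr M) <= B * complex.Re (\tr (M *m (mu *t mu))).
Proof.
have [c c0 pc] := universal_mx_ge; exists (c * c)^-1 => [|M pM]; first by rewrite invr_gt0 mulr_gt0.
rewrite mulrC ler_pdivlMr ?mulr_gt0//.
have c0' : 0 <= c%:C%C :> C by rewrite lecR ltW.
have muE : mu = c%:C%C *: 1%:M + (mu - c%:C%C *: 1%:M) by rewrite addrC subrK.
have cp : psd (c%:C%C *: 1%:M : 'M[C]_(2 ^ n)) by apply: (psdZ c0'); exact: psd_1mx.
rewrite muE; move: (mu - _) pc => nu pnu.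
rewrite tensmxDl !tensmxDr tensmxZ tens_1mx !mulmxDr !mxtraceD.
rewrite -scalemxAr mulmx1 mxtraceZ.
have Re_add (x z : C) : complex.Re (x + z) = complex.Re x + complex.Re z.
  by case: x z => [? ?] [? ?].
rewrite !Re_add -rmorphM.
have -> : complex.Re ((c * c)%:C%C * \tr M) = complex.Re (\tr M) * (c * c).
  by case: (\tr M) => x z /=; ring.
by rewrite -addrA lerDl !addr_ge0//; apply/Re_ge0/trace_psd_tens.
Qed.

Lemma cvg_quad_Im N (s : nat -> 'M[C]_N) A v : mx_cvg s A ->
  complex.Im (quad (s k) v) @[k --> \oo] --> complex.Im (quad A v).
Proof.
move=> sA; have E (M : 'M[C]_N) : complex.Im (quad M v) = \sum_a \sum_b
    (complex.Im ((v a 0)^* * v b 0) * complex.Re (M a b) +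
     complex.Re ((v a 0)^* * v b 0) * complex.Im (M a b)).
  rewrite quadE Im_sum; apply: eq_bigr => a _; rewrite Im_sum; apply: eq_bigr => b _.
  rewrite mulrAC; move: ((v a 0)^* * v b 0) => z.
  by case: z (M a b) => [? ?] [? ?] /=; ring.
rewrite E; under eq_fun do rewrite E.
apply: cvg_bigsum => a; apply: cvg_bigsum => b.
by have [re im] := sA a b; apply: cvgD; apply: cvgMl_tmp.
Qed.

Lemma psd_lim N (s : nat -> 'M[C]_N) A : (forall k, psd (s k)) -> mx_cvg s A -> psd A.
Proof.
move=> ps sA v; rewrite -[X in 0 <= X]/(quad A v) lecE /=; apply/andP; split.
  have im0 k : complex.Im (quad (s k) v) = 0.
    by have := ps k v; rewrite lecE => /andP[/eqP->].
  have := @cvg_quad_Im _ _ _ v sA; under eq_fun do rewrite im0.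
  by move=> /(cvg_lim (@Rhausdorff R)) <-; rewrite lim_cst.
have cv := cvg_quad (v := v) sA; rewrite -(cvg_lim (@Rhausdorff R) cv).
apply: limr_ge; first by apply/cvg_ex; eexists; exact: cv.
by apply: nearW => k; apply/Re_ge0/ps.
Qed.

End LowerBound.

(** * The universal test *)

Section UniversalTest.
Variables (R : realType) (U : recfun).
Hypothesis hU : universal U.
Variables (e : seq bool) (n : nat).
Local Notation C := R[i].
Local Notation mu := (universal_mx R U e n).
Local Notation N := (2 ^ n * 2 ^ n)%N.

Lemma lower_computes_psd (q : seq bool) (M : 'M[C]_N) : lower_computes U e q M -> psd M.
Proof. by move=> [s [_ ps _ sM]]; apply: psd_lim sM. Qed.

(** Distinct matrices are thus computed by disjoint sets of programs, so their lower probabilities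
    add up to at most 1. *)
Lemma lower_computes_functional (q : seq bool) (M M' : 'M[C]_N) :
  lower_computes U e q M -> lower_computes U e q M' -> M = M'.
Proof.
move=> [s [so _ _ sM]] [s' [so' _ _ sM']].
have E : s = s' by apply/funext => k; apply: runs_functional (so k) (so' k).
rewrite -E in sM'; apply/matrixP => a b; have [re im] := sM a b; have [re' im'] := sM' a b.
apply/eqP; rewrite eq_complex; apply/andP; split; apply/eqP.
  by rewrite -(cvg_lim (@Rhausdorff R) re) -(cvg_lim (@Rhausdorff R) re').
by rewrite -(cvg_lim (@Rhausdorff R) im) -(cvg_lim (@Rhausdorff R) im').
Qed.

Lemma lower_prob_ge0 (M : 'M[C]_N) : 0 <= lower_prob U e M n.
Proof. by apply: rsum_ge0 => q _; apply: univ_prob_ge0. Qed.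

Lemma lower_prob_sum (S : seq 'M[C]_N) : uniq S ->
  \sum_(M <- S) lower_prob U e M n <= 1.
Proof.
move=> US; apply: rsum_fibers => // [M M' q|q|P UP _].
- exact: lower_computes_functional.
- exact: univ_prob_ge0.
exact: univ_prob_sum.
Qed.

Lemma lower_prob_ge (q : seq bool) (M : 'M[C]_N) : lower_computes U e q M ->
  univ_prob R U q (e, n) <= lower_prob U e M n.
Proof.
move=> qM; have := @le_rsum_seq R _ [set q | lower_computes U e q M]
  (fun q => univ_prob R U q (e, n)) [:: q].
rewrite big_seq1; apply=> // [t _||t]; first exact: univ_prob_ge0.
  apply: (@rsummable_bound _ _ _ _ 1) => s Us _.
  by under eq_bigr do rewrite ger0_norm ?univ_prob_ge0//; apply: univ_prob_sum.
by rewrite inE => /eqP->.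
Qed.

Lemma tensor_test_psd (M : 'M[C]_N) : tensor_tests U e mu mu M -> psd M.
Proof. by move=> [_ [q qM] _]; apply: lower_computes_psd qM. Qed.

Lemma universal_test_summable :
  mx_summable (tensor_tests U e mu mu) (fun M : 'M[C]_N => (lower_prob U e M n)%:C%C *: M).
Proof.
have [B B0 BP] := tests_trace_bound R hU e n.
have bound M a b : tensor_tests U e mu mu M ->
    `|complex.Re (M a b)| <= B /\ `|complex.Im (M a b)| <= B.
  move=> tM; have pM := tensor_test_psd tM; have [re im] := psd_entry_bound a b pM.
  have trB : complex.Re (\tr M) <= B.
    apply: le_trans (BP _ pM) _; rewrite ler_piMr ?(ltW B0)//.
    by case: tM => _ _; rewrite lecE => /andP[].
  by split; apply: le_trans trB.
move=> a b; split; apply: (@rsummable_bound _ _ _ _ B) => S US SD.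
all: apply: (@le_trans _ _ (\sum_(M <- S) lower_prob U e M n * B));
  last by rewrite -mulr_suml ler_piMl ?(ltW B0)// lower_prob_sum.
all: rewrite big_seq [leRHS]big_seq; apply: ler_sum => M /SD/(bound M a b)[re im].
all: rewrite mxE /=; case: (M a b) re im => x y /= re im.
all: by rewrite ?mul0r ?subr0 ?addr0 normrM ger0_norm ?lower_prob_ge0// ler_wpM2l ?lower_prob_ge0.
Qed.

(** All terms of the trace are nonnegative, and the one of M is kept. *)
Lemma universal_test_ge (A M : 'M[C]_N) : psd A -> tensor_tests U e mu mu M ->
  lower_prob U e M n * complex.Re (\tr (M *m A)) <=
  complex.Re (\tr (universal_test U e mu mu *m A)).
Proof.
move=> pA tM; have ge0 M' : tensor_tests U e mu mu M' ->
    0 <= \tr ((lower_prob U e M' n)%:C%C *: M' *m A).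
  move=> /tensor_test_psd pM; rewrite -scalemxAl mxtraceZ.
  by rewrite mulr_ge0 ?trace_psd_mul// lecR lower_prob_ge0.
rewrite /universal_test (mxsum_trace_ge0E universal_test_summable ge0) [complex.Re _]/=.
have := @le_rsum_seq R _ (tensor_tests U e mu mu) (fun M =>
  complex.Re (\tr ((lower_prob U e M n)%:C%C *: M *m A))) [:: M].
rewrite big_seq1 -scalemxAl mxtraceZ.
have -> (x : R) (z : C) : complex.Re (x%:C%C * z) = x * complex.Re z.
  by case: z => a b /=; rewrite mul0r subr0.
apply=> // [t /ge0/Re_ge0//||t]; last by rewrite inE => /eqP->.
exact: mx_summable_trace universal_test_summable.
Qed.

End UniversalTest.

(** * The inequality *)

Lemma elem_tensor_mx (R : realType) N c w (A B : 'M[rat[i]]_N) :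
  elem_mx R (tensor_mx c w A B) =
  (2 ^+ w / 2 ^+ c)%:C%C *: (elem_mx R A *t elem_mx R B).
Proof.
apply/matrixP => a b; rewrite !mxE.
move: (A _ _) (B _ _) => u v; rewrite /tensor_entry /=.
have scaleE : ratr (tensor_scale c w) = 2 ^+ w / 2 ^+ c :> R.
  rewrite /tensor_scale fmorph_div /= ratr_int ratr_nat.
  by rewrite -pmulrn !natrX.
move: (tensor_scale c w) scaleE => d dE.
apply/eqP; rewrite eq_complex /= !(rmorphD, rmorphM, rmorphN) /= !dE.
by move: (2 ^+ w / 2 ^+ c) => f; apply/andP; split; apply/eqP; ring.
Qed.

Lemma log2_EFin (R : realType) (x : R) : 0 < x -> log2 x = (ln x / ln 2)%:E.
Proof. by move=> x0; rewrite /log2 lne_EFin// -EFinM. Qed.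

Lemma log2_0 (R : realType) : log2 (0 : R) = -oo%E.
Proof.
rewrite /log2 le0_lneNy// mulNyr gtr0_sg ?mul1e// invr_gt0 ln_gt0//.
by rewrite ltr1n.
Qed.

Lemma lower_computes_const (R : realType) U e N q (M : 'M[rat[i]]_N) :
  psd (elem_mx R M) -> outputs U e q (fun _ => M) -> lower_computes U e q (elem_mx R M).
Proof.
move=> pM oM; exists (fun _ => M); split; first exact: oM.
- by move=> _; exact: pM.
- by move=> _ v; rewrite subrr mulmx0 mul0mx mxE lexx.
by move=> a b; split; apply: cvg_cst.
Qed.

Theorem theorem9 (R : realType) (U : recfun) (hU : universal U) :
  exists c : R,
  forall (n : nat) (E : nat -> 'M[R[i]%C]_(2 ^ n)) (e : seq bool),
    POVM E -> enumerates U e E ->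
  forall (sigma rho : 'M[R[i]%C]_(2 ^ n)) (i j : nat),
    semi_density sigma -> semi_density rho ->
    let Iij := mutual_info U i j (e, n) in
    (Iij%:~R%:E + log2 (measure_prob E sigma i * measure_prob E rho j)
       - (Kpref U Iij (e, n))%:R%:E
     <= quantum_mutual_info U e sigma rho + c%:E)%E.
Proof.
have [H HU] := evaluator_exists U.
have [c cP] := measurement_coding R hU.
have [t tP] := tensor_machine hU HU (c + c).
have [c' c'P] := pair_machine hU HU t.
(* One [c] for each factor in the normalization of M, and [c'] for the length of the program that
   produces the program of M. *)
exists (c + c + c')%:R => n E e EP enumE sigma rho i j [psigma _] [prho _].
cbv zeta; set Iij := mutual_info U i j (e, n).
have [s [s_outputs sE]] := enumE.
have [[p1 p1P sz1] _] := KprefP hU (i, j) (e, n).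
have [[p2 p2P sz2] _] := KprefP hU Iij (e, n).
have [p pP lep] := c'P e n i j Iij p1 p2 p1P p2P.
set Ki := Kpref U i (e, n); set Kj := Kpref U j (e, n).
have wE : absz (Iij + Posz (size p1))%R = (Ki + Kj)%N.
  by rewrite sz1 /Iij /mutual_info subrK -PoszD.
rewrite wE in pP; set w := (Ki + Kj)%N in wE pP.
set q := t ++ _ in pP.
pose M := elem_mx R (tensor_mx (c + c) w (s i) (s j)).
have ME : M = (2 ^+ w / 2 ^+ (c + c))%:C%C *: (E i *t E j) by rewrite /M elem_tensor_mx !sE.
set g := 2 ^+ w / 2 ^+ (c + c) in ME.
have g0 : 0 < g by rewrite divr_gt0 ?exprn_gt0.
have pE k : psd (E k) by apply: EP.1.
have qM : lower_computes U e q M.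
  apply: lower_computes_const; last exact: tP.
  rewrite -/M ME; apply: psdZ; first by rewrite lecR ltW.
  exact: (psd_tens (pE i) (pE j)).
pose mu := universal_mx R U e n; have pmu : psd mu by apply: universal_mx_psd.
have prob (nu : 'M[R[i]%C]_(2 ^ n)) k : psd nu -> \tr (E k *m nu) = (measure_prob E nu k)%:C%C.
  by move=> pnu; apply: ge0_ReE; exact: (trace_psd_mul (pE k) pnu).
have prob_ge0 (nu : 'M[R[i]%C]_(2 ^ n)) k : psd nu -> 0 <= measure_prob E nu k.
  by move=> pnu; apply: Re_ge0; exact: (trace_psd_mul (pE k) pnu).
have traceM (nu nu' : 'M[R[i]%C]_(2 ^ n)) : psd nu -> psd nu' -> \tr (M *m (nu *t nu')) =
    (g * (measure_prob E nu i * measure_prob E nu' j))%:C%C.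
  move=> pnu pnu'; rewrite ME -scalemxAl mxtraceZ trace_tens_mul !prob//.
  by rewrite -!rmorphM.
have tM : tensor_tests U e mu mu M.
  split; [by exists (g%:C%C *: E i), (E j); rewrite -[E j]scale1r tensmxZ mulr1|by exists q|].
  (* The trace is 2^(K(i) + K(j) - 2c) times the probabilities of i and j under mu, which the coding
     bound limits to 2^(c - K(i)) and 2^(c - K(j)). *)
  rewrite traceM// lecR /g mulrAC ler_pdivrMr ?exprn_gt0// mul1r.
  have := cP n e E i EP enumE; have := cP n e E j EP enumE.
  rewrite -/Ki -/Kj -/mu -/(measure_prob E mu i) -/(measure_prob E mu j) => lej lei.
  have := ler_pM (prob_ge0 mu i pmu) (prob_ge0 mu j pmu) lei lej.
  rewrite -(ler_pM2l (exprn_gt0 w (ltr0n R 2))) => /le_trans -> //.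
  rewrite /w !exprD !exprVn; set a := 2 ^+ Ki; set b := 2 ^+ Kj; set d := 2 ^+ c.
  by rewrite mulrACA [a * _]mulrC [b * _]mulrC !divfK ?expf_neq0.
set P := measure_prob E sigma i * measure_prob E rho j.
have P_ge0 : 0 <= P by rewrite mulr_ge0 ?prob_ge0.
set X := complex.Re (\tr (universal_test U e mu mu *m (sigma *t rho))).
have leX : 2^-1 ^+ size p * (g * P) <= X.
  apply: le_trans (universal_test_ge hU (psd_tens psigma prho) tM).
  rewrite traceM// -/P [complex.Re _]/=.
  rewrite ler_wpM2r ?(mulr_ge0 (ltW g0))//.
  apply: le_trans; first exact: (univ_prob_ge R hU pP).
  exact: (lower_prob_ge hU qM).
rewrite /quantum_mutual_info -/mu -/X; clearbody P X.
(* If one of the probabilities vanishes, the left side is minus infinity. *)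
have [P0|PNZ] := eqVneq P 0; first by rewrite P0 log2_0 addeNy addNye leNye.
have P_gt0 : 0 < P by rewrite lt_def PNZ.
have lb_gt0 : 0 < 2^-1 ^+ size p * (g * P).
  by apply: mulr_gt0; [rewrite exprn_gt0 ?invr_gt0|exact: mulr_gt0].
rewrite !log2_EFin//; last exact: lt_le_trans leX.
rewrite -EFinB -!EFinD lee_fin.
have ln2 : 0 < ln 2 :> R by rewrite ln_gt0// ltr1n.
have lnX : ln P / ln 2 + w%:R - (c + c)%:R - (size p)%:R <= ln X / ln 2.
  rewrite ler_pdivlMr//; have : ln (2^-1 ^+ size p * (g * P)) <= ln X.
    by rewrite ler_ln ?posrE//; apply: lt_le_trans leX.
  rewrite !lnM ?posrE ?invr_gt0 ?exprn_gt0 ?mulr_gt0 ?invr_gt0 ?exprn_gt0//.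
  have lnE k : ln (2 ^+ k) = k%:R * ln 2 :> R by rewrite lnXn// mulr_natl.
  rewrite exprVn !lnV ?posrE ?exprn_gt0// !lnE; apply: le_trans.
  rewrite !mulrBl mulrDl divfK ?gt_eqF//.
  move: (ln P) (ln 2) (size p)%:R (c + c)%:R w%:R => u v x y z; lra.
have IE : Iij%:~R = w%:R - (size p1)%:R :> R.
  by rewrite sz1 /Iij /mutual_info intrB intrD /w natrD -!pmulrn.
have : (size p)%:R <= (size p1)%:R + (size p2)%:R + c'%:R :> R by rewrite -!natrD ler_nat.
rewrite -sz2 IE natrD; move: lnX; lra.
Qed.
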